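(* Suppose $\theta_n\to\infty$ as $n\to\infty$. Let $\{R^{(k)}\}$ be the opinion process on $G_n$ and $\{\mathcal{R}^{(k)}\}$ the approximating process defined in the context. Fix $k\ge 0$ and define random variables $(\{\boldsymbol{\mathcal{R}}_\emptyset^{(m)}:0\le m\le k\},\mathcal{J}_\emptyset)$ by $$P(\mathcal{J}_\emptyset=s)=\pi_s,\qquad 1\le s\le K,$$ $$P\left(\left.(\boldsymbol{\mathcal{R}}_\emptyset^{(0)},\dots,\boldsymbol{\mathcal{R}}_\emptyset^{(k)})\in A\,\right|\,\mathcal{J}_\emptyset=s\right)=\mathbb{P}_n\left((\boldsymbol{\mathcal{R}}_i^{(0)},\dots,\boldsymbol{\mathcal{R}}_i^{(k)})\in A\right),\qquad A\subseteq([-1,1]^\ell)^{k+1}\ \text{measurable},$$ where $i$ is any vertex belonging to community $s$. Let $V_{k,i}\in[-1,1]^{\ell\times(k+1)}$ be the matrix with $j$th column $(\mathbf{R}_i^{(j-1)})^\top$, and let $\mathcal{V}_k\in[-1,1]^{\ell\times(k+1)}$ be the matrix with $j$th column $(\boldsymbol{\mathcal{R}}_\emptyset^{(j-1)})^\top$, $1\le j\le k+1$. Then, for any $1\le r\le K$ and any bounded function $f:[-1,1]^{\ell\times(k+1)}\to\mathbb{R}$ that is continuous with respect to the operator norm $\|\cdot\|_1$, $$\frac1n\sum_{i=1}^nf(V_{k,i})\,1(J_i=r)\ \xrightarrow{P}\ E\left[f(\mathcal{V}_k)\,1(\mathcal{J}_\emptyset=r)\right]\qquad\text{as }n\to\infty.$$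 Furthermore, for any arbitrary collection of vertices $\{i_1,\dots,i_m\}\subseteq V_n$ having community labels $\{r_1,\dots,r_m\}$, $m\ge 1$, and any bounded functions $f_1,\dots,f_m$ on $[-1,1]^{\ell\times(k+1)}$ that are continuous with respect to $\|\cdot\|_1$, $$\mathbb{E}_n\left[\prod_{j=1}^mf_j(V_{k,i_j})\right]\ \xrightarrow{P}\ \prod_{j=1}^mE\left[\left.f_j(\mathcal{V}_k)\,\right|\,\mathcal{J}_\emptyset=r_j\right],\qquad n\to\infty.$$
   Context: Parameters. Fix integers $K,\ell\ge 1$ (communities, topics), $c,d\in[0,1]$ with $0<c+d\le 1$ and $d>0$, a finite constant $H>0$, a nonnegative kernel $\kappa:\{1,\dots,K\}^2\to[0,\infty)$, distributions $F_r$ on $[-1,1]^\ell$ ($1\le r\le K$), distributions $G_{r,s}$ on $[0,H]$ ($1\le r,s\le K$), and a family of distributions $\nu(\mathbf{a})$, $\mathbf{a}\in\{1,\dots,K\}\times[-1,1]^\ell$. Let $\theta_n>0$ be a density parameter with $\limsup_{n\to\infty}\max_{1\le r,s\le K}\kappa(r,s)\theta_n/n\le 1$. All random objects live on one probability space $(\Omega,\mathcal{F},P)$. Random graph. For each $n$, $G_n=(V_n,E_n)$ is a directed random graph with $|V_n|=n$. Vertex $i$ has community label $J_i\in\{1,\dots,K\}$; $\mathscr{J}_n=\{J_i:i\in V_n\}$, $\mathbb{E}_n[\cdot]=E[\cdot\mid\mathscr{J}_n]$, and $\mathbb{P}_n$ is the corresponding conditional probability. Given $\mathscr{J}_n$,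 the edge $(i,j)$ (written $i\to j$: $j$ listens to $i$) is present with probability $p_{ij}^{(n)}=\frac{\kappa(J_i,J_j)\theta_n}{n}\wedge 1$, independently of everything else. Assume $\pi_r^{(n)}:=\frac1n\sum_{i=1}^n 1(J_i=r)\xrightarrow{P}\pi_r$ for every $r$, where $(\pi_1,\dots,\pi_K)$ is a probability vector with all $\pi_r>0$. Internal beliefs $\mathbf{Q}_i\in[-1,1]^\ell$ are sampled from $F_{J_i}$; the attribute of $i$ is $\mathbf{A}_i=(J_i,\mathbf{Q}_i)$. Unnormalized weights $\{B_{ij}\}$ are conditionally independent given the labels, with $B_{ij}\sim G_{J_i,J_j}$. Normalized weights: $$C_{ij}=\frac{B_{ij}1(j\to i)}{\sum_{l\in V_n}B_{il}1(l\to i)}\,1\Big(\sum_{l\in V_n}B_{il}1(l\to i)>0,\ i\ne j\Big).$$ Opinion process. $R^{(k)}\in[-1,1]^{n\times\ell}$ has $i$th row $\mathbf{R}_i^{(k)}$ and satisfies $$\mathbf{R}_i^{(k+1)}=c\sum_{j\in V_n}C_{ij}\mathbf{R}_j^{(k)}+\mathbf{W}_i^{(k+1)}+(1-c-d)\mathbf{R}_i^{(k)},\quad k\ge 0,$$ with external signals $\mathbf{W}_i^{(k)}=d\,\mathbf{Z}_i^{(k)}+c\,\mathbf{Q}_i1(d_i^-=0)\in[-1,1]^\ell$, where $d_i^-=\sum_{j\in V_n}1(j\to i)$. Given the graph and attributes, the media signals $\mathbf{Z}_i^{(k)}$ are independent over $i$ and $k$, independent of $R^{(0)}$, with $\{\mathbf{Z}_i^{(k)}:k\ge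 0\}$ i.i.d. with law $\nu(\mathbf{A}_i)$. The rows $\{\mathbf{R}_i^{(0)}:J_i=r\}$ of the initial matrix are identically distributed for each $r$; given $\mathscr{J}_n$, the rows of $R^{(0)}$ are conditionally independent of each other and $R^{(0)}$ is conditionally independent of the edges and the weights. Dependence of the process on $n$ is suppressed in the notation. Constants. $\beta_{r,s}=E[B_{ij}\mid J_i=r,J_j=s]$. $M\in[0,1]^{K\times K}$ has entries $$m_{rs}=\frac{\pi_s\beta_{r,s}\kappa(s,r)}{\sum_{t=1}^K\pi_t\beta_{r,t}\kappa(t,r)}\,1\Big(\sum_{t=1}^K\pi_t\beta_{r,t}\kappa(t,r)>0\Big).$$ $\bar W,\bar R\in[-1,1]^{K\times\ell}$ have $r$th rows $E[\mathbf{W}_i^{(0)}\mid J_i=r]$ and $E[\mathbf{R}_i^{(0)}\mid J_i=r]$. Approximating process. $\mathcal{R}^{(0)}=R^{(0)}$ and, for $k\ge 1$, $\mathcal{R}^{(k)}$ has $i$th row $$\boldsymbol{\mathcal{R}}_i^{(k)}=\sum_{t=0}^{k-1}(1-c-d)^t\mathbf{W}_i^{(k-t)}+1(k\ge 2)\sum_{t=1}^{k-1}\sum_{s=1}^ta_{s,t}(M^s\bar W)_{J_i\bullet}+\sum_{s=1}^ka_{s,k}(M^s\bar R)_{J_i\bullet}+(1-c-d)^k\mathbf{R}_i^{(0)},$$ where $a_{s,t}=\binom{t}{s}(1-c-d)^{t-s}c^s$ (with $0^0=1$) and $X_{j\bullet}$ denotes the $j$th row of a matrix $X$. The rows of the approximating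 process are conditionally independent given $\mathscr{J}_n$, and the conditional law of the $i$th row's trajectory depends on $i$ only through $J_i$. For a matrix, $\|X\|_1$ is the operator norm induced by the vector $\ell_1$ norm. $\xrightarrow{P}$ denotes convergence in probability.
   Formalization: The approximating process can leave [-1,1] (in-degree 0, all signals and opinions 1: value 1+c at k=1), so f on the cube need not be defined at the root; f, f_j are taken bounded and continuous on all ℓ×(k+1) matrices, and the limit may depend on n and the labels. *)

(* Defs.v *)
From HB Require Import structures.
From mathcomp Require Import all_boot all_order all_algebra.
From mathcomp Require Import all_classical all_reals all_analysis.

Set Implicit Arguments.
Unset Strict Implicit.
Unset Printing Implicit Defensive.

Import Order.TTheory GRing.Theory Num.Theory.
Import numFieldNormedType.Exports.

Local Open Scope classical_set_scope.
Local Open Scope ring_scope.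

(* The sigma-algebra on real matrices generated by the entries, i.e. the Borel
   sigma-algebra of R^(m x n). *)
Definition mx_display : measure_display.
Proof. by constructor. Qed.

Section measurable_matrix.
Context {R : realType} (m n : nat).

Definition mx_cylinders : set_system 'M[R]_(m, n) :=
  [set A | exists i j (B : set R),
     measurable B /\ A = (fun X : 'M[R]_(m, n) => X i j) @^-1` B].

Definition mx_measurable := <<s mx_cylinders >>.

Let mx_measurable0 : mx_measurable set0.
Proof. exact: sigma_algebra0. Qed.

Let mx_measurableC A : mx_measurable A -> mx_measurable (~` A).
Proof. exact: sigma_algebraC. Qed.

Let mx_measurable_bigcup (F : (set 'M[R]_(m, n))^nat) :
  (forall i, mx_measurable (F i)) -> mx_measurable (\bigcup_i F i).
Proof. exact: sigma_algebra_bigcup. Qed.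

HB.instance Definition _ := @isMeasurable.Build mx_display 'M[R]_(m, n)
  mx_measurable mx_measurable0 mx_measurableC mx_measurable_bigcup.

End measurable_matrix.

Definition cube {R : realType} (m n : nat) : set 'M[R]_(m, n) :=
  [set X | forall i j, `|X i j| <= 1].

Section operator_norm.
Context {R : realType}.

Definition norm1 n (v : 'cV[R]_n) : R := \sum_i `|v i 0|.

Definition opnorm1 m n (X : 'M[R]_(m, n)) : R :=
  sup [set norm1 (X *m v) | v in [set v : 'cV[R]_n | norm1 v <= 1]].

(* Test functions are continuous on the whole matrix space: the opinion process
   stays in the cube, but the approximating process can leave it (a vertex of
   in-degree 0 receives c * Q_i on top of the averaged terms). A continuous
   function on the cube extends by composing it with entrywise truncation. *)
Definition continuous1 m n (f : 'M[R]_(m, n) -> R) : Prop :=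
  forall X eps, 0 < eps -> exists2 delta, 0 < delta &
    forall Y, opnorm1 (Y - X) < delta -> `|f Y - f X| < eps.

Definition bounded_function T (f : T -> R) : Prop :=
  exists C, forall X, `|f X| <= C.

End operator_norm.

Section elementary_conditioning.
Context {R : realType} d (T : measurableType d) (P : probability T R).

(* Both are 0 when P E = 0. *)
Definition condP (E A : set T) : R := fine (P (A `&` E)) / fine (P E).

Definition condE (E : set T) (X : T -> R) : R :=
  (\int[P]_(w in E) X w) / fine (P E).

(* The limit may be random and depend on n: convergence in probability to 0 of
   the difference. *)
Definition cvg_in_prob (X Y : nat -> T -> R) : Prop :=
  forall eps, 0 < eps ->
    P [set w | eps <= `|X n w - Y n w|] @[n --> \oo] --> 0%E.

End elementary_conditioning.

Record opinion_params (R : realType) := OpinionParams {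
  K : nat;
  l : nat;
  c : R;
  d : R;
  H : R;
  kappa : 'I_K -> 'I_K -> R;
  F : 'I_K -> probability 'rV[R]_l R;
  G : 'I_K -> 'I_K -> probability (measurableTypeR R) R;
  nu : 'I_K -> R.-pker 'rV[R]_l ~> 'rV[R]_l;
  theta : nat -> R;
  pi : 'I_K -> R }.

Section opinion_dynamics.
Context {R : realType} (S : opinion_params R).
Local Notation K := (K S).
Local Notation l := (l S).
Local Notation c := (c S).
Local Notation d := (d S).
Local Notation H := (H S).
Local Notation kappa := (@kappa R S).
Local Notation F := (@F R S).
Local Notation G := (@G R S).
Local Notation nu := (@nu R S).
Local Notation theta := (@theta R S).
Local Notation pi := (@pi R S).

Record params_ok : Prop := ParamsOk {
  K_ge1 : (1 <= K)%N;
  l_ge1 : (1 <= l)%N;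
  c_range : 0 <= c <= 1;
  d_range : 0 <= d <= 1;
  cd_range : 0 < c + d <= 1;
  d_gt0 : 0 < d;
  H_gt0 : 0 < H;
  kappa_ge0 : forall r s, 0 <= kappa r s;
  F_supp : forall r, F r (cube (m := 1) (n := l)) = 1%E;
  G_supp : forall r s, G r s [set x | 0 <= x <= H] = 1%E;
  theta_gt0 : forall n, 0 < theta n;
  theta_sparse :
    (limn_esup (fun n =>
       (\big[Num.max/0]_(r < K) \big[Num.max/0]_(s < K)
          (kappa r s * theta n / n%:R))%:E) <= 1)%E;
  pi_gt0 : forall r, 0 < pi r;
  pi_sum1 : \sum_r pi r = 1 }.

Definition labels (n : nat) := {ffun 'I_n -> 'I_K}.

Definition edge_prob n (x : labels n) (i j : 'I_n) : R :=
  Num.min (kappa (x i) (x j) * theta n / n%:R) 1.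

(* The first index is the number of vertices, and V_n = 'I_n.
   arc n i j w holds when i -> j is an edge. *)
Record opinion_inputs (Omega : Type) := OpinionInputs {
  J : forall n, 'I_n -> Omega -> 'I_K;
  arc : forall n, 'I_n -> 'I_n -> Omega -> bool;
  B : forall n, 'I_n -> 'I_n -> Omega -> R;
  Q : forall n, 'I_n -> Omega -> 'rV[R]_l;
  Z : forall n, 'I_n -> nat -> Omega -> 'rV[R]_l;
  R0 : forall n, 'I_n -> Omega -> 'rV[R]_l }.

Section process.
Context (Omega : Type) (U : opinion_inputs Omega).
Local Notation J := (J U).
Local Notation arc := (arc U).
Local Notation B := (B U).
Local Notation Q := (Q U).
Local Notation Z := (Z U).
Local Notation R0 := (R0 U).

Definition Jn n (w : Omega) : labels n := [ffun i => J i w].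

Definition labels_are n (x : labels n) : set Omega := [set w | Jn n w = x].

Definition weight_sum n (i : 'I_n) w : R := \sum_j B i j w * (arc j i w)%:R.

Definition C n w : 'M[R]_n :=
  \matrix_(i, j) if (0 < weight_sum i w) && (i != j)
                 then B i j w * (arc j i w)%:R / weight_sum i w else 0.

Definition indeg n (i : 'I_n) w : nat := \sum_(j < n) arc j i w.

Definition W n (i : 'I_n) (k : nat) w : 'rV[R]_l :=
  d *: Z i k w + (c * (indeg i w == 0%N)%:R) *: Q i w.

Fixpoint Rproc n (k : nat) w : 'M[R]_(n, l) :=
  if k is k'.+1 then
    c *: (C n w *m Rproc n k' w) + \matrix_(i < n) W i k w
    + (1 - c - d) *: Rproc n k' w
  else \matrix_(i < n) R0 i w.

Definition V n (k : nat) (i : 'I_n) w : 'M[R]_(l, k.+1) :=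
  \matrix_(u, b) Rproc n b w i u.

End process.

Definition a (s t : nat) : R := 'C(t, s)%:R * (1 - c - d) ^+ (t - s) * c ^+ s.

Definition M (beta : 'I_K -> 'I_K -> R) : 'M[R]_K :=
  \matrix_(r, s)
    let D := \sum_t pi t * beta r t * kappa t r in
    if 0 < D then pi s * beta r s * kappa s r / D else 0.

Definition Rapprox Omega (U : opinion_inputs Omega) (beta : 'I_K -> 'I_K -> R)
    (Wbar Rbar : 'M[R]_(K, l)) n (i : 'I_n) (k : nat) w : 'rV[R]_l :=
  if k == 0%N then R0 U i w else
  \sum_(0 <= t < k) (1 - c - d) ^+ t *: W U i (k - t) w
  + \sum_(1 <= t < k) \sum_(1 <= s < t.+1)
      a s t *: row (J U i w) (M beta ^+ s *m Wbar)
  + \sum_(1 <= s < k.+1) a s k *: row (J U i w) (M beta ^+ s *m Rbar)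
  + (1 - c - d) ^+ k *: R0 U i w.

Section model.
Context d1 (Omega : measurableType d1) (P : probability Omega R).

Definition vertex_counts (U : opinion_inputs Omega) (r : 'I_K) n w : R :=
  n%:R^-1 * \sum_(i < n) (J U i w == r)%:R.

(* [joint_law] gives the law of all inputs conditionally on the labels, on a
   generating pi-system: edges, weights and the pairs (Q_i, R0_i) are mutually
   independent, and, given those, the Z_i^(t) are independent with law
   nu(J_i, Q_i). The pairs (i, i) are treated like the others. *)
Record is_opinion_model (U : opinion_inputs Omega) : Prop := IsOpinionModel {
  J_meas : forall n (i : 'I_n) r, measurable [set w | J U i w = r];
  arc_meas : forall n (i j : 'I_n), measurable [set w | arc U i j w];
  B_meas : forall n (i j : 'I_n), measurable_fun setT (B U i j);
  Q_meas : forall n (i : 'I_n), measurable_fun setT (Q U i);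
  Z_meas : forall n (i : 'I_n) k, measurable_fun setT (Z U i k);
  R0_meas : forall n (i : 'I_n), measurable_fun setT (R0 U i);
  B_range : forall n (i j : 'I_n) w, 0 <= B U i j w <= H;
  Q_cube : forall n (i : 'I_n) w, cube (Q U i w);
  W_cube : forall n (i : 'I_n) k w, cube (W U i k w);
  Rproc_cube : forall n k w, cube (Rproc U n k w);
  label_lln : forall r, cvg_in_prob P (vertex_counts U r) (fun _ _ => pi r);
  joint_law : forall n (x : labels n), (0 < P (labels_are U x))%E ->
    forall (b : 'I_n -> 'I_n -> bool) (A : 'I_n -> 'I_n -> set R)
      (D : 'I_n -> set ('rV[R]_l * 'rV[R]_l)%type)
      (tau : nat) (Y : 'I_n -> nat -> set 'rV[R]_l),
    (forall i j, measurable (A i j)) -> (forall i, measurable (D i)) ->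
    (forall i t, measurable (Y i t)) ->
    condP P (labels_are U x)
      [set w | [/\ forall i j, arc U i j w = b i j,
                   forall i j, A i j (B U i j w),
                   forall i, D i (Q U i w, R0 U i w) &
                   forall i t, (t < tau)%N -> Y i t (Z U i t w)]]
    = (\prod_i \prod_j (if b i j then edge_prob x i j else 1 - edge_prob x i j))
      * (\prod_i \prod_j fine (G (x i) (x j) (A i j)))
      * \prod_i condE P (labels_are U x)
          (fun w => \1_(D i) (Q U i w, R0 U i w)
                    * \prod_(t < tau) fine (nu (x i) (Q U i w) (Y i t)));
  Q_law : forall n (x : labels n), (0 < P (labels_are U x))%E ->
    forall i (A : set 'rV[R]_l), measurable A ->
    condP P (labels_are U x) [set w | A (Q U i w)] = fine (F (x i) A);
  R0_law : forall n (x y : labels n), (0 < P (labels_are U x))%E ->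
    (0 < P (labels_are U y))%E ->
    forall i j (A : set 'rV[R]_l), x i = y j -> measurable A ->
    condP P (labels_are U x) [set w | A (R0 U i w)]
    = condP P (labels_are U y) [set w | A (R0 U j w)] }.

(* The constants are defined by conditioning on events of positive probability;
   their values do not depend on the vertices used. *)
Record is_beta (U : opinion_inputs Omega) (beta : 'I_K -> 'I_K -> R) : Prop :=
  IsBeta { betaE : forall n (i j : 'I_n) r s,
    (0 < P [set w | J U i w = r /\ J U j w = s])%E ->
    beta r s = condE P [set w | J U i w = r /\ J U j w = s] (B U i j) }.

Record is_label_mean (U : opinion_inputs Omega)
    (X : forall n, 'I_n -> Omega -> 'rV[R]_l) (Xbar : nat -> 'M[R]_(K, l)) :
    Prop := IsLabelMean {
  label_mean_cube : forall n, cube (Xbar n);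
  label_meanE : forall n (i : 'I_n) r, (0 < P [set w | J U i w = r])%E ->
    forall u, Xbar n r u = condE P [set w | J U i w = r] (fun w => X n i w 0 u)
}.

Section root.
Context d2 (Omega' : measurableType d2) (P' : probability Omega' R) (k : nat).

(* The conditional law given J_n, hence the law of the root, is a function of
   n and of the realised labels x. *)
Record is_root (U : opinion_inputs Omega) (beta : 'I_K -> 'I_K -> R)
    (Wbar Rbar : nat -> 'M[R]_(K, l))
    (Jroot : forall n, labels n -> Omega' -> 'I_K)
    (Rroot : forall n, labels n -> 'I_k.+1 -> Omega' -> 'rV[R]_l) : Prop :=
  IsRoot {
  Jroot_meas : forall n (x : labels n) s, measurable [set w | Jroot n x w = s];
  Rroot_meas : forall n (x : labels n) b, measurable_fun setT (Rroot n x b);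
  Jroot_law : forall n (x : labels n) s,
    P' [set w | Jroot n x w = s] = (pi s)%:E;
  Rroot_law : forall n (x : labels n), (0 < P (labels_are U x))%E ->
    forall s i (A : set (k.+1.-tuple 'rV[R]_l)), x i = s -> measurable A ->
    condP P' [set w | Jroot n x w = s]
      [set w | A [tuple Rroot n x b w | b < k.+1]]
    = condP P (labels_are U x)
      [set w | A [tuple Rapprox U beta (Wbar n) (Rbar n) i b w | b < k.+1]] }.

Definition Vroot (Rroot : forall n, labels n -> 'I_k.+1 -> Omega' -> 'rV[R]_l)
    n (x : labels n) w : 'M[R]_(l, k.+1) :=
  \matrix_(u, b) Rroot n x b w 0 u.

End root.
End model.
End opinion_dynamics.

(* Main.v *)
Require Import Defs.
From mathcomp Require Import all_boot all_order all_algebra.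
From mathcomp Require Import all_classical all_reals all_analysis.
From mathcomp Require Import measurable_realfun.
From mathcomp Require Import lra ring.

(** Fix the labels. The arcs, the weights and the data (Q_i, R0_i, Z_i) of each
    vertex are then independent. Since [theta n] tends to infinity, a vertex has
    many in-neighbours, and a weighted average over them is a quotient of two
    sums of many independent small terms. By the law of large numbers it is close
    to the quotient of the means, which is the mean field [M *m rho] driving the
    approximating process. So one step of the dynamics differs little from one
    step of the approximating recursion, except that the in-neighbours bring
    their own errors.

    Laws of large numbers come from second moments
    ([in_sum_concentration]); the two sums are handled in [C_small] and
    [avg_small], and the error of one step in [innov_small]. To sum the errors
    over several steps, follow the listening relation backwards from a vertex:
    the error after [k] steps is bounded by a weighted sum over walks of length
    at most [k] ([error_walk]). Along a walk that does not revisit a vertex, the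
    rows of the weight matrix are independent of each other and of the error at
    its end, and they are substochastic; a walk that does revisit a vertex costs
    a factor bounded by the mean weight of an edge, which is small. This gives
    [condE_walk], and with it [process_close]: in mean, every opinion is close to
    its approximation, uniformly in the vertex, as soon as the labels have
    frequencies near their limits and the number of vertices is large. Such
    labels are called typical ([typ]); they carry almost all the probability
    ([bad_labels_vanish]).

    Two points need care. The approximating row of a vertex involves the
    indicator that its in-degree is 0, which depends on the arcs; in the walk
    argument this indicator is replaced by its limit, which depends on the
    community only ([isodev_small]), so that the in-neighbours enter through
    their own data alone. Also the approximating process uses the mean [Wbar]
    given the label of one vertex, rather than given all labels; the two means
    are compared by summing over all vertices ([Wbar_close]).

    Bounded continuous test functions are almost Lipschitz on boxes
    ([box_lipschitz]), so they inherit the approximation. The rows of the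
    approximating process are independent and have the law of the root, which
    yields the product formula ([product_test]) and, by a variance bound, the
    convergence of the averages ([average_test]). Since both hold for typical
    labels, they hold in probability ([typ_cvg0], [typ_cvg_in_prob]). *)

Set Implicit Arguments.
Unset Strict Implicit.
Unset Printing Implicit Defensive.
Import Order.TTheory GRing.Theory Num.Theory.
Import numFieldNormedType.Exports.
Local Open Scope classical_set_scope.
Local Open Scope ring_scope.

(** * Bounded measurable functions *)

Section bounded_measurable.
Context {R : realType} d (T : measurableType d).
Implicit Types f g : T -> R.

(** The domain of the conditional expectations below; boundedness makes every
    function integrable on every event. *)
Definition bmf f := measurable_fun setT f /\ bounded_function f.

Lemma bounded_nneg T' (f : T' -> R) : bounded_function f ->
  exists2 C : R, 0 <= C & forall x, `|f x| <= C.
Proof.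
move=> [C fC]; exists `|C| => // x; exact: le_trans (fC x) (ler_norm _).
Qed.

Lemma bmf_cst (r : R) : bmf (fun=> r).
Proof. by split; [exact: measurable_cst|exists `|r|]. Qed.

Lemma bmf_add f g : bmf f -> bmf g -> bmf (fun w => f w + g w).
Proof.
move=> [mf [a fa]] [mg [b gb]]; split; first exact: measurable_funD.
by exists (a + b) => w; apply: le_trans (ler_normD _ _) _; exact: lerD.
Qed.

Lemma bmf_mul f g : bmf f -> bmf g -> bmf (fun w => f w * g w).
Proof.
move=> [mf [a fa]] [mg [b gb]]; split; first exact: measurable_funM.
by exists (a * b) => w; rewrite normrM ler_pM.
Qed.

Lemma bmf_scale r f : bmf f -> bmf (fun w => r * f w).
Proof. by move=> ?; apply: bmf_mul => //; exact: bmf_cst. Qed.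

Lemma bmf_sub f g : bmf f -> bmf g -> bmf (fun w => f w - g w).
Proof.
move=> mf mg; under eq_fun do rewrite -mulN1r.
by apply: bmf_add => //; exact: bmf_scale.
Qed.

Lemma bmf_norm f : bmf f -> bmf (fun w => `|f w|).
Proof.
move=> [mf [C fC]]; split; last by exists C => w; rewrite normr_id.
exact: measurableT_comp.
Qed.

Lemma bmf_sum (I : eqType) (s : seq I) (h : I -> T -> R) :
  (forall i, i \in s -> bmf (h i)) -> bmf (fun w => \sum_(i <- s) h i w).
Proof.
elim: s => [|i s IH] mh.
  by under eq_fun do rewrite big_nil; exact: bmf_cst.
under eq_fun do rewrite big_cons; apply: bmf_add.
  by apply: mh; rewrite mem_head.
by apply: IH => j js; apply: mh; rewrite inE js orbT.
Qed.

Lemma bmf_prod (I : eqType) (s : seq I) (h : I -> T -> R) :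
  (forall i, i \in s -> bmf (h i)) -> bmf (fun w => \prod_(i <- s) h i w).
Proof.
elim: s => [|i s IH] mh.
  by under eq_fun do rewrite big_nil; exact: bmf_cst.
under eq_fun do rewrite big_cons; apply: bmf_mul.
  by apply: mh; rewrite mem_head.
by apply: IH => j js; apply: mh; rewrite inE js orbT.
Qed.

Lemma bmf_indic (A : set T) : measurable A -> bmf \1_A.
Proof.
move=> mA; split; first exact: measurable_indic.
by exists 1 => x; rewrite indicE; case: (x \in A); rewrite ?normr1 ?normr0.
Qed.

Lemma bmf_bool (b : T -> bool) : measurable [set w | b w] ->
  bmf (fun w => (b w)%:R).
Proof.
move=> mb; have := bmf_indic mb; congr bmf; apply/funext => w.
rewrite indicE; congr (_%:R); case bw: (b w); first by rewrite mem_set.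
by rewrite memNset //= bw.
Qed.

(** Every bounded measurable function is a uniform limit of step functions
    with values in a grid; a linear and uniformly closed property therefore
    only has to be checked on indicators. *)
Lemma bmf_ind (H : (T -> R) -> Prop) :
  (forall A, measurable A -> H \1_A) ->
  (forall f g, bmf f -> bmf g -> H f -> H g -> H (fun w => f w + g w)) ->
  (forall r f, bmf f -> H f -> H (fun w => r * f w)) ->
  (forall f, bmf f ->
     (forall e : R, 0 < e -> exists g, [/\ bmf g, H g &
        forall w, `|f w - g w| <= e]) -> H f) ->
  forall f, bmf f -> H f.
Proof.
move=> Hi Ha Hs Hc f mf; apply: (Hc _ mf) => e e0.
have [C C0 fC] := bounded_nneg mf.2.
(* Grid points [e * k - N * e] for [k < N + N] cover the range [-C, C]. *)
pose N := (Num.truncn (C / e)).+2.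
pose A (k : nat) : set T := f @^-1` [set y | e * k%:R - N%:R * e <= y
   < e * k.+1%:R - N%:R * e].
have mA k : measurable (A k).
  rewrite /A (_ : [set y | _] = [set` `[e * k%:R - N%:R * e,
     e * k.+1%:R - N%:R * e[ ]).
    by rewrite -[X in measurable X]setTI; apply: mf.1.
  by apply/seteqP; split => y /=; rewrite in_itv.
pose c (k : nat) := e * k%:R - N%:R * e.
exists (fun w => \sum_(0 <= k < N + N) c k * \1_(A k) w); split.
- apply: bmf_sum => k _; apply: bmf_scale; exact: bmf_indic.
- elim: (index_iota _ _) => [|k s IH].
    under eq_fun do rewrite big_nil.
    rewrite (_ : (fun=> 0) = fun w => 0 * (\1_setT : T -> R) w).
      by apply: Hs => //; [exact: bmf_indic|exact: Hi].
    by apply/funext => w; rewrite mul0r.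
  under eq_fun do rewrite big_cons.
  apply: Ha => //; [by apply/bmf_scale/bmf_indic|  |].
    apply: bmf_sum => j _; apply: bmf_scale; exact: bmf_indic.
  by apply: Hs; [exact: bmf_indic|exact: Hi].
- move=> w.
  pose k := Num.truncn (f w / e + N%:R).
  have CN : C / e + 1 < N%:R.
    rewrite /N -addn1 natrD ltrD2r.
    by rewrite truncnS_gt.
  have fw : `|f w / e| <= C / e.
    have ei : 0 <= e^-1 by rewrite invr_ge0 ltW.
    by rewrite normrM [`|e^-1|]ger0_norm // ler_wpM2r.
  have fw' : - (C / e) <= f w / e <= C / e by rewrite -ler_norml.
  have ge0 : 0 <= f w / e + N%:R by lra.
  have kle : k%:R <= f w / e + N%:R < k.+1%:R.
    exact: truncn_itv.
  have kN : (k < N + N)%N.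
    by rewrite -(ltr_nat R) natrD; lra.
  have ee : f w = e * (f w / e) by field; rewrite gt_eqF.
  have Ak j : A j w <-> j = k.
    rewrite /A /= {1 2}ee; split.
      move=> /andP[h1 h2].
      have h3 : j%:R <= f w / e + N%:R.
        rewrite -(ler_pM2l e0) mulrDr; lra.
      have h4 : f w / e + N%:R < j.+1%:R.
        by rewrite -(ltr_pM2l e0) mulrDr; lra.
      apply/eqP; rewrite eqn_leq; apply/andP; split.
        by rewrite -ltnS -(ltr_nat R); case/andP: kle => _ ?; exact: le_lt_trans h3 _.
      by rewrite -ltnS -(ltr_nat R); case/andP: kle => ? _; exact: le_lt_trans h4.
    move=> ->; case/andP: kle => h1 h2; rewrite -!(mulrC e) -!mulrBr.
    by rewrite ler_pM2l // ltr_pM2l //; lra.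
  rewrite (bigD1_seq k) ?mem_index_iota ?iota_uniq //=.
  rewrite big1 ?addr0.
    rewrite indicE mem_set ?mulr1; last exact/Ak.
    have /andP[] := (Ak k).2 erefl; rewrite /c ler_norml => h1 h2.
    by rewrite -natr1 mulrDr in h2; lra.
  move=> j jk; rewrite indicE memNset ?mulr0 // => /Ak /eqP.
  by rewrite (negbTE jk).
Qed.

End bounded_measurable.

Arguments bmf_cst {R d T} r.

(** * Conditional expectations and independence of sigma-algebras *)

Section conditional_expectation.
Context {R : realType} d (T : measurableType d) (P : probability T R).
Variables (E : set T) (mE : measurable E) (E0 : (0 < P E)%E).
Implicit Types f g : T -> R.
Local Notation EE := (condE P E).

Lemma fine_gt0_prob : 0 < fine (P E).
Proof. by rewrite fine_gt0 // E0 /= -ge0_fin_numE ?fin_num_measure. Qed.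

Lemma bmf_integrable f : bmf f -> P.-integrable E (EFin \o f).
Proof.
move=> mf; apply: measurable_bounded_integrable => //.
- by rewrite -ge0_fin_numE ?fin_num_measure.
- exact: measurable_funS mf.1.
- have [C C0 fC] := bounded_nneg mf.2.
  exists C; split; first exact: num_real.
  by move=> M CM x _ /=; exact: le_trans (fC x) (ltW CM).
Qed.

Lemma condE_add f g : bmf f -> bmf g ->
  EE (fun w => f w + g w) = EE f + EE g.
Proof.
by move=> mf mg; rewrite /condE RintegralD ?mulrDl //; exact: bmf_integrable.
Qed.

Lemma condE_scale r f : bmf f -> EE (fun w => r * f w) = r * EE f.
Proof.
by move=> mf; rewrite /condE RintegralZl ?mulrA //; exact: bmf_integrable.
Qed.

Lemma condE_sub f g : bmf f -> bmf g ->
  EE (fun w => f w - g w) = EE f - EE g.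
Proof.
by move=> mf mg; rewrite /condE RintegralB ?mulrBl //; exact: bmf_integrable.
Qed.

Lemma condE_cst r : EE (fun=> r) = r.
Proof.
by rewrite /condE Rintegral_cst // mulfK // gt_eqF // fine_gt0_prob.
Qed.

Lemma condE_sum (I : eqType) (s : seq I) (h : I -> T -> R) :
  (forall i, i \in s -> bmf (h i)) ->
  EE (fun w => \sum_(i <- s) h i w) = \sum_(i <- s) EE (h i).
Proof.
elim: s => [|i s IH] mh.
  rewrite big_nil; under [X in EE X]eq_fun do rewrite big_nil.
  by rewrite condE_cst.
have mh' j : j \in s -> bmf (h j) by move=> js; apply: mh; rewrite inE js orbT.
rewrite big_cons; under [X in EE X]eq_fun do rewrite big_cons.
rewrite condE_add ?IH //; first by apply: mh; rewrite mem_head.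
exact: bmf_sum.
Qed.

Lemma condE_le f g : bmf f -> bmf g -> (forall w, E w -> f w <= g w) ->
  EE f <= EE g.
Proof.
move=> mf mg fg; rewrite /condE ler_wpM2r ?invr_ge0 ?(ltW fine_gt0_prob) //.
by apply: le_Rintegral => //; exact: bmf_integrable.
Qed.

Lemma condE_ext f g : (forall w, E w -> f w = g w) -> EE f = EE g.
Proof.
move=> fg; rewrite /condE; congr (_ / _).
by apply: eq_Rintegral => w; rewrite inE => /fg.
Qed.

Lemma condE_ge0 f : (forall w, E w -> 0 <= f w) -> 0 <= EE f.
Proof.
move=> f0; rewrite /condE divr_ge0 ?(ltW fine_gt0_prob) //.
exact: Rintegral_ge0.
Qed.

Lemma condE_bound f (C : R) : bmf f -> (forall w, `|f w| <= C) -> `|EE f| <= C.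
Proof.
move=> mf fC; rewrite ler_norml -{1}(condE_cst (- C)) -{2}(condE_cst C).
by apply/andP; split; apply: condE_le => //; try exact: bmf_cst;
  move=> w _; have := fC w; rewrite ler_norml => /andP[].
Qed.

Lemma condE_norm f : bmf f -> `|EE f| <= EE (fun w => `|f w|).
Proof.
move=> mf; have mn := bmf_norm mf.
rewrite ler_norml -mulN1r -condE_scale //; apply/andP; split;
  apply: condE_le => //; try exact: bmf_scale; move=> w _.
  by rewrite mulN1r lerNl ler_normr lexx orbT.
exact: ler_norm.
Qed.

Lemma condE_indic A : measurable A -> EE \1_A = condP P E A.
Proof.
move=> mA; rewrite /condE /condP; congr (_ / _).
by rewrite /Rintegral integral_indic.
Qed.

End conditional_expectation.

Section uniqueness.
Context {R : realType} d (T : measurableType d).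

(** The uniqueness theorem for measures concerns the whole sigma-algebra of a
    space; apply it to the images of [m1] and [m2] on the same points with the
    coarser sigma-algebra. *)
Lemma measure_unique_sub (m1 m2 : {measure set T -> \bar R}) (G : set (set T)) :
  G `<=` measurable -> setI_closed G -> G setT ->
  (forall A, G A -> m1 A = m2 A) -> (m1 setT < +oo)%E ->
  forall A, <<s G>> A -> m1 A = m2 A.
Proof.
move=> Gm GI GT m12 m1oo A sA.
have sub : <<s G>> `<=` (measurable : set (set T)).
  by apply: smallest_sub => //; exact: sigma_algebra_measurable.
have mi : measurable_fun setT (idfun : T -> g_sigma_algebraType G).
  by move=> _ Y mY; rewrite setTI; exact: sub.
pose n1 : {measure set (g_sigma_algebraType G) -> \bar R} :=
  [the measure _ _ of pushforward m1 (idfun : T -> g_sigma_algebraType G)].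
pose n2 : {measure set (g_sigma_algebraType G) -> \bar R} :=
  [the measure _ _ of pushforward m2 (idfun : T -> g_sigma_algebraType G)].
have H := @measure_unique _ R (g_sigma_algebraType G) G (fun=> setT) erefl GI
  (fun=> GT) _ (n1 mi) (n2 mi).
have := H _ _ _ A sA; rewrite /= /pushforward preimage_id; apply => //.
by rewrite bigcup_const.
Qed.

End uniqueness.

Section law.
Context {R : realType} d (T : measurableType d).
Context d1 (T1 : measurableType d1) (P1 : probability T1 R).
Context d2 (T2 : measurableType d2) (P2 : probability T2 R).

(** Both sides are linear in [h] and stable under uniform limits, so indicators,
    that is the two conditional laws, decide. *)
Lemma condE_eq_law (E1 : set T1) (E2 : set T2) (X1 : T1 -> T) (X2 : T2 -> T) :
  measurable E1 -> measurable E2 -> (0 < P1 E1)%E -> (0 < P2 E2)%E ->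
  measurable_fun setT X1 -> measurable_fun setT X2 ->
  (forall A, measurable A ->
     condP P1 E1 [set w | A (X1 w)] = condP P2 E2 [set w | A (X2 w)]) ->
  forall h : T -> R, bmf h ->
  condE P1 E1 (fun w => h (X1 w)) = condE P2 E2 (fun w => h (X2 w)).
Proof.
move=> mE1 mE2 E10 E20 mX1 mX2 law.
have c1 h : bmf h -> bmf (fun w => h (X1 w)).
  move=> [mh [C hC]]; split; last by exists C.
  exact: measurableT_comp.
have c2 h : bmf h -> bmf (fun w => h (X2 w)).
  move=> [mh [C hC]]; split; last by exists C.
  exact: measurableT_comp.
apply: bmf_ind.
- move=> A mA; have := law A mA.
  have m1 : measurable [set w | A (X1 w)].
    by rewrite -[X in measurable X]setTI; exact: mX1.
  have m2 : measurable [set w | A (X2 w)].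
    by rewrite -[X in measurable X]setTI; exact: mX2.
  by rewrite -!condE_indic.
- move=> f g mf mg Hf Hg.
  rewrite condE_add; [|assumption..|exact: c1|exact: c1].
  by rewrite condE_add; [rewrite Hf Hg|assumption..|exact: c2|exact: c2].
- move=> r f mf Hf; rewrite condE_scale; [|assumption..|exact: c1].
  by rewrite condE_scale; [rewrite Hf|assumption..|exact: c2].
- move=> f mf H; apply/eqP; rewrite -subr_eq0 -normr_le0.
  apply/ler_addgt0Pl => e e0; rewrite addr0.
  have [g [mg Hg fg]] := H _ (divr_gt0 e0 (ltr0Sn R 1)).
  have e1 : `|condE P1 E1 (fun w => f (X1 w)) - condE P1 E1 (fun w => g (X1 w))|
      <= e / 2%:R.
    rewrite -condE_sub; [|assumption..|exact: c1|exact: c1].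
    by apply: condE_bound => //; apply: bmf_sub; exact: c1.
  have e2 : `|condE P2 E2 (fun w => f (X2 w)) - condE P2 E2 (fun w => g (X2 w))|
      <= e / 2%:R.
    rewrite -condE_sub; [|assumption..|exact: c2|exact: c2].
    by apply: condE_bound => //; apply: bmf_sub; exact: c2.
  move: e1 e2; rewrite Hg !ler_norml.
  by move=> /andP[? ?] /andP[? ?]; apply/andP; split; lra.
Qed.

End law.

Section product_rule.
Context {R : realType} d (T : measurableType d) (P : probability T R).
Variables (E : set T) (mE : measurable E) (E0 : (0 < P E)%E).
Local Notation EE := (condE P E).
Local Notation PP := (condP P E).

(** Half of the passage from pi-systems to the generated sigma-algebras: for a
    fixed G, both sides of the product rule are finite measures in A. *)
Lemma indep_sigma1 (GA : set (set T)) (G : set T) :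
  GA `<=` measurable -> setI_closed GA -> GA setT -> measurable G ->
  (forall A, GA A -> PP (A `&` G) = PP A * PP G) ->
  forall A, <<s GA>> A -> PP (A `&` G) = PP A * PP G.
Proof.
move=> GAm GAI GAT mG H.
have finP X : measurable X -> P X = (fine (P X))%:E.
  by move=> mX; rewrite fineK ?fin_num_measure.
have P0 X : 0 <= fine (P X) by rewrite fine_ge0.
have PE0 : fine (P E) != 0 by rewrite gt_eqF // fine_gt0_prob.
have mGE : measurable (G `&` E) by exact: measurableI.
pose m1 := mscale (NngNum (P0 E)) (mrestr P mGE).
pose m2 := mscale (NngNum (P0 (G `&` E))) (mrestr P mE).
have sub : <<s GA>> `<=` (measurable : set (set T)).
  by apply: smallest_sub => //; exact: sigma_algebra_measurable.
have key A : measurable A ->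
    PP (A `&` G) = PP A * PP G <-> m1 A = m2 A.
  move=> mA; rewrite /m1 /m2 /mscale /= /mrestr.
  have mAE : measurable (A `&` E) by exact: measurableI.
  have mAGE : measurable (A `&` (G `&` E)) by exact: measurableI.
  rewrite (finP _ mAE) (finP _ mAGE) -!EFinM /condP -setIA.
  split.
    move=> e; congr EFin; apply: (mulIf (invr_neq0 PE0)).
    apply: (mulIf (invr_neq0 PE0)).
    have -> : fine (P E) * fine (P (A `&` (G `&` E))) / fine (P E) / fine (P E)
       = fine (P (A `&` (G `&` E))) / fine (P E) by field.
    by rewrite e; field.
  move=> [] e; apply: (mulIf PE0); rewrite mulfVK //.
  have -> : fine (P (A `&` (G `&` E))) =
     fine (P (G `&` E)) * fine (P (A `&` E)) / fine (P E).
    by rewrite -e mulrC mulKf.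
  by field.
move=> A sA; apply/key; first exact: sub.
apply: (@measure_unique_sub _ _ _ m1 m2 GA) => //.
- by move=> B GB; apply/key; [exact: GAm|exact: H].
- by rewrite /m1 /= /mscale /= /mrestr setTI (finP _ mGE) -EFinM ltry.
Qed.

Lemma indep_sigma (GA GB : set (set T)) :
  GA `<=` measurable -> setI_closed GA -> GA setT ->
  GB `<=` measurable -> setI_closed GB -> GB setT ->
  (forall A B, GA A -> GB B -> PP (A `&` B) = PP A * PP B) ->
  forall A B, <<s GA>> A -> <<s GB>> B -> PP (A `&` B) = PP A * PP B.
Proof.
move=> GAm GAI GAT GBm GBI GBT H A B sA sB.
have sub : <<s GB>> `<=` (measurable : set (set T)).
  by apply: smallest_sub => //; exact: sigma_algebra_measurable.
apply: (indep_sigma1 GAm) => //; first exact: sub.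
move=> A' GA'; rewrite setIC mulrC.
apply: (indep_sigma1 GBm) => //; first exact: GAm.
by move=> B' GB'; rewrite setIC mulrC; exact: H.
Qed.

(** Approximation by step functions, in one factor and then in the other,
    reduces the product rule to sets. Boundedness and measurability at
    [g_sigma_algebraType G] mean measurability for the sigma-algebra generated
    by [G]. *)
Lemma condE_mul_sigma (GA GB : set (set T)) :
  GA `<=` measurable -> setI_closed GA -> GA setT ->
  GB `<=` measurable -> setI_closed GB -> GB setT ->
  (forall A B, GA A -> GB B -> PP (A `&` B) = PP A * PP B) ->
  forall f g : T -> R,
  @bmf R _ (g_sigma_algebraType GA) f -> @bmf R _ (g_sigma_algebraType GB) g ->
  EE (fun w => f w * g w) = EE f * EE g.
Proof.
move=> GAm GAI GAT GBm GBI GBT H f g mf mg.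
have subm (G : set (set T)) (h : T -> R) : G `<=` measurable ->
    @bmf R _ (g_sigma_algebraType G) h -> bmf h.
  move=> Gm [mh bh]; split => // _ Y mY.
  have := mh measurableT Y mY; apply: smallest_sub => //.
  exact: sigma_algebra_measurable.
have sA := subm _ _ GAm; have sB := subm _ _ GBm.
have subA : <<s GA>> `<=` (measurable : set (set T)).
  by apply: smallest_sub => //; exact: sigma_algebra_measurable.
have subB : <<s GB>> `<=` (measurable : set (set T)).
  by apply: smallest_sub => //; exact: sigma_algebra_measurable.
have close (u v : T -> R) : bmf v ->
    (forall e : R, 0 < e -> exists w, [/\ bmf w,
        EE (fun x => w x * v x) = EE w * EE v & forall x, `|u x - w x| <= e]) ->
    bmf u -> EE (fun x => u x * v x) = EE u * EE v.
  move=> mv Hu mu; have [C C0 vC] := bounded_nneg mv.2.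
  apply/eqP; rewrite -subr_eq0 -normr_le0.
  apply/ler_addgt0Pl => e e0; rewrite addr0.
  have c0 : 0 < e / (C + 1) / 2%:R by rewrite !divr_gt0 // ltr_wpDl.
  have [w [mw Hw uw]] := Hu _ c0.
  have e1 : `|EE (fun x => u x * v x) - EE (fun x => w x * v x)| <= e / 2%:R.
    rewrite -condE_sub; [|assumption..|exact: bmf_mul|exact: bmf_mul].
    apply: condE_bound => //; first by apply: bmf_sub; exact: bmf_mul.
    move=> x; rewrite -mulrBl normrM.
    apply: (@le_trans _ _ (e / (C + 1) / 2%:R * (C + 1))).
      apply: ler_pM => //; apply: le_trans (vC x) _; lra.
    by rewrite mulrAC divfK // gt_eqF // ltr_wpDl.
  have e2 : `|EE u * EE v - EE w * EE v| <= e / 2%:R.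
    rewrite -mulrBl -condE_sub // normrM.
    apply: (@le_trans _ _ (e / (C + 1) / 2%:R * (C + 1))).
      apply: ler_pM => //; first by apply: condE_bound => //; exact: bmf_sub.
      by apply: condE_bound => // x; apply: le_trans (vC x) _; lra.
    by rewrite mulrAC divfK // gt_eqF // ltr_wpDl.
  move: e1 e2; rewrite Hw !ler_norml.
  by move=> /andP[? ?] /andP[? ?]; apply/andP; split; lra.
have HS := indep_sigma GAm GAI GAT GBm GBI GBT H.
pose HH (v u : T -> R) := EE (fun x => u x * v x) = EE u * EE v.
have lin (v u1 u2 : T -> R) (r : R) : bmf v -> bmf u1 -> bmf u2 ->
    HH v u1 -> HH v u2 -> HH v (fun w => u1 w + u2 w) /\ HH v (fun w => r * u1 w).
  move=> mv mu1 mu2 h1 h2; split; rewrite /HH.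
    under [X in EE X]eq_fun do rewrite mulrDl.
    by rewrite !condE_add ?h1 ?h2 ?mulrDl //; exact: bmf_mul.
  under [X in EE X]eq_fun do rewrite -mulrA.
  by rewrite !condE_scale ?h1 ?mulrA //; exact: bmf_mul.
have st1 B : <<s GB>> B -> HH (\1_B : T -> R) f.
  move=> sgB; have mB := bmf_indic (R := R) (subB _ sgB).
  move: f mf; apply: (@bmf_ind R _ (g_sigma_algebraType GA)).
  - move=> A sgA; rewrite /HH.
    have -> : (fun x => \1_A x * \1_B x) = \1_(A `&` B) :> (T -> R).
      by rewrite indicI.
    rewrite !condE_indic ?HS //; [exact: subB|exact: subA|].
    by apply: measurableI; [exact: subA|exact: subB].
  - by move=> u v mu mv hu hv; have [] := lin _ _ _ 0 mB (sA _ mu) (sA _ mv) hu hv.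
  - by move=> r u mu hu; have [] := lin _ _ _ r mB (sA _ mu) (sA _ mu) hu hu.
  - move=> u mu h; apply: close => //; last exact: sA.
    by move=> e /h[w [mw hw uw]]; exists w; split => //; exact: sA.
have mf' := sA _ mf.
have sw (u v : T -> R) : HH u v -> HH v u.
  rewrite /HH => h; rewrite mulrC -h; congr EE.
  by apply/funext => x; rewrite mulrC.
apply: (sw _ _); move: g mg; apply: (@bmf_ind R _ (g_sigma_algebraType GB)).
- by move=> B sgB; apply/sw/st1.
- by move=> u v mu mv hu hv; have [] := lin _ _ _ 0 mf' (sB _ mu) (sB _ mv) hu hv.
- by move=> r u mu hu; have [] := lin _ _ _ r mf' (sB _ mu) (sB _ mu) hu hu.
- move=> u mu h; apply: close => //; last exact: sB.
  by move=> e /h[w [mw hw uw]]; exists w; split => //; exact: sB.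
Qed.

End product_rule.

Arguments condE_add {R d T P E} mE {f g} _ _.
Arguments condE_sub {R d T P E} mE {f g} _ _.
Arguments condE_scale {R d T P E} mE r {f} _.
Arguments condE_indic {R d T P E} mE {A} _.
Arguments condE_cst {R d T P E} mE E0 r.
Arguments condE_sum {R d T P E} mE E0 {I s h} _.
Arguments condE_le {R d T P E} mE E0 {f g} _ _ _.
Arguments condE_ext {R d T P E f g} _.
Arguments condE_ge0 {R d T P E} mE E0 {f} _.
Arguments condE_bound {R d T P E} mE E0 {f C} _ _.
Arguments condE_norm {R d T P E} mE E0 {f} _.

(** * Functions of independent coordinates *)

Section independent_coordinates.
Context {R : realType} d (T : measurableType d) (P : probability T R).
Variables (E : set T) (mE : measurable E) (E0 : (0 < P E)%E).
Local Notation EE := (condE P E).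
Local Notation PP := (condP P E).
Variables (I : finType) (Gs : I -> set (set T)).
Hypothesis Gs_meas : forall i, Gs i `<=` measurable.
Hypothesis Gs_setI : forall i, setI_closed (Gs i).
Hypothesis Gs_setT : forall i, Gs i setT.

(** A pi-system generating the sigma-algebra of the coordinates in [A]; the
    other coordinates are filled with the whole space. *)
Definition coord_boxes (A : {set I}) : set (set T) :=
  [set S | exists s : I -> set T, [/\ forall i, Gs i (s i),
     forall i, i \notin A -> s i = setT & S = [set w | forall i, s i w]]].

(** Bounded functions of the coordinates in [A]. *)
Definition coord_bmf (A : {set I}) (f : T -> R) :=
  @bmf R _ (g_sigma_algebraType (coord_boxes A)) f.

Lemma coord_boxes_meas A : coord_boxes A `<=` measurable.
Proof.
move=> _ [s [Gss _ ->]].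
rewrite (_ : [set w | _] = \bigcap_(i in [set: I]) s i).
  by apply: fin_bigcap_measurable => // i _; exact: (Gs_meas (Gss i)).
by apply/seteqP; split=> w h i //; exact: h.
Qed.

Lemma coord_boxes_setI A : setI_closed (coord_boxes A).
Proof.
move=> _ _ [s [Gss sA ->]] [t [Gst tA ->]].
exists (fun i => s i `&` t i); split.
- by move=> i; exact: Gs_setI.
- by move=> i iA; rewrite sA // tA // setTI.
- apply/seteqP; split=> w /=; first by move=> [h1 h2] i; split.
  by move=> h; split=> i; have [] := h i.
Qed.

Lemma coord_boxes_setT A : coord_boxes A setT.
Proof. by exists (fun=> setT); split => //; apply/seteqP; split. Qed.

Lemma coord_boxes1 (A : {set I}) i S : i \in A -> Gs i S -> coord_boxes A S.
Proof.
move=> iA GS; exists (fun j => if j == i then S else setT); split.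
- by move=> j; case: eqP => [->|_].
- by move=> j jA; case: eqP => // ji; rewrite ji iA in jA.
- apply/seteqP; split=> w /=; last by move=> /(_ i); rewrite eqxx.
  by move=> Sw j; case: eqP.
Qed.

Lemma coord_boxesS (A B : {set I}) : A \subset B ->
  coord_boxes A `<=` coord_boxes B.
Proof.
move=> /fintype.subsetP AB S [s [Gss sA ->]]; exists s; split => // i iB.
by apply: sA; apply: contra iB => /AB.
Qed.

Lemma coord_bmf_sub (A B : {set I}) f : A \subset B -> coord_bmf A f -> coord_bmf B f.
Proof.
move=> AB [mf bf]; split => // _ Y mY; have := mf measurableT Y mY.
exact: sub_sigma_algebra2 (coord_boxesS AB) _.
Qed.

Lemma coord_bmf_bmf A f : coord_bmf A f -> bmf f.
Proof.
move=> [mf bf]; split => // _ Y mY; have := mf measurableT Y mY.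
apply: smallest_sub; first exact: sigma_algebra_measurable.
exact: coord_boxes_meas.
Qed.

Lemma coord_bmf_coord (A : {set I}) i f : i \in A ->
  @bmf R _ (g_sigma_algebraType (Gs i)) f -> coord_bmf A f.
Proof.
move=> iA [mf bf]; split => // _ Y mY; have := mf measurableT Y mY.
by apply: sub_sigma_algebra2 => S; exact: coord_boxes1.
Qed.

Hypothesis Gs_indep : forall s : I -> set T, (forall i, Gs i (s i)) ->
  PP [set w | forall i, s i w] = \prod_i PP (s i).

Lemma coord_bmf_indep (A B : {set I}) f g : A \subset ~: B -> coord_bmf A f -> coord_bmf B g ->
  EE (fun w => f w * g w) = EE f * EE g.
Proof.
move=> AB; apply: condE_mul_sigma => //; try exact: coord_boxes_meas;
  try exact: coord_boxes_setI; try exact: coord_boxes_setT.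
move=> _ _ [s [Gss sA ->]] [t [Gst tB ->]].
have PT : PP setT = 1.
  by rewrite /condP setTI divff // gt_eqF // (fine_gt0_prob mE E0).
rewrite (_ : _ `&` _ = [set w | forall i, (s i `&` t i) w]); last first.
  apply/seteqP; split=> w /=; first by move=> [h1 h2] i; split.
  by move=> h; split=> i; have [] := h i.
rewrite !Gs_indep // -?big_split /=; last by move=> i; exact: Gs_setI.
apply: eq_bigr => i _; change (PP (s i `&` t i) = PP (s i) * PP (t i)).
have [iA|iA] := boolP (i \in A).
  have iB : i \notin B by move/fintype.subsetP: AB => /(_ _ iA); rewrite finset.in_setC.
  by rewrite (tB i iB) setIT PT mulr1.
by rewrite (sA i) // setTI PT mul1r.
Qed.

Lemma coord_bmf_prod (J : eqType) (s : seq J) (A : J -> {set I}) (f : J -> T -> R) :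
  uniq s -> (forall j k, j \in s -> k \in s -> j != k -> A j \subset ~: A k) ->
  (forall j, j \in s -> coord_bmf (A j) (f j)) ->
  EE (fun w => \prod_(j <- s) f j w) = \prod_(j <- s) EE (f j).
Proof.
elim: s => [|j s IH] us dA mf.
  rewrite big_nil; under [X in EE X]eq_fun do rewrite big_nil.
  by rewrite condE_cst.
move: us => /= /andP[js us].
rewrite big_cons; under [X in EE X]eq_fun do rewrite big_cons.
rewrite (@coord_bmf_indep (A j) (\bigcup_(k <- s) A k)).
- rewrite IH // => [k k' ks k's|k ks]; last by apply: mf; rewrite inE ks orbT.
  by apply: dA; rewrite inE ?ks ?k's orbT.
- apply/fintype.subsetP => i ij; rewrite finset.in_setC big_seq.
  elim/big_ind: _ => [|B C hB hC|k ks]; first by rewrite finset.in_set0.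
    by rewrite finset.in_setU negb_or hB hC.
  have := dA j k; rewrite !inE eqxx ks orbT => /(_ isT isT).
  case: eqP => [jk|_ /(_ isT) /fintype.subsetP/(_ _ ij)]; first by rewrite jk ks in js.
  by rewrite finset.in_setC.
- by apply: mf; rewrite inE eqxx.
- apply: bmf_prod => k ks; apply: (@coord_bmf_sub (A k)).
    by rewrite (big_rem k) //= finset.subsetUl.
  by apply: mf; rewrite inE ks orbT.
Qed.

End independent_coordinates.

(** * The coordinates of the model *)

(** The independent coordinates given the labels: one per potential arc, one
    per weight and one per vertex. *)
Notation coord n := ('I_n * 'I_n + 'I_n * 'I_n + 'I_n)%type.
Notation arcc i j := (inl (inl (i, j))).
Notation wgtc i j := (inl (inr (i, j))).
Notation nodec i := (inr i).

Section model_coordinates.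
Context {R : realType} (S : opinion_params R).
Context d1 (Omega : measurableType d1) (P : probability Omega R).
Variables (U : opinion_inputs S Omega) (U_ok : is_opinion_model P U).
Variables (n : nat) (x : labels S n).

Lemma labels_meas : measurable (labels_are U x).
Proof.
rewrite (_ : labels_are U x =
    \bigcap_(i in [set: 'I_n]) [set w | J U i w = x i]).
  by apply: fin_bigcap_measurable => // i _; exact: J_meas U_ok _ _ _.
apply/seteqP; split=> w /=.
  by move=> <- i _ /=; rewrite ffunE.
by move=> h; apply/ffunP => i; rewrite ffunE; exact: h.
Qed.

Hypothesis x0 : (0 < P (labels_are U x))%E.
Variable tau : nat.
Local Notation E := (labels_are U x).
Local Notation EE := (condE P E).
Local Notation PP := (condP P E).
Local Notation pairT := ('I_n * 'I_n)%type.
Local Notation nodeT := ('rV[R]_(l S) * 'rV[R]_(l S))%type.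


Definition arc_set (p : pairT) (b : set bool) : set Omega :=
  [set w | b (Defs.arc U p.1 p.2 w)].
Definition wgt_set (p : pairT) (A : set R) : set Omega :=
  [set w | A (B U p.1 p.2 w)].
Definition node_set (i : 'I_n) (D : set nodeT) (Y : nat -> set 'rV[R]_(l S)) :
    set Omega :=
  [set w | D (Q U i w, R0 U i w) /\ forall t, (t < tau)%N -> Y t (Z U i t w)].

Definition coord_sets (a : coord n) : set (set Omega) :=
  match a with
  | inl (inl p) => [set X | exists b, X = arc_set p b]
  | inl (inr p) => [set X | exists2 A, measurable A & X = wgt_set p A]
  | inr i => [set X | exists D Y, [/\ measurable D,
       forall t, measurable (Y t) & X = node_set i D Y]]
  end.

Lemma arc_set_meas p b : measurable (arc_set p b).
Proof.
have m1 : measurable [set w | Defs.arc U p.1 p.2 w] by exact: arc_meas U_ok _ _ _.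
have [bt|bt] := pselect (b true); have [bf|bf] := pselect (b false).
- rewrite (_ : arc_set _ _ = setT) //.
  by apply/seteqP; split=> w //= _; rewrite /arc_set /=; case: Defs.arc.
- rewrite (_ : arc_set _ _ = [set w | Defs.arc U p.1 p.2 w]) //.
  by apply/seteqP; split=> w; rewrite /arc_set /=; case: Defs.arc.
- rewrite (_ : arc_set _ _ = ~` [set w | Defs.arc U p.1 p.2 w]).
    exact: measurableC.
  by apply/seteqP; split=> w; rewrite /arc_set /=; case: Defs.arc => //= /(_ isT).
- rewrite (_ : arc_set _ _ = set0) //.
  by apply/seteqP; split=> w; rewrite /arc_set /=; case: Defs.arc.
Qed.

Lemma wgt_set_meas p A : measurable A -> measurable (wgt_set p A).
Proof.
move=> mA; rewrite -[X in measurable X]setTI.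
exact: (B_meas U_ok p.1 p.2).
Qed.

Lemma node_set_meas i D Y : measurable D -> (forall t, measurable (Y t)) ->
  measurable (node_set i D Y).
Proof.
move=> mD mY; rewrite (_ : node_set i D Y =
  (fun w => (Q U i w, R0 U i w)) @^-1` D `&`
  \bigcap_(t in `I_tau) (Z U i t @^-1` Y t)).
  apply: measurableI.
    rewrite -[X in measurable X]setTI.
    have : measurable_fun setT (fun w => (Q U i w, R0 U i w)).
      by apply: measurable_fun_pair; [exact: (Q_meas U_ok)|exact: (R0_meas U_ok)].
    exact.
  apply: fin_bigcap_measurable => // t _; rewrite -[X in measurable X]setTI.
  exact: (Z_meas U_ok).
by apply/seteqP; split.
Qed.

Lemma coord_sets_meas a : coord_sets a `<=` measurable.
Proof.
case: a => [[p|p]|i] X /=.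
- by move=> [b ->]; exact: arc_set_meas.
- by move=> [A mA ->]; exact: wgt_set_meas.
- by move=> [D [Y [mD mY ->]]]; exact: node_set_meas.
Qed.

Lemma coord_sets_setI a : setI_closed (coord_sets a).
Proof.
case: a => [[p|p]|i] X X' /=.
- by move=> [b ->] [b' ->]; exists (b `&` b').
- move=> [A mA ->] [A' mA' ->]; by exists (A `&` A'); [exact: measurableI|].
- move=> [D [Y [mD mY ->]]] [D' [Y' [mD' mY' ->]]].
  exists (D `&` D'), (fun t => Y t `&` Y' t); split.
  + exact: measurableI.
  + by move=> t; exact: measurableI.
  + apply/seteqP; split=> w /=.
      by move=> [[h1 h2] [h3 h4]]; split=> // t tt; split; [exact: h2|exact: h4].
    move=> [[h1 h2] h3]; split; split=> // t tt; by have [] := h3 t tt.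
Qed.

Lemma coord_sets_setT a : coord_sets a setT.
Proof.
case: a => [[p|p]|i] /=.
- by exists setT.
- by exists setT.
- by exists setT, (fun=> setT); split => //; apply/seteqP; split.
Qed.

Let arc_fac (p : pairT) (b : set bool) : R :=
  \sum_(c : bool) (`[< b c >])%:R *
    (if c then edge_prob x p.1 p.2 else 1 - edge_prob x p.1 p.2).
Let wgt_fac (p : pairT) (A : set R) : R := fine (G (x p.1) (x p.2) A).
Let node_fac (i : 'I_n) (D : set nodeT) (Y : nat -> set 'rV[R]_(l S)) : R :=
  EE (fun w => \1_D (Q U i w, R0 U i w)
        * \prod_(t < tau) fine (nu (x i) (Q U i w) (Y t))).

Lemma arc_facT p : arc_fac p setT = 1.
Proof.
rewrite /arc_fac big_bool /= !asboolT // !mul1r; exact: subrKC.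
Qed.

Lemma wgt_facT p : wgt_fac p setT = 1.
Proof. by rewrite /wgt_fac probability_setT. Qed.

Lemma node_facT i : node_fac i setT (fun=> setT) = 1.
Proof.
rewrite /node_fac -[RHS](condE_cst labels_meas x0); congr condE.
apply/funext => w; rewrite indicT mul1r big1 // => t _.
by rewrite prob_kernel.
Qed.

(** The joint law on boxes whose arc constraints are arbitrary subsets of
    bool: the boxes of the model prescribe every arc, so sum over the allowed
    arc configurations. *)
Lemma box_law (b : pairT -> set bool) (A : pairT -> set R)
    (D : 'I_n -> set nodeT) (Y : 'I_n -> nat -> set 'rV[R]_(l S)) :
  (forall p, measurable (A p)) -> (forall i, measurable (D i)) ->
  (forall i t, measurable (Y i t)) ->
  PP [set w | [/\ forall p, arc_set p (b p) w, forall p, wgt_set p (A p) w &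
                forall i, node_set i (D i) (Y i) w]] =
  \prod_p arc_fac p (b p) * \prod_p wgt_fac p (A p) *
    \prod_i node_fac i (D i) (Y i).
Proof.
move=> mA mD mY.
pose bx (g : {ffun pairT -> bool}) : set Omega :=
  [set w | [/\ forall i j, Defs.arc U i j w = g (i, j),
             forall i j, A (i, j) (B U i j w),
             forall i, D i (Q U i w, R0 U i w) &
             forall i t, (t < tau)%N -> Y i t (Z U i t w)]].
have bxE g : bx g = [set w | [/\ forall p, arc_set p [set g p] w,
    forall p, wgt_set p (A p) w & forall i, node_set i (D i) (Y i) w]].
  apply/seteqP; split=> w /=.
    move=> [h1 h2 h3 h4]; split; first by move=> [i j]; exact: h1.
      by move=> [i j]; exact: h2.
    by move=> i; split => // t; exact: h4.
  move=> [h1 h2 h3]; split; first by move=> i j; exact: (h1 (i, j)).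
  - by move=> i j; exact: (h2 (i, j)).
  - by move=> i; have [] := h3 i.
  - by move=> i t; have [_] := h3 i; exact.
have mbox (b' : pairT -> set bool) : measurable
    [set w | [/\ forall p, arc_set p (b' p) w, forall p, wgt_set p (A p) w &
                forall i, node_set i (D i) (Y i) w]].
  rewrite (_ : [set w | _] = \bigcap_(p in [set: pairT]) arc_set p (b' p) `&`
    \bigcap_(p in [set: pairT]) wgt_set p (A p) `&`
    \bigcap_(i in [set: 'I_n]) node_set i (D i) (Y i)).
    apply: measurableI; first apply: measurableI;
      apply: fin_bigcap_measurable => // p _.
    + exact: arc_set_meas.
    + exact: wgt_set_meas.
    + exact: node_set_meas.
  apply/seteqP; split=> w /=.
    by move=> [h1 h2 h3]; split; first split; move=> p _.
  by move=> [[h1 h2] h3]; split=> p; [exact: h1|exact: h2|exact: h3].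
have mbx g : measurable (bx g) by rewrite bxE; exact: mbox.
have lawbx g : PP (bx g) =
   (\prod_p (if g p then edge_prob x p.1 p.2 else 1 - edge_prob x p.1 p.2)) *
   \prod_p wgt_fac p (A p) * \prod_i node_fac i (D i) (Y i).
  rewrite (@joint_law _ _ _ _ _ _ U_ok _ _ x0 (fun i j => g (i, j))
     (fun i j => A (i, j)) D tau Y) //.
  congr (_ * _ * _); rewrite pair_bigA /=; apply: eq_bigr => -[i j] _ //.
rewrite -(condE_indic labels_meas) //.
transitivity (EE (fun w => \sum_(g : {ffun pairT -> bool})
   (\prod_p (`[< b p (g p) >])%:R) * \1_(bx g) w)).
  apply: condE_ext => w _.
  pose g0 := [ffun p : pairT => Defs.arc U p.1 p.2 w].
  rewrite (bigD1 g0) //= [X in _ + X]big1 ?addr0; last first.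
    move=> g gg0; rewrite ?indicE memNset ?mulr0 // => -[h _ _ _].
    by move/eqP: gg0; apply; apply/ffunP => -[i j]; rewrite ffunE /= h.
  rewrite ?indicE.
  have [h|h] := pselect (forall p, arc_set p (b p) w).
    rewrite big1 ?mul1r; last first.
      by move=> p _; rewrite ffunE asboolT //; exact: h.
    congr ((_ : bool)%:R); apply/idP/idP; rewrite !inE => hw.
      case: hw => _ h2 h3; rewrite bxE; split=> // p.
      by rewrite /arc_set /= ffunE.
    by move: hw; rewrite bxE => -[_ h2 h3]; split.
  have [p hp] := (existsNP _).2 h.
  rewrite memNset; last by move=> [h1 _ _].
  by rewrite (bigD1 p) //= ffunE asboolF // !mul0r.
rewrite (condE_sum labels_meas x0); last first.
  by move=> g _; apply: bmf_scale; exact: bmf_indic.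
transitivity (\sum_(g : {ffun pairT -> bool})
    (\prod_p ((`[< b p (g p) >])%:R *
      (if g p then edge_prob x p.1 p.2 else 1 - edge_prob x p.1 p.2))) *
     (\prod_p wgt_fac p (A p) * \prod_i node_fac i (D i) (Y i))).
  apply: eq_bigr => g _.
  rewrite (condE_scale labels_meas _); last exact: bmf_indic.
  rewrite (condE_indic labels_meas); last exact: mbx.
  by rewrite lawbx [X in _ = X * _]big_split /= !mulrA.
by rewrite -mulr_suml -mulrA; congr (_ * _); rewrite /arc_fac bigA_distr_bigA.
Qed.

Lemma arc_set_law p b : PP (arc_set p b) = arc_fac p b.
Proof.
have := @box_law (fun q => if q == p then b else setT) (fun=> setT)
  (fun=> setT) (fun _ _ => setT) (fun=> measurableT) (fun=> measurableT)
  (fun _ _ => measurableT).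
rewrite [\prod_p wgt_fac _ _]big1; last by move=> q _; exact: wgt_facT.
rewrite [\prod_i node_fac _ _ _]big1; last by move=> q _; exact: node_facT.
rewrite !mulr1 (bigD1 p) //= eqxx big1 ?mulr1; last first.
  by move=> q /negbTE ->; exact: arc_facT.
move=> <-; congr condP; apply/seteqP; split=> w /=.
  by move=> h; split=> // q; rewrite /arc_set /=; case: eqP => // ->.
by move=> [/(_ p)]; rewrite /arc_set /= eqxx.
Qed.

Lemma wgt_set_law p A : measurable A -> PP (wgt_set p A) = wgt_fac p A.
Proof.
move=> mA; have := @box_law (fun=> setT) (fun q => if q == p then A else setT)
  (fun=> setT) (fun _ _ => setT) _ (fun=> measurableT)
  (fun _ _ => measurableT).
rewrite [\prod_p arc_fac _ _]big1; last by move=> q _; exact: arc_facT.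
rewrite [\prod_i node_fac _ _ _]big1; last by move=> q _; exact: node_facT.
rewrite mulr1 mul1r (bigD1 p) //= eqxx big1 ?mulr1; last first.
  by move=> q /negbTE ->; exact: wgt_facT.
move=> <- //; last by move=> q; case: eqP.
congr condP; apply/seteqP; split=> w /=.
  by move=> h; split=> // q; rewrite /wgt_set /=; case: eqP => // ->.
by move=> [_ /(_ p)]; rewrite /wgt_set /= eqxx.
Qed.

Lemma node_set_law i D Y : measurable D -> (forall t, measurable (Y t)) ->
  PP (node_set i D Y) = node_fac i D Y.
Proof.
move=> mD mY; have := @box_law (fun=> setT) (fun=> setT)
  (fun j => if j == i then D else setT)
  (fun j => if j == i then Y else fun=> setT) (fun=> measurableT) _ _.
rewrite [\prod_p arc_fac _ _]big1; last by move=> q _; exact: arc_facT.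
rewrite [\prod_p wgt_fac _ _]big1; last by move=> q _; exact: wgt_facT.
rewrite !mul1r (bigD1 i) //= eqxx [X in _ * X]big1 ?mulr1; last first.
  by move=> q /negbTE ->; exact: node_facT.
move=> <- //.
- congr condP; apply/seteqP; split=> w /=.
    move=> h; split=> // j; rewrite /node_set /=; case: eqP => [->|_] //.
  by move=> [_ _ /(_ i)]; rewrite /node_set /= eqxx.
- by move=> j; case: eqP.
- by move=> j t; case: eqP.
Qed.

Lemma coord_indep (s : coord n -> set Omega) : (forall a, coord_sets a (s a)) ->
  PP [set w | forall a, s a w] = \prod_a PP (s a).
Proof.
move=> ss.
have [b hb] := choice (fun p => ss (inl (inl p))).
have hA' p : exists A, measurable A /\ s (inl (inr p)) = wgt_set p A.
  by have [A mA e] := ss (inl (inr p)); exists A.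
have [A hA] := choice hA'.
have hD' i : exists DY : set nodeT * (nat -> set 'rV[R]_(l S)),
    [/\ measurable DY.1, forall t, measurable (DY.2 t) &
        s (inr i) = node_set i DY.1 DY.2].
  by have [D [Y [mD mY e]]] := ss (inr i); exists (D, Y).
have [DY hDY] := choice hD'.
rewrite !big_sumType /=.
under eq_bigr do rewrite hb arc_set_law.
under [X in _ * X * _]eq_bigr => p _ do
  rewrite (hA p).2 (wgt_set_law _ (hA p).1).
under [X in _ * _ * X]eq_bigr => i _ do
  (have [mD mY ->] := hDY i; rewrite (node_set_law _ mD mY)).
rewrite -box_law.
- congr condP; apply/seteqP; split=> w /=.
    move=> h; split=> [p|p|i].
    + by rewrite -hb; exact: h.
    + by rewrite -(hA p).2; exact: h.
    + by have [_ _ <-] := hDY i; exact: h.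
  move=> [h1 h2 h3] [[p|p]|i].
  + by rewrite hb; exact: h1.
  + by rewrite (hA p).2; exact: h2.
  + by have [_ _ ->] := hDY i; exact: h3.
- by move=> p; exact: (hA p).1.
- by move=> i; have [] := hDY i.
- by move=> i t; have [] := hDY i.
Qed.

Local Notation bmc := (coord_bmf coord_sets).

Lemma bmc_mul (A A' : {set coord n}) (f g : Omega -> R) : A \subset ~: A' ->
  bmc A f -> bmc A' g -> EE (fun w => f w * g w) = EE f * EE g.
Proof.
apply: coord_bmf_indep => //; [exact: labels_meas|exact: coord_sets_meas|
  exact: coord_sets_setI|exact: coord_sets_setT|exact: coord_indep].
Qed.

Lemma bmc_prod (J : eqType) (s : seq J) (A : J -> {set coord n})
  (f : J -> Omega -> R) :
  uniq s -> (forall j k, j \in s -> k \in s -> j != k -> A j \subset ~: A k) ->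
  (forall j, j \in s -> bmc (A j) (f j)) ->
  EE (fun w => \prod_(j <- s) f j w) = \prod_(j <- s) EE (f j).
Proof.
apply: coord_bmf_prod => //; [exact: labels_meas|exact: coord_sets_meas|
  exact: coord_sets_setI|exact: coord_sets_setT|exact: coord_indep].
Qed.

Lemma bmc_bmf A (f : Omega -> R) : bmc A f -> bmf f.
Proof. apply: coord_bmf_bmf; exact: coord_sets_meas. Qed.

Lemma bmc_arc (A : {set coord n}) i j : arcc i j \in A ->
  bmc A (fun w => (Defs.arc U i j w)%:R : R).
Proof.
move=> iA; apply: (coord_bmf_coord coord_sets_setT iA).
apply: bmf_bool; apply: sub_gen_smallest; exists [set true].
by apply/seteqP; split=> w.
Qed.

Lemma bmc_wgt (A : {set coord n}) i j : wgtc i j \in A -> bmc A (B U i j).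
Proof.
move=> iA; apply: (coord_bmf_coord coord_sets_setT iA); split.
  move=> _ Y mY; rewrite setTI; apply: sub_gen_smallest.
  by exists Y.
exists (H S) => w; have /andP[B0 BH] := B_range U_ok i j w.
by rewrite ger0_norm.
Qed.

Lemma entry_meas u : measurable_fun setT (fun X : 'rV[R]_(l S) => X 0 u).
Proof.
move=> _ Y mY; rewrite setTI; apply: sub_gen_smallest.
by exists 0, u, Y; split.
Qed.

Lemma bmc_Q (A : {set coord n}) i u : nodec i \in A ->
  bmc A (fun w => Q U i w 0 u).
Proof.
move=> iA; apply: (coord_bmf_coord coord_sets_setT iA); split.
  move=> _ Y mY; rewrite setTI; apply: sub_gen_smallest.
  exists ((fun X : nodeT => X.1 0 u) @^-1` Y), (fun=> setT); split => //.
    rewrite -[X in measurable X]setTI.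
    have : measurable_fun setT (fun X : nodeT => X.1 0 u).
      exact: measurableT_comp (entry_meas u) measurable_fst.
    exact.
  by apply/seteqP; split=> w //= [].
by exists 1 => w; exact: Q_cube U_ok n i w 0 u.
Qed.

Lemma bmc_R0 (A : {set coord n}) i u : nodec i \in A ->
  bmc A (fun w => R0 U i w 0 u).
Proof.
move=> iA; apply: (coord_bmf_coord coord_sets_setT iA); split.
  move=> _ Y mY; rewrite setTI; apply: sub_gen_smallest.
  exists ((fun X : nodeT => X.2 0 u) @^-1` Y), (fun=> setT); split => //.
    rewrite -[X in measurable X]setTI.
    have : measurable_fun setT (fun X : nodeT => X.2 0 u).
      exact: measurableT_comp (entry_meas u) measurable_snd.
    exact.
  by apply/seteqP; split=> w //= [].
by exists 1 => w; have := Rproc_cube U_ok (n := n) 0 w i u; rewrite /= mxE.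
Qed.

Lemma bmc_Z (A : {set coord n}) i t u C : nodec i \in A -> (t < tau)%N ->
  (forall w, `|Z U i t w 0 u| <= C) -> bmc A (fun w => Z U i t w 0 u).
Proof.
move=> iA tt ZC; apply: (coord_bmf_coord coord_sets_setT iA); split; last by exists C.
move=> _ Y mY; rewrite setTI; apply: sub_gen_smallest.
exists setT, (fun t' => if t' == t then (fun X : 'rV[R]_(l S) => X 0 u) @^-1` Y
  else setT); split => //.
  move=> t'; case: eqP => // _; rewrite -[X in measurable X]setTI.
  exact: entry_meas.
apply/seteqP; split=> w /=.
  by move=> h; split=> // t' _; case: eqP => // ->.
by move=> [_ /(_ t tt)]; rewrite eqxx.
Qed.

Lemma condE_arc i j : EE (fun w => (Defs.arc U i j w)%:R : R) = edge_prob x i j.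
Proof.
transitivity (PP (arc_set (i, j) [set true])).
  rewrite -(condE_indic labels_meas); last exact: arc_set_meas.
  apply: condE_ext => w _; rewrite indicE; congr ((_ : bool)%:R).
  by rewrite /arc_set; apply/idP/idP; rewrite !inE.
rewrite arc_set_law /arc_fac big_bool /= asboolT // asboolF // mul0r addr0.
by rewrite mul1r.
Qed.

Lemma condP_wgt i j A : measurable A ->
  PP [set w | A (B U i j w)] = fine (G (x i) (x j) A).
Proof. exact: (wgt_set_law (i, j)). Qed.

(** The law of a media signal is the kernel averaged over the belief of the
    vertex. *)
Lemma condP_Z i t A : measurable A -> (t < tau)%N ->
  PP [set w | A (Z U i t w)] = EE (fun w => fine (nu (x i) (Q U i w) A)).
Proof.
move=> mA tt.
have := @node_set_law i setT (fun t' => if t' == t then A else setT)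
  measurableT.
rewrite (_ : node_set _ _ _ = [set w | A (Z U i t w)]); last first.
  apply/seteqP; split=> w /=; first by move=> [_ /(_ t tt)]; rewrite eqxx.
  by move=> h; split=> // t' _; case: eqP => // ->.
move=> ->; last by move=> t'; case: eqP.
apply: condE_ext => w _; rewrite indicT mul1r.
rewrite (bigD1 (Ordinal tt)) //= eqxx big1 ?mulr1 // => t' tt'.
rewrite ifN ?prob_kernel //.
Qed.

End model_coordinates.

(** * Means given the labels *)

Section truncation.
Context {R : realType}.

Definition clip (C y : R) : R := Num.max (- C) (Num.min C y).

Lemma clip_id C y : `|y| <= C -> clip C y = y.
Proof.
rewrite ler_norml => /andP[h1 h2]; rewrite /clip min_r // max_r //.
Qed.

Lemma bmf_clip C : bmf (clip C).
Proof.
split.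
  apply: measurable_maxr; first exact: measurable_cst.
  by apply: measurable_minr; first exact: measurable_cst.
exists `|C| => y; rewrite /clip ler_norml /Num.max /Num.min.
have := ler_norm C; have := ler_norm (- C); rewrite normrN.
by case: ifP; case: ifP; move=> *; apply/andP; split; lra.
Qed.

(** The function [h] may be unbounded on [T]; clipping it at a bound of its
    values along [X1] and [X2] changes neither side. *)
Lemma condE_eq_law_real d1 (T1 : measurableType d1) (P1 : probability T1 R)
  d2 (T2 : measurableType d2) (P2 : probability T2 R)
  d (T : measurableType d) (E1 : set T1) (E2 : set T2)
  (X1 : T1 -> T) (X2 : T2 -> T) (h : T -> R) (C : R) :
  measurable E1 -> measurable E2 -> (0 < P1 E1)%E -> (0 < P2 E2)%E ->
  measurable_fun setT X1 -> measurable_fun setT X2 -> measurable_fun setT h ->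
  (forall A, measurable A ->
     condP P1 E1 [set w | A (X1 w)] = condP P2 E2 [set w | A (X2 w)]) ->
  (forall w, `|h (X1 w)| <= C) -> (forall w, `|h (X2 w)| <= C) ->
  condE P1 E1 (fun w => h (X1 w)) = condE P2 E2 (fun w => h (X2 w)).
Proof.
move=> mE1 mE2 E10 E20 mX1 mX2 mh law h1 h2.
have -> : (fun w => h (X1 w)) = (fun w => (clip C \o h) (X1 w)).
  by apply/funext => w /=; rewrite clip_id.
have -> : (fun w => h (X2 w)) = (fun w => (clip C \o h) (X2 w)).
  by apply/funext => w /=; rewrite clip_id.
apply: condE_eq_law => //; split.
  exact: measurableT_comp (bmf_clip C).1 mh.
by have [M hM] := (bmf_clip C).2; exists M => y; exact: hM.
Qed.

End truncation.

Section label_means.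
Context {R : realType} (S : opinion_params R).
Context d1 (Omega : measurableType d1) (P : probability Omega R).
Variables (U : opinion_inputs S Omega) (U_ok : is_opinion_model P U).
Variables (beta : 'I_(K S) -> 'I_(K S) -> R) (beta_ok : is_beta P U beta).
Variable (Rbar : nat -> 'M[R]_(K S, l S)).
Variable (Rbar_ok : is_label_mean P U (fun n i => R0 U i) Rbar).

Definition label_prob n (x : labels S n) : R := fine (P (labels_are U x)).

Lemma label_prob_ge0 n (x : labels S n) : 0 <= label_prob x.
Proof. by rewrite /label_prob fine_ge0. Qed.

Lemma label_prob_gt0 n (x : labels S n) : (0 < label_prob x) = (0 < P (labels_are U x))%E.
Proof.
rewrite /label_prob -lte_fin fineK //; apply: fin_num_measure.
exact: (labels_meas U_ok).
Qed.

Lemma label_event_meas n (a : pred (labels S n)) :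
  measurable [set w | a (Jn U n w)].
Proof.
rewrite (_ : [set w | _] = \bigcup_(x in [set` a]) labels_are U x).
  by apply: fin_bigcup_measurable => // x _; exact: (labels_meas U_ok).
apply/seteqP; split=> w /=; first by move=> h; exists (Jn U n w).
by move=> [x ax ->].
Qed.

(** Law of total expectation; a configuration of probability 0 contributes 0 on
    the left, and on the right whatever its conditional expectation is. *)
Lemma int_labels n (a : pred (labels S n)) (X : Omega -> R) : bmf X ->
  \int[P]_(w in [set w | a (Jn U n w)]) X w =
  \sum_(x | a x) label_prob x * condE P (labels_are U x) X.
Proof.
move=> mX; have P1 : (0 < P setT)%E by rewrite probability_setT.
have key (A : set Omega) : measurable A ->
    \int[P]_(w in A) X w = condE P setT (fun w => \1_A w * X w).
  move=> mA; rewrite /condE probability_setT divr1 Rintegral_mkcond.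
  apply: eq_Rintegral => w _; rewrite /patch indicE.
  by case: (w \in A); rewrite ?mul1r ?mul0r.
rewrite key; last exact: label_event_meas.
transitivity (condE P setT (fun w =>
    \sum_(x | a x) \1_(labels_are U x) w * X w)).
  apply: condE_ext => w _; rewrite -mulr_suml; congr (_ * _).
  rewrite indicE; have [aw|aw] := boolP (a (Jn U n w)).
    rewrite mem_set // (bigD1 (Jn U n w)) //= big1 ?addr0.
      by rewrite indicE mem_set.
    by move=> y /andP[_ yw]; rewrite indicE memNset //= => e; rewrite e eqxx in yw.
  rewrite memNset ?big1 //; last by apply/negP.
  move=> y ay; rewrite indicE memNset //= => e.
  by rewrite e ay in aw.
under [X in condE _ _ X]eq_fun do rewrite -big_filter.
rewrite (condE_sum measurableT P1); last first.
  by move=> x _; apply: bmf_mul => //; apply: bmf_indic; exact: (labels_meas U_ok).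
rewrite big_filter; apply: eq_bigr => x _; rewrite -key; last exact: (labels_meas U_ok).
rewrite /condE -/(label_prob x) mulrC; have [/eqP e|ne] := boolP (label_prob x == 0).
  rewrite e mulr0.
  have [C C0 XC] := bounded_nneg mX.2.
  have mE := labels_meas U_ok x.
  have fE : (P (labels_are U x) < +oo)%E by rewrite -ge0_fin_numE ?fin_num_measure.
  apply/eqP; rewrite -normr_le0; apply: le_trans (le_normr_Rintegral _ _) _ => //.
    exact: bmf_integrable.
  apply: (@le_trans _ _ (\int[P]_(w in labels_are U x) C)).
    apply: le_Rintegral => [//|||w _]; last exact: XC.
      exact: (bmf_integrable P mE (bmf_norm mX)).
    by apply: bmf_integrable => //; exact: bmf_cst.
  by rewrite Rintegral_cst // -/(label_prob x) e mulr0.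
by rewrite mulfVK.
Qed.

Lemma label_event_prob n (a : pred (labels S n)) :
  fine (P [set w | a (Jn U n w)]) = \sum_(x | a x) label_prob x.
Proof.
have := int_labels a (bmf_cst 1).
rewrite Rintegral_cst ?mul1r => [->|]; last exact: label_event_meas.
apply: eq_bigr => x _; have [x0|x0] := boolP (0 < label_prob x).
  by rewrite condE_cst ?mulr1 -?label_prob_gt0 //; exact: (labels_meas U_ok).
have -> : label_prob x = 0 by apply/eqP; rewrite eq_le label_prob_ge0 leNgt x0.
by rewrite mul0r.
Qed.

Lemma sum_label_prob n : \sum_(x : labels S n) label_prob x = 1.
Proof.
have := @label_event_prob n predT; rewrite -[X in _ = X -> _]/(_) => <-.
by rewrite (_ : [set w | _] = setT) ?probability_setT //; apply/seteqP; split.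
Qed.

Lemma condE_label_event n (a : pred (labels S n)) (X : Omega -> R) m :
  bmf X -> (0 < P [set w | a (Jn U n w)])%E ->
  (forall x, a x -> (0 < P (labels_are U x))%E ->
     condE P (labels_are U x) X = m) ->
  condE P [set w | a (Jn U n w)] X = m.
Proof.
move=> mX a0 h; rewrite /condE int_labels // label_event_prob.
have h' x : a x -> label_prob x * condE P (labels_are U x) X = label_prob x * m.
  move=> ax; have [x0|x0] := boolP (0 < label_prob x); first by rewrite h // -label_prob_gt0.
  have -> : label_prob x = 0 by apply/eqP; rewrite eq_le label_prob_ge0 leNgt x0.
  by rewrite !mul0r.
rewrite (eq_bigr _ h') -mulr_suml mulrAC divff ?mul1r // -label_event_prob gt_eqF //.
rewrite fine_gt0 // a0 /= -ge0_fin_numE // fin_num_measure //.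
exact: label_event_meas.
Qed.

Section fixed_labels.
Variables (n : nat) (x : labels S n).
Hypothesis x0 : (0 < P (labels_are U x))%E.
Local Notation EE := (condE P (labels_are U x)).

Lemma bmf_wgt i j : bmf (@B R S Omega U n i j).
Proof.
split; first exact: (B_meas U_ok).
exists (H S) => w; have /andP[B0 BH] := B_range U_ok i j w.
by rewrite ger0_norm.
Qed.

(** [beta] conditions on two labels only: average over the configurations that
    extend them, on which the law of the weight is the same. *)
Lemma condE_wgt i j : EE (B U i j) = beta (x i) (x j).
Proof.
pose a := [pred y : labels S n | (y i == x i) && (y j == x j)].
have aE : [set w | J U i w = x i /\ J U j w = x j] = [set w | a (Jn U n w)].
  by apply/seteqP; split=> w /=; rewrite !ffunE;
    [move=> [-> ->]; rewrite !eqxx|move=> /andP[/eqP -> /eqP ->]].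
have a0 : (0 < P [set w | a (Jn U n w)])%E.
  apply: lt_le_trans x0 _; apply: le_measure; rewrite ?inE.
  - exact: (labels_meas U_ok).
  - exact: label_event_meas.
  - by move=> w /= ->; rewrite !eqxx.
rewrite (betaE beta_ok (n := n) (i := i) (j := j)) ?aE //; symmetry.
apply: condE_label_event => // [|y /= /andP[/eqP yi /eqP yj] y0].
  exact: bmf_wgt.
apply: (@condE_eq_law_real _ _ _ P _ _ P _ _ _ _ (B U i j) (B U i j) id (H S)) => //.
- exact: (labels_meas U_ok).
- exact: (labels_meas U_ok).
- exact: (B_meas U_ok).
- exact: (B_meas U_ok).
- by move=> A mA; rewrite !(condP_wgt U_ok) // yi yj.
- by move=> w; have /andP[B0 BH] := B_range U_ok i j w; rewrite ger0_norm.
- by move=> w; have /andP[B0 BH] := B_range U_ok i j w; rewrite ger0_norm.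
Qed.

Lemma beta_range i j : 0 <= beta (x i) (x j) <= H S.
Proof.
have mE := labels_meas U_ok x.
rewrite -condE_wgt; apply/andP; split.
  apply: (condE_ge0 mE x0) => w _; by have /andP[] := B_range U_ok i j w.
rewrite -[X in _ <= X](condE_cst mE x0).
apply: (condE_le mE x0) => [||w _]; [exact: bmf_wgt|exact: bmf_cst|].
by have /andP[] := B_range U_ok i j w.
Qed.

Lemma R0_entry_cube (i : 'I_n) u w : `|R0 U i w 0 u| <= 1.
Proof. by have := Rproc_cube U_ok (n := n) 0 w i u; rewrite /= mxE. Qed.

Lemma R0_entry_meas (i : 'I_n) u : measurable_fun setT (fun w => R0 U i w 0 u).
Proof. exact: measurableT_comp (entry_meas u) (R0_meas U_ok i). Qed.

Lemma condE_R0 i u : EE (fun w => R0 U i w 0 u) = Rbar n (x i) u.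
Proof.
pose a := [pred y : labels S n | y i == x i].
have aE : [set w | J U i w = x i] = [set w | a (Jn U n w)].
  by apply/seteqP; split=> w /=; rewrite !ffunE; [move=> ->|move/eqP].
have a0 : (0 < P [set w | a (Jn U n w)])%E.
  apply: lt_le_trans x0 _; apply: le_measure; rewrite ?inE.
  - exact: (labels_meas U_ok).
  - exact: label_event_meas.
  - by move=> w /= ->; rewrite !eqxx.
rewrite (label_meanE Rbar_ok (i := i)) ?aE //; symmetry.
apply: condE_label_event => // [|y /= /eqP yi y0].
  by split; [exact: R0_entry_meas|exists 1; exact: R0_entry_cube].
apply: (@condE_eq_law_real _ _ _ P _ _ P _ _ _ _ (R0 U i) (R0 U i)
  (fun X => X 0 u) 1) => //.
- exact: (labels_meas U_ok).
- exact: (labels_meas U_ok).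
- exact: (R0_meas U_ok).
- exact: (R0_meas U_ok).
- exact: entry_meas.
- by move=> A mA; apply: (R0_law U_ok).
- by move=> w; exact: R0_entry_cube.
- by move=> w; exact: R0_entry_cube.
Qed.

End fixed_labels.

Section two_labels.
Variables (n : nat) (x y : labels S n).
Hypothesis x0 : (0 < P (labels_are U x))%E.
Hypothesis y0 : (0 < P (labels_are U y))%E.
Variables (i j : 'I_n) (xy : x i = y j).

Lemma condE_Q_law (h : 'rV[R]_(l S) -> R) : bmf h ->
  condE P (labels_are U x) (fun w => h (Q U i w)) =
  condE P (labels_are U y) (fun w => h (Q U j w)).
Proof.
move=> mh; apply: (condE_eq_law (X1 := Q U i) (X2 := Q U j)) => //.
- exact: (labels_meas U_ok).
- exact: (labels_meas U_ok).
- exact: (Q_meas U_ok).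
- exact: (Q_meas U_ok).
- by move=> A mA; rewrite !(Q_law U_ok) // xy.
Qed.

Lemma condE_Q u : condE P (labels_are U x) (fun w => Q U i w 0 u) =
  condE P (labels_are U y) (fun w => Q U j w 0 u).
Proof.
apply: (@condE_eq_law_real _ _ _ P _ _ P _ _ _ _ (Q U i) (Q U j)
  (fun X => X 0 u) 1) => //.
- exact: (labels_meas U_ok).
- exact: (labels_meas U_ok).
- exact: (Q_meas U_ok).
- exact: (Q_meas U_ok).
- exact: entry_meas.
- by move=> A mA; rewrite !(Q_law U_ok) // xy.
- by move=> w; exact: Q_cube U_ok n i w 0 u.
- by move=> w; exact: Q_cube U_ok n j w 0 u.
Qed.

Lemma condE_Z (t s : nat) u (C : R) :
  (forall w, `|Z U i t w 0 u| <= C) -> (forall w, `|Z U j s w 0 u| <= C) ->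
  condE P (labels_are U x) (fun w => Z U i t w 0 u) =
  condE P (labels_are U y) (fun w => Z U j s w 0 u).
Proof.
move=> Zi Zj.
apply: (@condE_eq_law_real _ _ _ P _ _ P _ _ _ _ (Z U i t) (Z U j s)
  (fun X => X 0 u) C) => //.
- exact: (labels_meas U_ok).
- exact: (labels_meas U_ok).
- exact: (Z_meas U_ok).
- exact: (Z_meas U_ok).
- exact: entry_meas.
- move=> A mA; rewrite (condP_Z U_ok x0 (tau := t.+1)) //.
  rewrite (condP_Z U_ok y0 (tau := s.+1)) // xy.
  apply: (@condE_Q_law (fun q => fine (nu (y j) q A))); split.
    apply: measurableT_comp (fine_measurable _) _ => //.
    exact: measurable_kernel.
  exists 1 => q; rewrite ger0_norm ?fine_ge0 //.
  have nu1 : (nu (y j) q A <= 1%:E)%E.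
    rewrite -(prob_kernel (s := nu (y j)) q).
    by apply: le_measure; rewrite ?inE.
  rewrite -lee_fin fineK // ge0_fin_numE //; exact: le_lt_trans nu1 (ltry _).
Qed.

End two_labels.

End label_means.

(** * Typical labels and edge probabilities *)

Section typical_labels.
Context {R : realType} (S : opinion_params R) (S_ok : params_ok S).
Context d1 (Omega : measurableType d1) (P : probability Omega R).
Variables (U : opinion_inputs S Omega) (U_ok : is_opinion_model P U).

Definition freq n (x : labels S n) r : R := n%:R^-1 * \sum_i (x i == r)%:R.

Definition good (eta : R) n (x : labels S n) : bool :=
  [forall r, `|freq x r - Defs.pi r| <= eta].

(** A property of label configurations is typical when it holds for all large n
    and all possible labels whose frequencies are close enough to [pi]; by
    [bad_labels_vanish] such labels carry almost all the probability. *)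
Definition typ (Phi : forall n, labels S n -> Prop) :=
  exists2 eta : R, 0 < eta & \forall n \near \oo, forall x : labels S n,
    (0 < P (labels_are U x))%E -> good eta x -> Phi n x.

Lemma typ_and (Phi Psi : forall n, labels S n -> Prop) :
  typ Phi -> typ Psi -> typ (fun n x => Phi n x /\ Psi n x).
Proof.
move=> [e e0 H1] [f f0 H2]; exists (Num.min e f); first by rewrite lt_min e0.
move: H1 H2; apply: filterS2 => n h1 h2 x x0 /forallP g; split.
  apply: h1 => //; apply/forallP => r; apply: le_trans (g r) _.
  by rewrite ge_min lexx.
apply: h2 => //; apply/forallP => r; apply: le_trans (g r) _.
by rewrite ge_min lexx orbT.
Qed.

Lemma typ_mono (Phi Psi : forall n, labels S n -> Prop) :
  (forall n x, (0 < P (labels_are U x))%E -> Phi n x -> Psi n x) ->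
  typ Phi -> typ Psi.
Proof.
move=> h [e e0 H1]; exists e => //; move: H1.
by apply: filterS => n h1 x x0 g; apply: h => //; exact: h1.
Qed.

Lemma typ_good (eta : R) : 0 < eta -> typ (good eta).
Proof. by move=> e0; exists eta => //; near=> n. Unshelve. all: by end_near. Qed.

Lemma typ_near (Q : nat -> Prop) : (\forall n \near \oo, Q n) ->
  typ (fun n _ => Q n).
Proof. by move=> h; exists 1 => //; apply: filterS h => n. Qed.

Lemma bad_labels_vanish (eta eps : R) : 0 < eta -> 0 < eps ->
  \forall n \near \oo, \sum_(x : labels S n | ~~ good eta x) label_prob P U x <= eps.
Proof.
move=> e0 p0.
pose bad n r : pred (labels S n) := [pred x | eta <= `|freq x r - Defs.pi r|].
have Kp : 0 < (K S)%:R + 1 :> R by rewrite ltr_wpDl.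
have badr r : \forall n \near \oo,
    \sum_(x : labels S n | bad n r x) label_prob P U x <= eps / ((K S)%:R + 1).
  have /fine_cvgP[_ /cvgr0_norm_le] := label_lln U_ok r e0.
  move=> /(_ _ (divr_gt0 p0 Kp)); apply: filterS => n /= h.
  rewrite -label_event_prob //.
  apply: le_trans h; apply: le_trans (ler_norm _).
  rewrite le_eqVlt; apply/orP; left; apply/eqP; congr (fine (P _)).
  have e w : vertex_counts U r n w = freq (Jn U n w) r.
    by rewrite /vertex_counts /freq; congr (_ * _); apply: eq_bigr => i _;
      rewrite /Jn ffunE.
  by apply/seteqP; split => w /=; rewrite e.
have : \forall n \near \oo, forall r,
    \sum_(x : labels S n | bad n r x) label_prob P U x <= eps / ((K S)%:R + 1).
  exact: filter_forall.
apply: filterS => n h.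
apply: (@le_trans _ _ (\sum_r \sum_(x : labels S n | bad n r x) label_prob P U x)).
  rewrite (exchange_big_dep predT) //=.
  rewrite big_mkcond /=; apply: ler_sum => x _.
  rewrite sumr_const -mulr_natl; case: ifPn => [|_]; last first.
    by rewrite mulr_ge0 // label_prob_ge0.
  rewrite negb_forall => /existsP[r]; rewrite -ltNge => /ltW hr.
  rewrite -[X in X <= _]mul1r ler_wpM2r ?label_prob_ge0 // ler1n; apply/card_gt0P.
  exists r; exact: hr.
apply: (@le_trans _ _ (\sum_(r < K S) eps / ((K S)%:R + 1))).
  by apply: ler_sum => r _; exact: h.
rewrite sumr_const card_ord -[X in X <= _]mulr_natl mulrA ler_pdivrMr //. lra.
Qed.

(** A sum serves as an upper bound for all the kernel values. *)
Definition kmax : R := \sum_r \sum_s kappa (o:=S) r s.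

Lemma kmax_ge0 : 0 <= kmax.
Proof. by apply: sumr_ge0 => r _; apply: sumr_ge0 => s _; exact: kappa_ge0. Qed.

Lemma kappa_le r s : kappa (o:=S) r s <= kmax.
Proof.
rewrite /kmax (bigD1 r) //= (bigD1 s) //= -addrA lerDl addr_ge0 //.
  by apply: sumr_ge0 => t _; exact: kappa_ge0.
by apply: sumr_ge0 => t _; apply: sumr_ge0 => u _; exact: kappa_ge0.
Qed.

Lemma edge_prob_ge0 n (x : labels S n) i j : 0 <= edge_prob x i j.
Proof.
rewrite /edge_prob le_min ler01 andbT !mulr_ge0 ?invr_ge0 //.
  exact: kappa_ge0.
exact: ltW (theta_gt0 S_ok n).
Qed.

Lemma edge_prob_le n (x : labels S n) i j :
  edge_prob x i j / theta S n <= kmax / n%:R.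
Proof.
have t0 := theta_gt0 S_ok n.
rewrite ler_pdivrMr // mulrAC; apply: (@le_trans _ _
  (kappa (o:=S) (x i) (x j) * theta S n / n%:R)).
  by rewrite /edge_prob ge_min lexx.
by rewrite ler_wpM2r ?invr_ge0 // ler_wpM2r ?(ltW t0) // kappa_le.
Qed.

(** Where the truncation at 1 is active, sparsity makes the untruncated value
    at most [1 + eta]. *)
Lemma edge_prob_approx (eta : R) : 0 < eta -> \forall n \near \oo,
  forall (x : labels S n) i j,
  `|edge_prob x i j / theta S n - kappa (o:=S) (x i) (x j) / n%:R|
     <= eta * (kmax / n%:R).
Proof.
move=> e0.
have : (limn_esup (fun n =>
       (\big[Num.max/0]_(r < K S) \big[Num.max/0]_(s < K S)
          (kappa (o:=S) r s * theta S n / n%:R))%:E) < (1 + eta)%:E)%E.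
  by apply: le_lt_trans (theta_sparse S_ok) _; rewrite lte_fin ltrDl.
rewrite /limn_esup limf_esupE => /ereal_inf_lt[_ [V nV <-] h].
apply: filterS nV => n Vn x i j.
have t0 := theta_gt0 S_ok n.
have k0 := kappa_ge0 S_ok (x i) (x j).
have kt : kappa (o:=S) (x i) (x j) * theta S n / n%:R <= 1 + eta.
  rewrite -lee_fin; apply: le_trans (ltW h).
  apply: le_ereal_sup_tmp; eexists; first by exists n.
  rewrite lee_fin; apply: (@le_trans _ _ (\big[Num.max/0]_(s < K S)
          (kappa (o:=S) (x i) s * theta S n / n%:R))).
    exact: (le_bigmax 0 (fun s => kappa (o:=S) (x i) s * theta S n / n%:R)).
  exact: (le_bigmax 0 (fun r => \big[Num.max/0]_(s < K S)
          (kappa (o:=S) r s * theta S n / n%:R))).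
have [n0|n0] := eqVneq n 0%N; first by subst n; have := ltn_ord i.
have np : 0 < n%:R :> R by rewrite ltr0n lt0n.
have kn : eta * (kappa (o:=S) (x i) (x j) / n%:R) <= eta * (kmax / n%:R).
  by rewrite ler_pM2l // ler_wpM2r ?invr_ge0 ?kappa_le // ltW.
apply: le_trans kn; set k0' := kappa (x i) (x j) in kt k0 *.
rewrite /edge_prob -/k0' /Num.min; case: ifPn => [lt1|]; last first.
  rewrite -leNgt => ge1.
  have a1 : 1 / theta S n <= k0' / n%:R.
    rewrite ler_pdivrMr // mulrAC //.
  have a2 : k0' / n%:R <= (1 + eta) / theta S n.
    by rewrite ler_pdivlMr // mulrAC.
  rewrite ler0_norm; last by rewrite subr_le0.
  have : eta * (1 / theta S n) <= eta * (k0' / n%:R) by rewrite ler_pM2l.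
  by move: a2; lra.
have -> : k0' * theta S n / n%:R / theta S n = k0' / n%:R.
  by field; rewrite !gt_eqF.
by rewrite subrr normr0 mulr_ge0 ?(ltW e0) // mulr_ge0 // invr_ge0 ltW.
Qed.

End typical_labels.

(** * Concentration of incoming sums *)

Section concentration.
Context {R : realType} (S : opinion_params R) (S_ok : params_ok S).
Hypothesis theta_infty : theta S n @[n --> \oo] --> +oo.
Context d1 (Omega : measurableType d1) (P : probability Omega R).
Variables (U : opinion_inputs S Omega) (U_ok : is_opinion_model P U).
Local Notation typ := (typ P U).
Local Notation kap := (@kappa R S).

Lemma sum_by_label n (x : labels S n) (f : 'I_(K S) -> R) :
  \sum_j f (x j) = \sum_s (\sum_j (x j == s)%:R) * f s.
Proof.
under [in RHS]eq_bigr do rewrite mulr_suml.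
rewrite exchange_big /=; apply: eq_bigr => j _.
rewrite (bigD1 (x j)) //= eqxx mul1r big1 ?addr0 // => s /negbTE.
by rewrite eq_sym => ->; rewrite mul0r.
Qed.

(** Limit of [\sum_j p_(j, i) / theta * h (x j)] for a vertex [i] of community
    [r]. *)
Definition mean_field (h : 'I_(K S) -> R) r : R := \sum_s Defs.pi s * kap s r * h s.

(** Replacing the edge probabilities by their linearisation and the community
    frequencies by [Defs.pi] costs two errors of order [eta]. *)
Lemma edge_sum (C eps : R) : 0 <= C -> 0 < eps ->
  typ (fun n x => forall (h : 'I_(K S) -> R) i, (forall s, `|h s| <= C) ->
    `|\sum_j edge_prob x j i / theta S n * h (x j) - mean_field h (x i)| <= eps).
Proof.
move=> C0 e0.
have km0 := kmax_ge0 S_ok.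
have D0 : 0 < ((K S)%:R + 1) * (kmax S + 1) * (C + 1).
  by rewrite !mulr_gt0 // ltr_wpDl.
pose eta := eps / (((K S)%:R + 1) * (kmax S + 1) * (C + 1)).
have eta0 : 0 < eta by rewrite divr_gt0.
apply: typ_mono (typ_and (typ_good _ _ eta0)
  (typ_near _ _ (edge_prob_approx S_ok eta0))).
move=> n x x0 [/forallP g ap] h i hC.
have n0 : 0 < n%:R :> R by rewrite ltr0n; exact: leq_ltn_trans (ltn_ord i).
have -> : \sum_j edge_prob x j i / theta S n * h (x j) - mean_field h (x i) =
  \sum_j (edge_prob x j i / theta S n - kap (x j) (x i) / n%:R) * h (x j)
  + \sum_s (freq x s - Defs.pi s) * (kap s (x i) * h s).
  have -> : \sum_s (freq x s - Defs.pi s) * (kap s (x i) * h s) =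
      \sum_j kap (x j) (x i) / n%:R * h (x j) - mean_field h (x i).
    rewrite (sum_by_label x (fun s => kap s (x i) / n%:R * h s)) -sumrB.
    by apply: eq_bigr => s _; rewrite /freq; ring.
  rewrite addrA -big_split /=; congr (_ - _); apply: eq_bigr => j _; ring.
apply: (@le_trans _ _ (\sum_(j < n) eta * (kmax S / n%:R) * C +
                       \sum_(s < K S) eta * (kmax S * C))).
  apply: le_trans (ler_normD _ _) _; apply: lerD.
    apply: le_trans (ler_norm_sum _ _ _) _; apply: ler_sum => j _.
    by rewrite normrM; apply: ler_pM.
  apply: le_trans (ler_norm_sum _ _ _) _; apply: ler_sum => s _.
  rewrite normrM; apply: ler_pM => //.
  rewrite normrM; apply: ler_pM => //.
  by rewrite ger0_norm ?kappa_le // kappa_ge0.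
rewrite !sumr_const !card_ord -[X in X + _]mulr_natl -[X in _ + X]mulr_natl.
have -> : n%:R * (eta * (kmax S / n%:R) * C) = eta * (kmax S * C).
  by field; rewrite gt_eqF.
have -> : eps = eta * (((K S)%:R + 1) * (kmax S + 1) * (C + 1)).
  by rewrite /eta divfK // gt_eqF.
have -> : eta * (kmax S * C) + (K S)%:R * (eta * (kmax S * C)) =
  eta * (((K S)%:R + 1) * (kmax S) * C) by ring.
rewrite ler_pM2l //; apply: ler_pM; rewrite ?mulr_ge0 ?addr_ge0 //; last by lra.
by rewrite ler_wpM2l ?addr_ge0 //; lra.
Qed.

Lemma edge_prob_sum n (x : labels S n) i :
  \sum_j edge_prob x j i <= kmax S * theta S n.
Proof.
have t0 := theta_gt0 S_ok n.
apply: (@le_trans _ _ (\sum_(j < n) kmax S / n%:R * theta S n)).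
  by apply: ler_sum => j _; rewrite -ler_pdivrMr // edge_prob_le.
rewrite sumr_const card_ord -[X in X <= _]mulr_natr mulrAC ler_wpM2r ?(ltW t0) //.
case: n i x t0 => [[]//|n] _ _ _; by rewrite divfK.
Qed.

Section fixed_labels.
Variables (n : nat) (x : labels S n).
Hypothesis x0 : (0 < P (labels_are U x))%E.
Variable tau : nat.
Local Notation EE := (condE P (labels_are U x)).
Local Notation bmc := (coord_bmf (coord_sets U (n := n) tau)).

(** The cross terms of the centred variables vanish by independence. *)
Lemma variance_sum (J : finType) (A : J -> {set coord n}) (X : J -> Omega -> R) :
  (forall j k, j != k -> A j \subset ~: A k) -> (forall j, bmc (A j) (X j)) ->
  EE (fun w => (\sum_j X j w - \sum_j EE (X j)) ^+ 2)
    <= \sum_j EE (fun w => X j w ^+ 2).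
Proof.
move=> dA mX.
have mE := labels_meas U_ok x.
have mX1 j := bmc_bmf U_ok (mX j).
pose Y j w := X j w - EE (X j).
have mY j : bmc (A j) (Y j) by apply: bmf_sub (mX j) (bmf_cst _).
have mY1 j := bmc_bmf U_ok (mY j).
have EY j : EE (Y j) = 0.
  by rewrite /Y (condE_sub mE (mX1 j) (bmf_cst _)) (condE_cst mE x0) subrr.
have -> : (fun w => (\sum_j X j w - \sum_j EE (X j)) ^+ 2) =
    (fun w => \sum_j \sum_k Y j w * Y k w).
  apply/funext => w; rewrite -sumrB expr2 mulr_suml.
  by apply: eq_bigr => j _; rewrite mulr_sumr.
rewrite (condE_sum mE x0); last first.
  by move=> j _; apply: bmf_sum => k _; exact: bmf_mul.
apply: ler_sum => j _.
rewrite (condE_sum mE x0); last by move=> k _; exact: bmf_mul.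
rewrite (bigD1 j) //= big1 ?addr0; last first.
  move=> k kj; rewrite (bmc_mul U_ok x0 _ (mY j) (mY k)) ?EY ?mul0r //.
  by apply: dA; rewrite eq_sym.
have -> : (fun w => Y j w * Y j w) = (fun w => X j w ^+ 2 +
    ((- 2%:R * EE (X j)) * X j w + EE (X j) ^+ 2)).
  by apply/funext => w; rewrite /Y; ring.
have m2 : bmf (fun w => X j w ^+ 2).
  by under eq_fun do rewrite expr2; exact: bmf_mul.
rewrite (condE_add mE m2); last first.
  by apply: bmf_add; [exact: bmf_scale|exact: bmf_cst].
rewrite (condE_add mE (bmf_scale _ (mX1 j)) (bmf_cst _)).
rewrite (condE_scale mE _ (mX1 j)) (condE_cst mE x0).
rewrite gerDl (_ : _ + _ = - EE (X j) ^+ 2); last by ring.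
by rewrite oppr_le0 sqr_ge0.
Qed.

(** From [2 * al * |z| <= al ^+ 2 + z ^+ 2], which avoids square roots. *)
Lemma L1_le_L2 (f : Omega -> R) al : 0 < al -> bmf f ->
  EE (fun w => `|f w|) <= al + al^-1 * EE (fun w => f w ^+ 2).
Proof.
move=> al0 mf; have mE := labels_meas U_ok x.
have m2 : bmf (fun w => f w ^+ 2).
  by under eq_fun do rewrite expr2; exact: bmf_mul.
rewrite -(condE_scale mE _ m2) -[X in _ <= X + _](condE_cst mE x0).
rewrite -(condE_add mE (bmf_cst _) (bmf_scale _ m2)).
apply: (condE_le mE x0 (bmf_norm mf)).
  by apply: bmf_add; [exact: bmf_cst|exact: bmf_scale].
move=> w _; rewrite -(ler_pM2l al0) mulrDr mulrA divff ?gt_eqF // mul1r.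
have := sqr_ge0 (al - `|f w|); rewrite sqrrB -[f w ^+ 2]real_normK ?num_real //.
have : 0 <= al * `|f w| by rewrite mulr_ge0 // ltW.
rewrite -!expr2; lra.
Qed.

Lemma bmc_arc_mul i j (Y : Omega -> R) :
  bmc [set wgtc i j; nodec j] Y ->
  bmc [set arcc j i; wgtc i j; nodec j] (fun w => (Defs.arc U j i w)%:R * Y w).
Proof.
move=> mY; apply: bmf_mul.
  by apply: bmc_arc; rewrite !inE eqxx.
apply: coord_bmf_sub mY; apply/fintype.subsetP => a; rewrite !inE.
by move=> /orP[] ->; rewrite ?orbT.
Qed.

Lemma condE_arc_mul i j (Y : Omega -> R) : bmc [set wgtc i j; nodec j] Y ->
  EE (fun w => (Defs.arc U j i w)%:R * Y w) = edge_prob x j i * EE Y.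
Proof.
move=> mY.
have ma : bmc [set arcc j i] (fun w => (Defs.arc U j i w)%:R : R).
  by apply: bmc_arc; rewrite inE.
rewrite (bmc_mul U_ok x0 _ ma mY) ?(condE_arc U_ok x0 tau) //.
by apply/fintype.subsetP => a; rewrite !inE => /eqP ->.
Qed.

End fixed_labels.

(** Law of large numbers for the in-neighbourhood of a vertex: the second
    moment of the centred sum is of order [theta n], against a normalisation
    by [theta n]. *)
Lemma in_sum_concentration tau (b eps : R) : 0 <= b -> 0 < eps ->
  typ (fun n x => forall i (Y : 'I_n -> Omega -> R) (h : 'I_(K S) -> R),
    (forall j, coord_bmf (coord_sets U tau) [set wgtc i j; nodec j] (Y j)) ->
    (forall j w, `|Y j w| <= b) -> (forall s, `|h s| <= b) ->
    condE P (labels_are U x) (fun w =>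
      `|(\sum_j (Defs.arc U j i w)%:R * Y j w) / theta S n
         - mean_field h (x i)|) <=
    eps + kmax S / n%:R * \sum_j `|condE P (labels_are U x) (Y j) - h (x j)|).
Proof.
move=> b0 e0; have km0 := kmax_ge0 S_ok.
have e4 : 0 < eps / 4%:R by rewrite divr_gt0.
have tn : \forall n \near \oo, b ^+ 2 * kmax S / (eps / 4%:R) ^+ 2 <= theta S n.
  by move/cvgryPge: theta_infty; apply.
apply: typ_mono (typ_and (edge_sum b0 (divr_gt0 e0 (ltr0Sn R 1)))
  (typ_near _ _ tn)).
move=> n x x0 [es {}tn] i Y h mY Yb hb.
have t0 := theta_gt0 S_ok n; have mE := labels_meas U_ok x.
pose X j w := (Defs.arc U j i w)%:R * Y j w.
pose A j : {set coord n} := [set arcc j i; wgtc i j; nodec j]%SET.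
have mX j : coord_bmf (coord_sets U tau) (A j) (X j) by exact: bmc_arc_mul.
have EX j : condE P (labels_are U x) (X j) =
    edge_prob x j i * condE P (labels_are U x) (Y j).
  exact: condE_arc_mul.
have mX1 j := bmc_bmf U_ok (mX j).
have dA j k : j != k -> A j \subset ~: A k.
  move=> jk; apply/fintype.subsetP => a; rewrite !inE -!orbA.
  by move=> /or3P[] /eqP ->; rewrite /= ?orbF ?(inj_eq inl_inj) ?(inj_eq inr_inj)
    ?xpair_eqE ?eqxx ?andbT ?orbF //=.
set m := \sum_j edge_prob x j i / theta S n * condE P (labels_are U x) (Y j).
pose Z w := (\sum_j X j w) / theta S n - m.
have ms : bmf (fun w => \sum_j X j w) by apply: bmf_sum.
have mZ : bmf Z.
  apply: bmf_sub (bmf_cst _); apply: bmf_mul => //; exact: bmf_cst.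
have ZE w : Z w = (theta S n)^-1 *
    (\sum_j X j w - \sum_j condE P (labels_are U x) (X j)).
  rewrite /Z mulrBr mulrC; congr (_ - _); rewrite /m mulr_sumr.
  by apply: eq_bigr => j _; rewrite EX; ring.
have vZ : condE P (labels_are U x) (fun w => Z w ^+ 2) <= b ^+ 2 * kmax S / theta S n.
  under [X in condE _ _ X]eq_fun do rewrite ZE exprMn.
  rewrite (condE_scale mE); last first.
    under eq_fun do rewrite expr2; apply: bmf_mul;
    apply: bmf_sub (bmf_cst _) => //.
  apply: (@le_trans _ _ ((theta S n)^-1 ^+ 2 *
     \sum_j b ^+ 2 * edge_prob x j i)).
    rewrite ler_wpM2l ?sqr_ge0 //.
    apply: le_trans (variance_sum x0 dA mX) _; apply: ler_sum => j _.
    rewrite -(condE_arc U_ok x0 tau) -(condE_scale mE); last first.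
      exact: bmf_bool (arc_meas U_ok _ _).
    apply: (condE_le mE x0).
    - by under eq_fun do rewrite expr2; exact: bmf_mul.
    - by apply: bmf_scale; exact: bmf_bool (arc_meas U_ok _ _).
    - move=> w _; rewrite /X; case: (Defs.arc U j i w) => /=.
        rewrite mul1r mulr1 -[X in X <= _]real_normK ?num_real //.
        by rewrite ler_sqr ?nnegrE.
      by rewrite mul0r mulr0 expr0n.
  rewrite -mulr_sumr expr2 -mulrA [X in _ <= X]mulrC ler_pM2l ?invr_gt0 //.
  rewrite mulrCA ler_wpM2l ?sqr_ge0 // ler_pdivrMl // mulrC.
  exact: edge_prob_sum.
have LZ : condE P (labels_are U x) (fun w => `|Z w|) <= eps / 2%:R.
  apply: le_trans (L1_le_L2 x0 e4 mZ) _.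
  suff : (eps / 4%:R)^-1 * condE P (labels_are U x) (fun w => Z w ^+ 2)
     <= eps / 4%:R by lra.
  rewrite ler_pdivrMl // -expr2; apply: le_trans vZ _.
  by rewrite ler_pdivrMr // -ler_pdivrMl ?exprn_gt0 // mulrC.
have dm : `|m - mean_field h (x i)| <= eps / 2%:R +
    kmax S / n%:R * \sum_j `|condE P (labels_are U x) (Y j) - h (x j)|.
  have -> : m - mean_field h (x i) =
     \sum_j edge_prob x j i / theta S n * h (x j) - mean_field h (x i) +
     \sum_j edge_prob x j i / theta S n * (condE P (labels_are U x) (Y j) - h (x j)).
    rewrite addrAC -big_split /=; congr (_ - _); apply: eq_bigr => j _; ring.
  apply: le_trans (ler_normD _ _) _; apply: lerD; first exact: es.
  apply: le_trans (ler_norm_sum _ _ _) _; rewrite mulr_sumr.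
  apply: ler_sum => j _; rewrite normrM ler_wpM2r // ger0_norm ?edge_prob_le //.
  by rewrite divr_ge0 ?edge_prob_ge0 // ltW.
apply: (@le_trans _ _ (condE P (labels_are U x) (fun w => `|Z w| +
    `|m - mean_field h (x i)|))).
  apply: (condE_le mE x0).
  - apply: bmf_norm; apply: bmf_sub (bmf_cst _); apply: bmf_mul => //.
    exact: bmf_cst.
  - by apply: bmf_add; [exact: bmf_norm|exact: bmf_cst].
  - move=> w _; rewrite (_ : _ - _ = Z w + (m - mean_field h (x i))).
      exact: ler_normD.
    by rewrite /Z /X; ring.
rewrite (condE_add mE (bmf_norm mZ) (bmf_cst _)) (condE_cst mE x0).
by lra.
Qed.

End concentration.

(** * The recursion of the approximating process *)

Section approximating_recursion.
Context {R : realType} (S : opinion_params R) (S_ok : params_ok S).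
Local Notation e := (1 - c S - d S).

Lemma coef_ge0 : [/\ 0 <= c S, 0 <= d S, 0 <= e & c S + e <= 1].
Proof.
have /andP[c0 _] := c_range S_ok; have /andP[d0 _] := d_range S_ok.
by have /andP[_ cd] := cd_range S_ok; split => //; lra.
Qed.

Section rho.
Variables (beta : 'I_(K S) -> 'I_(K S) -> R) (Wb Rb : 'M[R]_(K S, l S)).
Local Notation Mb := (@M R S beta).

(** Mean opinions by community in the limit. *)
Fixpoint rho k : 'M[R]_(K S, l S) :=
  if k is k'.+1 then c S *: (Mb *m rho k') + Wb + e *: rho k' else Rb.

(** One coordinate of a process that follows the mean field [m] and the
    signals [v]. *)
Fixpoint driven (m : nat -> R) (r0 : R) (v : nat -> R) k : R :=
  if k is k'.+1 then c S * m k' + v k + e * driven m r0 v k' else r0.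

Let N t : 'M[R]_(K S) := \sum_(0 <= s < t.+1) a S s t *: Mb ^+ s.
Let D t : 'M[R]_(K S) := \sum_(1 <= s < t.+1) a S s t *: Mb ^+ s.

(* The coefficients are those of the powers of [c M + (1 - c - d)], whence the
   Pascal recursions. *)
Lemma a_rec0 t : a S 0 t.+1 = e * a S 0 t.
Proof. by rewrite /a !bin0 !subn0 exprS expr0; ring. Qed.

Lemma a_recS s t : a S s.+1 t.+1 = c S * a S s t + e * a S s.+1 t.
Proof.
rewrite /a binS subSS exprS natrD mulrDl mulrDl addrC; congr (_ + _).
  by ring.
have [st|ts] := ltnP s t; first by rewrite -(subnSK st) exprS; ring.
by rewrite bin_small // ?ltnS // !mul0r mulr0.
Qed.

Let ND t : N t = a S 0 t *: 1%:M + D t.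
Proof. by rewrite /N big_nat_recl // /D big_add1 /= expr0. Qed.

Let N_rec t : N t.+1 = c S *: (Mb *m N t) + e *: N t.
Proof.
rewrite /N big_nat_recl // a_rec0 expr0.
have -> : e *: (\sum_(0 <= s < t.+1) a S s t *: Mb ^+ s) =
    e *: (\sum_(0 <= s < t.+2) a S s t *: Mb ^+ s).
  rewrite [in RHS]big_nat_recr //=; have -> : a S t.+1 t = 0.
    by rewrite /a bin_small // !mul0r.
  by rewrite scale0r addr0.
rewrite [in X in _ + e *: X]big_nat_recl // expr0 scalerDr scalerA addrCA.
congr (_ + _); rewrite mulmx_sumr !scaler_sumr -big_split /=.
apply: eq_bigr => s _; rewrite a_recS scalerDl -!scalerA; congr (_ + _).
by rewrite -!scalemxAr exprS.
Qed.

Let D_rec t : D t.+1 = c S *: (Mb *m N t) + e *: D t.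
Proof.
apply: (addrI (a S 0 t.+1 *: 1%:M)); rewrite -ND N_rec [in e *: N t]ND scalerDr.
by rewrite a_rec0 scalerA addrCA.
Qed.

Let D0 : D 0 = 0.
Proof. by rewrite /D big_geq. Qed.

Let rhoE k : rho k = N k *m Rb + \sum_(0 <= t < k) N t *m Wb.
Proof.
elim: k => [|k IH].
  by rewrite big_geq // addr0 ND D0 addr0 /a bin0 subnn expr0 !mulr1 scale1r mul1mx.
rewrite [rho _]/= IH big_nat_recl // N_rec.
have -> : N 0 *m Wb = Wb.
  by rewrite ND D0 addr0 /a bin0 subnn expr0 !mulr1 scale1r mul1mx.
under [in RHS]eq_bigr do rewrite N_rec mulmxDl -!scalemxAl -mulmxA.
rewrite big_split /= -!scaler_sumr -mulmx_sumr mulmxDr !scalerDr mulmxDl.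
rewrite -!scalemxAl -mulmxA.
have AC (V : zmodType) (x1 x2 w y1 y2 : V) :
    x1 + x2 + w + (y1 + y2) = x1 + y1 + (w + (x2 + y2)).
  rewrite -!addrA; congr (x1 + _); rewrite (addrCA y1 w) (addrCA x2 w).
  by congr (w + _); rewrite addrCA.
exact: AC.
Qed.

(** The explicit formula of the approximating process solves the one-step
    recursion in which the weighted average of the neighbours is replaced by
    the mean field of [rho]. *)
Lemma Rapprox_driven (Omega : Type) (U : opinion_inputs S Omega) n (i : 'I_n)
    k w u :
  Rapprox U beta Wb Rb i k w 0 u =
  driven (fun t => (Mb *m rho t) (J U i w) u) (R0 U i w 0 u)
         (fun t => W U i t w 0 u) k.
Proof.
pose T k := D k *m Rb + \sum_(0 <= t < k) D t *m Wb.
have T_rec t : T t.+1 = c S *: (Mb *m rho t) + e *: T t.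
  rewrite /T D_rec big_nat_recl // D0 mul0mx add0r rhoE.
  under eq_bigr do rewrite D_rec mulmxDl -!scalemxAl -mulmxA.
  rewrite big_split /= -!scaler_sumr -mulmx_sumr mulmxDr !scalerDr mulmxDl.
  rewrite -!scalemxAl -mulmxA -!addrA; congr (_ + _).
  by rewrite addrCA.
have RE : Rapprox U beta Wb Rb i k w = \sum_(0 <= t < k) e ^+ t *: W U i (k - t) w
    + row (J U i w) (T k) + e ^+ k *: R0 U i w.
  rewrite /Rapprox; case: eqP => [->|/eqP k0].
    by rewrite /T D0 !big_geq // mul0mx addr0 row0 add0r add0r expr0 scale1r.
  congr (_ + _); rewrite -addrA; congr (_ + _).
  rewrite /T; case: k k0 => // k' _.
  rewrite [in RHS]big_nat_recl // D0 mul0mx add0r addrC linearD /=; congr (_ + _).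
    rewrite /D mulmx_suml linear_sum; apply: eq_bigr => s _.
    by rewrite -scalemxAl linearZ.
  rewrite big_add1 /= linear_sum; apply: eq_bigr => t _.
  rewrite /D mulmx_suml linear_sum; apply: eq_bigr => s _.
  by rewrite -scalemxAl linearZ.
rewrite RE; elim: k {RE} => [|k IH].
  by rewrite /T D0 !big_geq // mul0mx addr0 row0 add0r add0r expr0 scale1r.
rewrite [driven _ _ _ _]/= -IH T_rec big_nat_recl // expr0 scale1r subn0.
under eq_bigr do rewrite subSS exprS -scalerA.
by rewrite -scaler_sumr exprS -scalerA !mxE; ring.
Qed.

Hypothesis beta0 : forall r s, 0 <= beta r s.
Hypothesis Wb1 : forall r u, `|Wb r u| <= 1.
Hypothesis Rb1 : forall r u, `|Rb r u| <= 1.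

Lemma M_ge0 r s : 0 <= Mb r s.
Proof.
rewrite mxE /=; case: ifP => // h; rewrite divr_ge0 ?(ltW h) //.
apply: mulr_ge0; last exact: (kappa_ge0 S_ok).
by apply: mulr_ge0 => //; apply: ltW; exact: (Defs.pi_gt0 S_ok).
Qed.

Lemma M_sum r : \sum_s Mb r s <= 1.
Proof.
pose den := \sum_t Defs.pi t * beta r t * kappa (o:=S) t r.
have E s : Mb r s = if 0 < den then Defs.pi s * beta r s * kappa s r / den else 0.
  by rewrite mxE.
under eq_bigr do rewrite E; have [h|h] := boolP (0 < den).
  by rewrite -mulr_suml divff // gt_eqF.
by rewrite big1 ?ler01.
Qed.

Lemma M_avg (h : 'I_(K S) -> R) (C : R) r : (forall s, `|h s| <= C) ->
  `|\sum_s Mb r s * h s| <= C.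
Proof.
move=> hC; have C0 : 0 <= C by exact: le_trans (hC r).
apply: le_trans (ler_norm_sum _ _ _) _.
apply: (@le_trans _ _ (\sum_s Mb r s * C)).
  by apply: ler_sum => s _; rewrite normrM ger0_norm ?M_ge0 // ler_wpM2l ?M_ge0.
rewrite -mulr_suml -[X in _ <= X]mul1r; exact: ler_wpM2r (M_sum r).
Qed.

Lemma rho_bound k r u : `|rho k r u| <= k.+1%:R.
Proof.
have [c0 d0 e0 ce] := coef_ge0.
elim: k r => [|k IH] r; first by apply: le_trans (Rb1 r u) _.
have mb : `|(Mb *m rho k) r u| <= k.+1%:R by rewrite mxE; apply: M_avg => s.
rewrite [rho _]/= !mxE; rewrite mxE in mb.
apply: le_trans (ler_normD _ _) _; apply: le_trans (lerD (ler_normD _ _) (lexx _)) _.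
rewrite !normrM (ger0_norm c0) (ger0_norm e0).
have h1 : c S * `|\sum_j Mb r j * rho k j u| <= c S * k.+1%:R by rewrite ler_wpM2l.
have h2 : e * `|rho k r u| <= e * k.+1%:R by rewrite ler_wpM2l.
have h3 : (c S + e) * k.+1%:R <= 1 * k.+1%:R by rewrite ler_wpM2r.
have := Wb1 r u; rewrite -[k.+2%:R]natr1; lra.
Qed.

Lemma Mrho_bound k r u : `|(Mb *m rho k) r u| <= k.+1%:R.
Proof. by rewrite mxE; apply: M_avg => s; exact: rho_bound. Qed.

End rho.

(** The retention coefficient is at most 1, so the errors made in the signals at
    worst add up. *)
Lemma driven_diff m r0 v v' (q : R) k : (forall t, `|v t - v' t| <= q) ->
  `|driven m r0 v k - driven m r0 v' k| <= k%:R * q.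
Proof.
move=> vq; have [c0 d0 e0 ce] := coef_ge0.
have q0 : 0 <= q by exact: le_trans (vq 0%N).
elim: k => [|k IH]; first by rewrite subrr normr0 mul0r.
rewrite /= (_ : _ - _ = (v k.+1 - v' k.+1) +
  e * (driven m r0 v k - driven m r0 v' k)); last by ring.
apply: le_trans (ler_normD _ _) _; rewrite normrM (ger0_norm e0) -natr1.
have h : e * `|driven m r0 v k - driven m r0 v' k| <= 1 * (k%:R * q).
  by apply: ler_pM => //; lra.
have := vq k.+1; lra.
Qed.

Lemma driven_bound m r0 v k : (forall t, `|m t| <= t.+1%:R) -> `|r0| <= 1 ->
  (forall t, `|v t| <= 2%:R) -> `|driven m r0 v k| <= 2%:R * k.+1%:R.
Proof.
move=> mb rb vb; have [c0 d0 e0 ce] := coef_ge0.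
elim: k => [|k IH]; first by rewrite /=; lra.
rewrite [driven _ _ _ _]/=.
apply: le_trans (ler_normD _ _) _; apply: le_trans (lerD (ler_normD _ _) (lexx _)) _.
rewrite !normrM (ger0_norm c0) (ger0_norm e0).
have h1 : c S * `|m k| <= c S * k.+1%:R by rewrite ler_wpM2l.
have h2 : e * `|driven m r0 v k| <= e * (2%:R * k.+1%:R) by rewrite ler_wpM2l.
have h3 : (c S + e) * k.+1%:R <= 1 * k.+1%:R by rewrite ler_wpM2r.
have h4 : 0 <= c S * k.+1%:R by rewrite mulr_ge0.
have := vb k.+1; rewrite -[k.+2%:R]natr1; lra.
Qed.

End approximating_recursion.

(** * The error as a walk on the graph *)

Section weights.
Context {R : realType} (S : opinion_params R).
Context d1 (Omega : measurableType d1) (P : probability Omega R).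
Variables (U : opinion_inputs S Omega) (U_ok : is_opinion_model P U).
Variable n : nat.

(** By the convention [0^-1 = 0], the quotient covers the case of total weight 0. *)
Lemma C_entry (i j : 'I_n) w : Defs.C U n w i j =
  (i != j)%:R * (B U i j w * (Defs.arc U j i w)%:R * (weight_sum U i w)^-1).
Proof.
rewrite mxE; case: (i != j); rewrite ?andbF ?mul0r // mul1r andbT.
have s0 : 0 <= weight_sum U i w.
  apply: sumr_ge0 => k _; rewrite mulr_ge0 //.
  by have /andP[] := B_range U_ok i k w.
case: ltP => // s1; have -> : weight_sum U i w = 0 by apply/eqP; rewrite eq_le s1.
by rewrite invr0 mulr0.
Qed.

Lemma weight_ge0 (i j : 'I_n) w : 0 <= B U i j w * (Defs.arc U j i w)%:R.
Proof. by rewrite mulr_ge0 //; have /andP[] := B_range U_ok i j w. Qed.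

Lemma weight_sum_ge0 (i : 'I_n) w : 0 <= weight_sum U i w.
Proof. by apply: sumr_ge0 => k _; exact: weight_ge0. Qed.

Lemma C_ge0 (i j : 'I_n) w : 0 <= Defs.C U n w i j.
Proof.
by rewrite C_entry !mulr_ge0 ?invr_ge0 ?weight_sum_ge0 //;
  have /andP[] := B_range U_ok i j w.
Qed.

Lemma C_sum (i : 'I_n) w : \sum_j Defs.C U n w i j <= 1.
Proof.
apply: (@le_trans _ _ (\sum_j B U i j w * (Defs.arc U j i w)%:R *
    (weight_sum U i w)^-1)).
  apply: ler_sum => j _; rewrite C_entry.
  rewrite ler_piMl //; last by case: (i != j).
  by rewrite mulr_ge0 ?weight_ge0 // invr_ge0 weight_sum_ge0.
rewrite -mulr_suml -/(weight_sum U i w).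
have [->|s0] := eqVneq (weight_sum U i w) 0; first by rewrite mul0r.
by rewrite divff.
Qed.

Lemma C_le1 (i j : 'I_n) w : Defs.C U n w i j <= 1.
Proof.
apply: le_trans (C_sum i w); rewrite (bigD1 j) //= lerDl.
by apply: sumr_ge0 => k _; exact: C_ge0.
Qed.

Lemma C_diag (i : 'I_n) w : Defs.C U n w i i = 0.
Proof. by rewrite C_entry eqxx mul0r. Qed.

End weights.

Section walk.
Context {R : realType} (S : opinion_params R) (S_ok : params_ok S).
Context d1 (Omega : measurableType d1) (P : probability Omega R).
Variables (U : opinion_inputs S Omega) (U_ok : is_opinion_model P U).
Variables (beta : 'I_(K S) -> 'I_(K S) -> R) (Wb Rb : 'M[R]_(K S, l S)).
Hypothesis beta0 : forall r s, 0 <= beta r s.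
Hypothesis Wb1 : forall r u, `|Wb r u| <= 1.
Hypothesis Rb1 : forall r u, `|Rb r u| <= 1.
Variables (n : nat) (x : labels S n).
Hypothesis x0 : (0 < P (labels_are U x))%E.
Variables (tau : nat) (u : 'I_(l S)).
Local Notation EE := (condE P (labels_are U x)).
Local Notation bmc := (coord_bmf (coord_sets U (n := n) tau)).
Local Notation e := (1 - c S - d S).
Local Notation CC w i j := (Defs.C U n w i j).

(** Communities in which every vertex has in-degree 0. *)
Definition iso (r : 'I_(K S)) : bool := [forall s, kappa s r == 0].

(** The external signal with the indicator of in-degree 0 replaced by its
    limit: it only depends on the data of the vertex itself. *)
Definition Wnode (i : 'I_n) t w : R :=
  d S * Z U i t w 0 u + c S * (iso (x i))%:R * Q U i w 0 u.

Definition field (r : 'I_(K S)) t : R := (M beta *m rho beta Wb Rb t) r u.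

Definition node (i : 'I_n) k w : R :=
  driven S (field (x i)) (R0 U i w 0 u) (fun t => Wnode i t w) k.

Definition isodev (i : 'I_n) w : R :=
  `|(indeg U i w == 0%N)%:R - (iso (x i))%:R|.

(** The error of one step: fluctuation of the weighted average around the mean
    field, and replacement of the in-degree indicator. *)
Definition innov (i : 'I_n) k w : R :=
  `|\sum_j CC w i j * node j k w - field (x i) k| + isodev i w.

(** Bounds the error at [i] after [k] steps by following the listening
    relation backwards; a walk that comes back to a visited vertex, recorded in
    [A], is charged the trivial bound [b]. Avoiding the visited vertices makes
    the rows of the weight matrix met along the walk independent. *)
Fixpoint walk (b : R) k (A : {set 'I_n}) (i : 'I_n) w : R :=
  if k is k'.+1 then
    \sum_j CC w i j * (if j \in i |: A then b else walk b k' (i |: A) j w)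
    + innov i k' w + walk b k' A i w
  else 0.

Lemma isodev_le1 i w : 0 <= isodev i w <= 1.
Proof.
rewrite /isodev normr_ge0 /=; case: (indeg U i w == 0%N); case: (iso (x i)) => /=;
  by rewrite ?subrr ?subr0 ?sub0r ?normrN ?normr1 ?normr0.
Qed.

Lemma W_Wnode i t w : `|W U i t w 0 u - Wnode i t w| <= isodev i w.
Proof.
have [c0 d0 e0 ce] := coef_ge0 S_ok.
rewrite /W !mxE (_ : _ - _ = c S * ((indeg U i w == 0%N)%:R - (iso (x i))%:R)
  * Q U i w 0 u); last by rewrite /Wnode; ring.
rewrite !normrM (ger0_norm c0) -/(isodev i w).
have /andP[q0 q1] := isodev_le1 i w.
have := Q_cube U_ok i w 0 u => Q1.
have c1 : c S <= 1 by lra.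
rewrite -[X in _ <= X]mulr1; apply: ler_pM => //; first by rewrite mulr_ge0.
by rewrite ler_piMl.
Qed.

Lemma Wnode_bound i t w : `|Wnode i t w| <= 2%:R.
Proof.
have /andP[q0 q1] := isodev_le1 i w; have wq := W_Wnode i t w.
have W1 : `|W U i t w 0 u| <= 1 by exact: (W_cube U_ok i t w 0 u).
have := ler_normB (W U i t w 0 u) (W U i t w 0 u - Wnode i t w).
rewrite (_ : _ - (_ - _) = Wnode i t w); last by ring.
lra.
Qed.

Lemma node_bound i k w : `|node i k w| <= 2%:R * k.+1%:R.
Proof.
apply: (driven_bound S_ok) => [t||t].
- exact: Mrho_bound.
- exact: (R0_entry_cube U_ok).
- exact: Wnode_bound.
Qed.

Lemma Z_bound (i : 'I_n) t w : `|Z U i t w 0 u| <= 2%:R / d S.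
Proof.
have [c0 d0 e0 ce] := coef_ge0 S_ok; have dp := d_gt0 S_ok.
rewrite ler_pdivlMr // mulrC -[X in X * _](ger0_norm d0) -normrM.
have W1 : `|W U i t w 0 u| <= 1 by exact: (W_cube U_ok i t w 0 u).
have Q1 := Q_cube U_ok i w 0 u.
have -> : d S * Z U i t w 0 u = W U i t w 0 u -
  c S * (indeg U i w == 0%N)%:R * Q U i w 0 u by rewrite /W !mxE; ring.
apply: le_trans (ler_normB _ _) _.
have : `|c S * (indeg U i w == 0%N)%:R * Q U i w 0 u| <= 1; last by lra.
rewrite !normrM (ger0_norm c0) -[X in _ <= X]mulr1; apply: ler_pM => //; first by rewrite mulr_ge0.
rewrite -[X in _ <= X]mulr1; apply: ler_pM => //; first by lra.
by case: eqP; rewrite ?normr1 ?normr0.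
Qed.

Lemma Rproc_step i k w : Rproc U n k.+1 w i u =
  c S * (\sum_j CC w i j * Rproc U n k w j u) + W U i k.+1 w 0 u
  + e * Rproc U n k w i u.
Proof. by rewrite /= !mxE. Qed.

Lemma node_step i k w : node i k.+1 w =
  c S * field (x i) k + Wnode i k.+1 w + e * node i k w.
Proof. by []. Qed.

(** Subtracting the recursions of the process and of [node] expresses the error
    at [i] by the errors at its in-neighbours and the one-step error. *)
Lemma error_walk b kk : (forall k, (k <= kk)%N -> 2%:R * k.+1%:R + 1 <= b) ->
  forall k A i w, (k <= kk)%N ->
  `|Rproc U n k w i u - node i k w| <= walk b k A i w.
Proof.
move=> bb; have [c0 d0 e0 ce] := coef_ge0 S_ok.
have tb k i w : (k <= kk)%N -> `|Rproc U n k w i u - node i k w| <= b.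
  move=> kkk; apply: le_trans (bb k kkk); apply: le_trans (ler_normB _ _) _.
  by rewrite addrC lerD ?node_bound //; exact: (Rproc_cube U_ok).
elim=> [|k IH] A i w kkk; first by rewrite /= mxE subrr normr0.
have kk' := ltnW kkk.
rewrite Rproc_step node_step [walk _ _ _ _ _]/=.
rewrite (_ : _ - _ = c S * (\sum_j CC w i j * (Rproc U n k w j u - node j k w))
  + c S * (\sum_j CC w i j * node j k w - field (x i) k)
  + (W U i k.+1 w 0 u - Wnode i k.+1 w)
  + e * (Rproc U n k w i u - node i k w)); last first.
  under [in RHS]eq_bigr do rewrite mulrBr.
  by rewrite sumrB; ring.
have h1 : `|c S * (\sum_j CC w i j * (Rproc U n k w j u - node j k w))| <=
    \sum_j CC w i j * (if j \in i |: A then b else walk b k (i |: A) j w).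
  rewrite normrM (ger0_norm c0) -[X in _ <= X]mul1r; apply: ler_pM => //.
    by lra.
  apply: le_trans (ler_norm_sum _ _ _) _; apply: ler_sum => j _.
  rewrite normrM (ger0_norm (C_ge0 U_ok i j w)) ler_wpM2l ?(C_ge0 U_ok) //.
  by case: ifP => _; [exact: tb|exact: IH].
have h2 : `|c S * (\sum_j CC w i j * node j k w - field (x i) k)| <=
    `|\sum_j CC w i j * node j k w - field (x i) k|.
  by rewrite normrM (ger0_norm c0) ler_piMl //; lra.
have h3 := W_Wnode i k.+1 w.
have h4 : `|e * (Rproc U n k w i u - node i k w)| <= walk b k A i w.
  rewrite normrM (ger0_norm e0); apply: le_trans (IH A i w kk').
  by rewrite ler_piMl //; lra.
apply: le_trans (ler_normD _ _) _; apply: lerD => //.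
apply: le_trans (ler_normD _ _) _; rewrite /innov addrA; apply: lerD => //.
by apply: le_trans (ler_normD _ _) _; apply: lerD.
Qed.

Definition row_coords (i : 'I_n) : {set coord n} :=
  finset (fun a : coord n => match a with
    | inl (inl p) => p.2 == i | inl (inr p) => p.1 == i | inr _ => false end).

Definition rows_avoiding (A : {set 'I_n}) : {set coord n} :=
  finset (fun a : coord n => match a with
    | inl (inl p) => p.2 \notin A | inl (inr p) => p.1 \notin A
    | inr _ => true end).

Lemma row_coords_sub (A : {set 'I_n}) i : i \notin A -> row_coords i \subset rows_avoiding A.
Proof.
move=> iA; apply/fintype.subsetP => -[[[j k]|[j k]]|j]; rewrite !inE //=.
  by move=> /eqP ->.
by move=> /eqP ->.
Qed.

Lemma row_coords_disj (A : {set 'I_n}) i : row_coords i \subset ~: rows_avoiding (i |: A).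
Proof.
apply/fintype.subsetP => -[[[j k]|[j k]]|j]; rewrite !inE //=;
  by move=> /eqP ->; rewrite eqxx.
Qed.

Lemma rows_avoidingS (A : {set 'I_n}) i : rows_avoiding (i |: A) \subset rows_avoiding A.
Proof.
apply/fintype.subsetP => -[[[j k]|[j k]]|j]; rewrite !inE //= negb_or;
  by move=> /andP[].
Qed.

Lemma bmc_weight_sum (i : 'I_n) : bmc (row_coords i) (weight_sum U i).
Proof.
apply: bmf_sum => j _; apply: bmf_mul.
  by apply: (bmc_wgt U_ok); rewrite inE /= eqxx.
by apply: bmc_arc; rewrite inE /= eqxx.
Qed.

(** The inverse of a nonnegative function is its real power -1, hence measurable. *)
Lemma bmc_C (i j : 'I_n) : bmc (row_coords i) (fun w => CC w i j).
Proof.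
split; last first.
  by exists 1 => w; rewrite ger0_norm ?(C_ge0 U_ok) ?(C_le1 U_ok).
under eq_fun do rewrite (C_entry U_ok).
apply: measurable_funM => //; apply: measurable_funM.
  apply: (proj1 (_ : bmc (row_coords i) _)); apply: bmf_mul.
    by apply: (bmc_wgt U_ok); rewrite inE /= eqxx.
  by apply: bmc_arc; rewrite inE /= eqxx.
under eq_fun do rewrite -(powR_inv1 (weight_sum_ge0 U_ok i _)).
apply: (measurableT_comp (f := fun z : R => z `^ (-1))).
  exact: measurable_powR.
exact: (bmc_weight_sum i).1.
Qed.

Lemma indeg0_prod (i : 'I_n) w :
  (indeg U i w == 0%N)%:R = \prod_j (1 - (Defs.arc U j i w)%:R) :> R.
Proof.
rewrite /indeg sum_nat_eq0; case: forallP => [h|/existsNP[j /negP]].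
  rewrite big1 // => j _; have := h j; rewrite implyTb.
  by case: (Defs.arc U j i w) => //= _; rewrite subr0.
rewrite implyTb => hj.
by rewrite (bigD1 j) //=; move: hj; case: (Defs.arc U j i w) => // _;
  rewrite subrr mul0r.
Qed.

Lemma bmc_indeg0 (i : 'I_n) :
  bmc (row_coords i) (fun w => (indeg U i w == 0%N)%:R : R).
Proof.
under eq_fun do rewrite indeg0_prod.
apply: bmf_prod => j _; apply: bmf_sub; first exact: bmf_cst.
by apply: bmc_arc; rewrite inE /= eqxx.
Qed.

Lemma bmc_isodev i : bmc (row_coords i) (isodev i).
Proof. apply: bmf_norm; apply: bmf_sub (bmf_cst _); exact: bmc_indeg0. Qed.

Lemma bmc_Wnode (A : {set coord n}) i t : nodec i \in A -> (t < tau)%N ->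
  bmc A (Wnode i t).
Proof.
move=> iA tt; apply: bmf_add; apply: bmf_scale.
  exact: (bmc_Z iA tt (Z_bound i t)).
exact: (bmc_Q U_ok).
Qed.

Lemma bmc_driven (A : {set coord n}) m (i : 'I_n) (v : nat -> Omega -> R) k :
  nodec i \in A -> (forall t, (t < tau)%N -> bmc A (v t)) -> (k < tau)%N ->
  bmc A (fun w => driven S m (R0 U i w 0 u) (fun t => v t w) k).
Proof.
move=> iA mv; elim: k => [|k IH] kt /=; first exact: (bmc_R0 U_ok).
apply: bmf_add; first by apply: bmf_add; [exact: bmf_cst|exact: mv].
by apply: bmf_scale; apply: IH; exact: ltnW.
Qed.

Lemma bmc_node (A : {set coord n}) i k : nodec i \in A -> (k < tau)%N ->
  bmc A (node i k).
Proof. by move=> iA kt; apply: bmc_driven => // t tt; exact: bmc_Wnode. Qed.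

Lemma bmc_innov (A : {set 'I_n}) i k : i \notin A -> (k < tau)%N ->
  bmc (rows_avoiding A) (innov i k).
Proof.
move=> iA kt; apply: bmf_add.
  apply: bmf_norm; apply: bmf_sub (bmf_cst _); apply: bmf_sum => j _.
  apply: bmf_mul; first exact: coord_bmf_sub (row_coords_sub iA) (bmc_C i j).
  by apply: bmc_node => //; rewrite inE.
exact: coord_bmf_sub (row_coords_sub iA) (bmc_isodev i).
Qed.

Lemma bmc_walk b k (A : {set 'I_n}) i : i \notin A -> (k <= tau)%N ->
  bmc (rows_avoiding A) (walk b k A i).
Proof.
elim: k A i => [|k IH] A i iA kt; first exact: bmf_cst.
apply: bmf_add; last exact: IH (ltnW kt).
apply: bmf_add; last exact: bmc_innov.
apply: bmf_sum => j _; apply: bmf_mul.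
  exact: coord_bmf_sub (row_coords_sub iA) (bmc_C i j).
have [jA|jA] := boolP (j \in i |: A); first exact: bmf_cst.
exact: coord_bmf_sub (rows_avoidingS A i) (IH _ _ jA (ltnW kt)).
Qed.

(** The walk meets independent rows, so its expectation obeys a deterministic
    recursion: [gam] bounds the mean weight of an edge, [del] the mean
    one-step error. *)
Lemma condE_walk (b gam del : R) : 0 <= b -> 0 <= gam -> 0 <= del ->
  (forall i j, EE (fun w => CC w i j) <= gam) ->
  (forall i k, (k < tau)%N -> EE (innov i k) <= del) ->
  forall k (A : {set 'I_n}) i, i \notin A -> (k <= tau)%N ->
  EE (walk b k A i) <= (2%:R ^+ k - 1) * (del + (#|A| + k)%:R * (b * gam)).
Proof.
move=> b0 g0 dl0 Cg Id; have mE := labels_meas U_ok x.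
elim=> [|k IH] A i iA kt.
  by rewrite (condE_cst mE x0) expr0 subrr mul0r.
have kt' := ltnW kt.
have mw := bmc_bmf U_ok (bmc_walk b iA kt').
have mi := bmc_bmf U_ok (bmc_innov iA kt).
have mC j := bmc_bmf U_ok (bmc_C i j).
pose F j w := if j \in i |: A then b else walk b k (i |: A) j w.
have mF j : bmc (rows_avoiding (i |: A)) (F j).
  rewrite /F; have [jA|jA] := boolP (j \in i |: A); first exact: bmf_cst.
  exact: bmc_walk.
have mCF j : bmf (fun w => CC w i j * F j w).
  exact: (bmf_mul (mC j) (bmc_bmf U_ok (mF j))).
have ms : bmf (fun w => \sum_j CC w i j * F j w) by apply: bmf_sum.
rewrite [X in EE X](_ : _ = fun w => \sum_j CC w i j * F j w + innov i k w
  + walk b k A i w) //.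
rewrite (condE_add mE (bmf_add ms mi) mw) (condE_add mE ms mi).
rewrite (condE_sum mE x0) //.
set s := (2%:R ^+ k - 1) * (del + (#|A|.+1 + k)%:R * (b * gam)).
have pw : 0 <= 2%:R ^+ k - 1 :> R by rewrite subr_ge0 exprn_ege1 // ler1n.
have bg : 0 <= b * gam by rewrite mulr_ge0.
(* The vertices in [A] carry at most [b * gam] each; at a new vertex [j] the
   weight and the remaining walk are independent. *)
have EC j : EE (fun w => CC w i j * F j w) <=
    (if j \in A then b * gam else 0) + EE (fun w => CC w i j) * s.
  rewrite (bmc_mul U_ok x0 (row_coords_disj A i) (bmc_C i j) (mF j)).
  have Cj0 : 0 <= EE (fun w => CC w i j).
    by apply: (condE_ge0 mE x0) => w _; exact: (C_ge0 U_ok).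
  have s0 : 0 <= s by rewrite mulr_ge0 // addr_ge0 // mulr_ge0.
  rewrite /F in_setU1; have [->|ji] /= := eqVneq j i.
    rewrite (_ : (fun w => CC w i i) = (fun=> 0)); last first.
      by apply/funext => w; rewrite (C_diag U_ok).
    by rewrite (condE_cst mE x0) !mul0r addr0; case: ifP.
  have [jA|jA] := boolP (j \in A).
    rewrite (condE_cst mE x0) [X in X <= _]mulrC -[X in X <= _]addr0.
    by apply: lerD; [exact: ler_wpM2l|exact: mulr_ge0].
  rewrite add0r ler_wpM2l //; apply: le_trans (IH _ _ _ kt') _.
    by rewrite in_setU1 negb_or ji.
  by rewrite cardsU1 iA add1n.
have ES : \sum_j EE (fun w => CC w i j * F j w) <= #|A|%:R * (b * gam) + s.
  apply: le_trans (ler_sum _ (fun j _ => EC j)) _.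
  rewrite big_split /= -big_mkcond /= sumr_const -[X in X + _]mulr_natl.
  rewrite lerD2l -mulr_suml -[X in _ <= X]mul1r ler_wpM2r //.
    by rewrite mulr_ge0 // addr_ge0 // mulr_ge0.
  rewrite -(condE_sum mE x0) // -[X in _ <= X](condE_cst mE x0).
  apply: (condE_le mE x0); [exact: bmf_sum|exact: bmf_cst|].
  by move=> w _; exact: (C_sum U_ok).
have EI := Id i k kt.
have EW := IH A i iA kt'.
apply: le_trans (lerD (lerD ES EI) EW) _.
rewrite /s !natrD -[#|A|.+1%:R]natr1 -[k.+1%:R]natr1 exprS.
have a0 : 0 <= #|A|%:R :> R by [].
have k0 : 0 <= k%:R :> R by [].
have p1 : 0 <= (2%:R ^+ k - 1) * (b * gam) by rewrite mulr_ge0.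
have p2 : 0 <= k%:R * (b * gam) by rewrite mulr_ge0.
move: pw p1 p2 bg; set q := 2%:R ^+ k; set g := b * gam.
move=> pw p1 p2 bg.
rewrite -subr_ge0.
rewrite (_ : _ - _ = (q - 1) * g + (k%:R * g + g)); last by ring.
by rewrite !addr_ge0.
Qed.

End walk.

(** * External signals and in-degrees *)

Lemma pos_lower (R : realType) k (f : 'I_k -> R) :
  exists2 m : R, 0 < m & forall r, 0 < f r -> m <= f r.
Proof.
exists (\big[Num.min/1]_(r | 0 < f r) f r).
  by apply: lt_bigmin => //; exact: ltr01.
by move=> r fr; exact: bigmin_le_cond.
Qed.

Section null_functions.
Context {R : realType} d (T : measurableType d) (P : probability T R).
Variables (E : set T) (mE : measurable E) (E0 : (0 < P E)%E).

(** A nonnegative function with mean 0 vanishes almost everywhere. *)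
Lemma condE_eq0 (f g : T -> R) : bmf f -> bmf g -> (forall w, 0 <= f w) ->
  (forall w, f w = 0 -> g w = 0) -> condE P E f = 0 -> condE P E g = 0.
Proof.
move=> mf mg f0 fg; rewrite /condE => ef.
have PE := fine_gt0_prob mE E0.
have : \int[P]_(w in E) f w = 0.
  apply/eqP; move/eqP: ef; rewrite mulf_eq0 invr_eq0 (gt_eqF PE) orbF //.
have intf := bmf_integrable P mE mf.
have mfE : measurable_fun E (EFin \o f).
  by apply/measurable_EFinP; exact: measurable_funS mf.1.
have mgE : measurable_fun E (EFin \o g).
  by apply/measurable_EFinP; exact: measurable_funS mg.1.
rewrite /Rintegral => h.
have h' : (\int[P]_(w in E) `|(EFin \o f) w|)%E = 0%E.
  under eq_integral => w _ do rewrite /= ger0_norm //.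
  by rewrite -[LHS]fineK ?h //; exact: integrable_fin_num.
have /ae_eq_integral_abs ae := h'.
rewrite (_ : (\int[P]_(w in E) (g w)%:E)%E = (\int[P]_(w in E) (cst 0%E w))%E).
  by rewrite integral0 mul0r.
apply: ae_eq_integral => //.
apply: filterS (ae mE mfE) => w /= hw Ew; have [fw] := hw Ew.
by rewrite fg.
Qed.

End null_functions.

Section local_estimates.
Context {R : realType} (S : opinion_params R) (S_ok : params_ok S).
Hypothesis theta_infty : theta S n @[n --> \oo] --> +oo.
Context d1 (Omega : measurableType d1) (P : probability Omega R).
Variables (U : opinion_inputs S Omega) (U_ok : is_opinion_model P U).
Variable (Wbar : nat -> 'M[R]_(K S, l S)).
Variable (Wbar_ok : is_label_mean P U (fun n i => W U i 0) Wbar).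
Local Notation typ := (typ P U).
Local Notation EE x := (condE P (labels_are U x)).
Local Notation kap := (@kappa R S).

Lemma typ_labels : typ (fun n x => forall r, exists i, x i = r).
Proof.
have [m m0 hm] := pos_lower (@Defs.pi R S).
have m2 : 0 < m / 2%:R by rewrite divr_gt0.
apply: typ_mono (typ_good _ _ m2) => n x _ /forallP g r.
apply/not_existsP => h.
have := g r; rewrite /freq big1; last first.
  by move=> i _; case: eqP => // /h.
rewrite mulr0 sub0r normrN gtr0_norm; last exact: (Defs.pi_gt0 S_ok).
by have := hm r (Defs.pi_gt0 S_ok r); lra.
Qed.

Lemma mean_field_ge0 h r : (forall s, 0 <= h s) -> 0 <= mean_field (S:=S) h r.
Proof.
move=> h0; apply: sumr_ge0 => s _; rewrite !mulr_ge0 ?(kappa_ge0 S_ok) //.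
exact: ltW (Defs.pi_gt0 S_ok s).
Qed.

Lemma mean_field_eq0 h r : (forall s, 0 <= h s) -> mean_field (S:=S) h r = 0 ->
  forall s, kap s r = 0 \/ h s = 0.
Proof.
move=> h0 /eqP; rewrite psumr_eq0; last first.
  move=> s _; rewrite !mulr_ge0 ?(kappa_ge0 S_ok) //.
  exact: ltW (Defs.pi_gt0 S_ok s).
move=> /allP a s; have := a s (mem_index_enum s); rewrite implyTb !mulf_eq0.
by rewrite (gt_eqF (Defs.pi_gt0 S_ok s)) /= => /orP[] /eqP; [left|right].
Qed.

Lemma edge_prob_eq0 n (x : labels S n) i j : kap (x i) (x j) = 0 ->
  edge_prob x i j = 0.
Proof. by move=> h; rewrite /edge_prob h !mul0r min_l. Qed.

(** In an isolated community no edge is ever present; in the others the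
    in-degree concentrates around a positive multiple of [theta n]. *)
Lemma isodev_small (eps : R) : 0 < eps ->
  typ (fun n x => forall i, EE x (isodev U x i) <= eps).
Proof.
move=> e0.
have [m m0 hm] := pos_lower (mean_field (S:=S) (fun=> 1)).
have em0 : 0 < eps * m by rewrite mulr_gt0.
apply: typ_mono (in_sum_concentration S_ok theta_infty U_ok 0 ler01 em0).
move=> n x x0 conc i; have mE := labels_meas U_ok x.
have mq := bmc_bmf U_ok (bmc_isodev U x 0 i).
have marc j : bmf (fun w => (Defs.arc U j i w)%:R : R).
  exact: bmf_bool (arc_meas U_ok _ _).
have [isoi|niso] := boolP (iso (x i)).
  apply: (@le_trans _ _ (EE x (fun w => \sum_j (Defs.arc U j i w)%:R))).
    apply: (condE_le mE x0) => //; first exact: bmf_sum.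
    move=> w _; rewrite /isodev isoi.
    have [e|ne] := eqVneq (indeg U i w) 0%N.
      by rewrite subrr normr0; apply: sumr_ge0.
    rewrite sub0r normrN normr1 -natr_sum ler1n lt0n.
    by move: ne; rewrite /indeg.
  rewrite (condE_sum mE x0) // big1 ?(ltW e0) // => j _.
  rewrite (condE_arc U_ok x0 0); apply: edge_prob_eq0.
  by apply/eqP; move/forallP: isoi; apply.
set mu := mean_field (S:=S) (fun=> 1) (x i).
have mu0 : 0 < mu.
  rewrite lt_neqAle mean_field_ge0 // andbT eq_sym.
  apply: contraNneq niso => /(mean_field_eq0 (fun=> ler01)) h.
  by apply/forallP => s; have [->|/eqP] := h s; rewrite ?eqxx // oner_eq0.
pose N w := (\sum_j (Defs.arc U j i w)%:R * 1) / theta S n - mu.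
have mN : bmf N.
  apply: bmf_sub (bmf_cst _); apply: bmf_mul (bmf_cst _).
  by apply: bmf_sum => j _; exact: bmf_mul (bmf_cst _).
apply: (@le_trans _ _ (EE x (fun w => mu^-1 * `|N w|))).
  apply: (condE_le mE x0) => //; first exact: bmf_scale (bmf_norm mN).
  move=> w _; rewrite /isodev (negbTE niso) subr0 ger0_norm //.
  have [e|ne] := eqVneq (indeg U i w) 0%N; last first.
    by rewrite mulr_ge0 ?invr_ge0 // ltW.
  rewrite /N (_ : \sum_j _ = 0); last first.
    apply: big1 => j _; move/eqP: e; rewrite /indeg sum_nat_eq0 => /forallP/(_ j).
    by rewrite implyTb; case: (Defs.arc U j i w); rewrite // mul0r.
  by rewrite mul0r sub0r normrN gtr0_norm // mulVf // gt_eqF.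
rewrite (condE_scale mE _ (bmf_norm mN)) ler_pdivrMl //.
have n1 : `|1 : R| <= 1 by rewrite normr1.
have := conc i (fun _ _ => 1) (fun=> 1) (fun j => bmf_cst 1)
  (fun _ _ => n1) (fun=> n1).
rewrite (condE_cst mE x0) subrr normr0 big1 // mulr0 addr0 => h.
apply: le_trans h _; rewrite mulrC ler_pM2r //; exact: hm.
Qed.

Lemma bmf_Wnode n (x : labels S n) u i t : bmf (Wnode U x u i t).
Proof.
have ii : nodec i \in (finset.setT : {set coord n}) by rewrite finset.in_setT.
exact: (bmc_bmf U_ok (bmc_Wnode S_ok U_ok x u ii (ltnSn t))).
Qed.

Lemma bmf_W n (i : 'I_n) t u : bmf (fun w => W U i t w 0 u).
Proof.
have ii : nodec i \in (finset.setT : {set coord n}) by rewrite finset.in_setT.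
have mZ := bmc_bmf U_ok (bmc_Z ii (ltnSn t) (Z_bound S_ok U_ok u i t)).
have mQ := bmc_bmf U_ok (bmc_Q U_ok 0 u ii).
have mI := bmc_bmf U_ok (bmc_indeg0 U 0 i).
have -> : (fun w => W U i t w 0 u) = (fun w => d S * Z U i t w 0 u
    + (c S * (indeg U i w == 0%N)%:R) * Q U i w 0 u).
  by apply/funext => w; rewrite /W !mxE.
by apply: bmf_add; [exact: bmf_scale|apply: bmf_mul => //; exact: bmf_scale].
Qed.

(** [Wbar] conditions on the label of one vertex only, but is the same for all
    vertices; summing over the vertices makes the atypical labels negligible. *)
Lemma Wbar_close u (eps : R) : 0 < eps -> \forall n \near \oo,
  forall (x : labels S n), (0 < P (labels_are U x))%E -> forall i t,
  `|EE x (Wnode U x u i t) - Wbar n (x i) u| <= eps.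
Proof.
move=> e0.
have [m m0 hm] := pos_lower (@Defs.pi R S).
have m2 : 0 < m / 2%:R by rewrite divr_gt0.
pose e1 := eps * m / 8%:R.
have e10 : 0 < e1 by rewrite divr_gt0 // mulr_gt0.
have [eta eta0 near1] := typ_and (isodev_small e10) (typ_good _ _ m2).
have e2 : 0 < Num.min e1 (1 / 2%:R) by rewrite lt_min e10 divr_gt0.
have near2 := bad_labels_vanish U_ok eta0 e2.
move: near1 near2; apply: filterS2 => n h1 h2 x x0 i t.
have n0 : 0 < n%:R :> R by rewrite ltr0n; exact: leq_ltn_trans (ltn_ord i).
set r := x i; set mm := EE x _.
pose dev (y : labels S n) j := EE y (isodev U y j).
have mq (y : labels S n) j : bmf (isodev U y j) := bmc_bmf U_ok (bmc_isodev U y 0 j).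
have dev_le1 (y : labels S n) j : 0 < label_prob P U y -> 0 <= dev y j <= 1.
  rewrite label_prob_gt0 // => y0; have mE := labels_meas U_ok y; apply/andP; split.
    by apply: (condE_ge0 mE y0) => w _; have /andP[] := isodev_le1 U y j w.
  rewrite -[X in _ <= X](condE_cst mE y0).
  rewrite /dev; apply: (condE_le mE y0 (mq y j)) => [|w _]; first exact: bmf_cst.
  by have /andP[] := isodev_le1 U y j w.
have Wm (y : labels S n) j : 0 < label_prob P U y -> y j = r ->
    `|EE y (fun w => W U j 0 w 0 u) - mm| <= dev y j.
  rewrite label_prob_gt0 // => y0 yj; have mE := labels_meas U_ok y.
  have mE' := labels_meas U_ok x.
  have -> : mm = EE y (Wnode U y u j 0).
    have ZB := Z_bound S_ok U_ok u i t; have ZB' := Z_bound S_ok U_ok u j 0.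
    have ii : nodec i \in (finset.setT : {set coord n}) by rewrite finset.in_setT.
    have jj : nodec j \in (finset.setT : {set coord n}) by rewrite finset.in_setT.
    have mZ := bmc_bmf U_ok (bmc_Z ii (ltnSn t) ZB).
    have mZ' := bmc_bmf U_ok (bmc_Z jj (ltnSn 0) ZB').
    have mQ := bmc_bmf U_ok (bmc_Q U_ok 0 u ii).
    have mQ' := bmc_bmf U_ok (bmc_Q U_ok 0 u jj).
    rewrite /mm /Wnode (condE_add mE' (bmf_scale _ mZ) (bmf_scale _ mQ)).
    rewrite (condE_add mE (bmf_scale _ mZ') (bmf_scale _ mQ')).
    rewrite (condE_scale mE' _ mZ) (condE_scale mE' _ mQ).
    rewrite (condE_scale mE _ mZ') (condE_scale mE _ mQ').
    have xy : x i = y j by [].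
    rewrite (condE_Z U_ok x0 y0 xy ZB ZB') (condE_Q U_ok x0 y0 xy u) yj.
    by [].
  rewrite -(condE_sub mE (bmf_W _ _ _) (bmf_Wnode _ _ _ _)).
  apply: le_trans (condE_norm mE y0 _) _.
    by apply: bmf_sub; [exact: bmf_W|exact: bmf_Wnode].
  apply: (condE_le mE y0) => [||w _]; last exact: (W_Wnode S_ok U_ok).
    by apply: bmf_norm; apply: bmf_sub; [exact: bmf_W|exact: bmf_Wnode].
  exact: mq.
pose pj j := \sum_(y : labels S n | y j == r) label_prob P U y.
have WpE j : pj j * (Wbar n r u - mm) = \sum_(y : labels S n | y j == r)
    label_prob P U y * (EE y (fun w => W U j 0 w 0 u) - mm).
  under [in RHS]eq_bigr do rewrite mulrBr.
  rewrite sumrB -mulr_suml mulrBr; congr (_ - _).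
  pose aj := [pred y : labels S n | y j == r].
  have aE : [set w | J U j w = r] = [set w | aj (Jn U n w)].
    by apply/seteqP; split=> w /=; rewrite !ffunE; [move=> ->|move/eqP].
  rewrite -(@int_labels _ _ _ _ P U U_ok n aj _ (bmf_W j 0 u)) -aE.
  have pjE : pj j = fine (P [set w | J U j w = r]) by rewrite aE label_event_prob.
  have mJ : measurable [set w | J U j w = r] by exact: (J_meas U_ok).
  have [pz|pz] := eqVneq (pj j) 0.
    rewrite pz mul0r; apply/esym; rewrite aE int_labels //; last exact: bmf_W.
    apply: big1 => y yj; have := pz; rewrite /pj => /eqP.
    rewrite psumr_eq0 => [/allP/(_ y (mem_index_enum y))|? _]; last exact: label_prob_ge0.
    by move: yj; rewrite /= => -> /= /eqP ->; rewrite mul0r.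
  have Pp : (0 < P [set w | J U j w = r])%E.
    rewrite lt0e measure_ge0 andbT; apply: contra pz => /eqP e.
    by rewrite pjE e.
  by rewrite (label_meanE Wbar_ok Pp) /condE -pjE mulrC divfK.
have sum1 : \sum_(y : labels S n) label_prob P U y = 1 by exact: (sum_label_prob U_ok).
set pb := \sum_(x : labels S n | ~~ good eta x) label_prob P U x in h2.
have pb0 : 0 <= pb by apply: sumr_ge0 => y _; exact: label_prob_ge0.
have goodE : \sum_(y : labels S n | good eta y) label_prob P U y = 1 - pb.
  by rewrite -sum1 [X in _ = X - _](bigID (fun y : labels S n => good eta y)) /= /pb addrK.
(* The total probability [\sum_j pj j], of order [n], multiplies the error on
   the left; on the right each good configuration contributes at most
   [n * e1], each bad one at most [n]. *)
have up : \sum_j pj j * `|Wbar n r u - mm| <= n%:R * (e1 + pb).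
  apply: (@le_trans _ _ (\sum_j \sum_(y : labels S n | y j == r)
     label_prob P U y * dev y j)).
    apply: ler_sum => j _; rewrite -[pj j]ger0_norm; last first.
      by apply: sumr_ge0 => y _; exact: label_prob_ge0.
    rewrite -normrM WpE; apply: le_trans (ler_norm_sum _ _ _) _.
    apply: ler_sum => y /eqP yj; rewrite normrM ger0_norm ?label_prob_ge0 //.
    have [y0|y0] := boolP (0 < label_prob P U y); first by rewrite ler_pM2l // Wm.
    have -> : label_prob P U y = 0 by apply/eqP; rewrite eq_le label_prob_ge0 leNgt y0.
    by rewrite !mul0r.
  apply: (@le_trans _ _ (\sum_(j < n) (e1 + pb))); last first.
    by rewrite sumr_const card_ord -[X in X <= _]mulr_natl.
  apply: ler_sum => j _.
  apply: (@le_trans _ _ (\sum_(y : labels S n)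
      label_prob P U y * (if good eta y then e1 else 1))).
    rewrite big_mkcond /=; apply: ler_sum => y _.
    have cpos : 0 <= label_prob P U y * (if good eta y then e1 else 1).
      by rewrite mulr_ge0 ?label_prob_ge0 //; case: ifP => // _; exact: ltW.
    case: ifP => // _; have [y0|y0] := boolP (0 < label_prob P U y); last first.
      have -> : label_prob P U y = 0 by apply/eqP; rewrite eq_le label_prob_ge0 leNgt y0.
      by rewrite !mul0r.
    rewrite ler_pM2l //; case: ifPn => gy.
      by rewrite label_prob_gt0 // in y0; have [hd _] := h1 y y0 gy; exact: hd.
    by have /andP[] := dev_le1 y j y0.
  rewrite (bigID (fun y : labels S n => good eta y)) /=; apply: lerD.
    rewrite (eq_bigr (fun y => label_prob P U y * e1)); last by move=> y ->.
    by rewrite -mulr_suml goodE ler_piMl ?(ltW e10) // gerBl.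
  rewrite /pb; apply: ler_sum => y /negbTE ->; by rewrite mulr1.
have low : n%:R * (m / 2%:R) * (1 - pb) <= \sum_j pj j.
  rewrite /pj (exchange_big_dep predT) //= -goodE.
  rewrite mulr_sumr [X in _ <= X](bigID (fun y : labels S n => good eta y)) /= -[X in X <= _]addr0.
  apply: lerD; last by apply: sumr_ge0 => y _; apply: sumr_ge0 => j _; exact: label_prob_ge0.
  apply: ler_sum => y gy.
  have [y0|y0] := boolP (0 < label_prob P U y); last first.
    have -> : label_prob P U y = 0 by apply/eqP; rewrite eq_le label_prob_ge0 leNgt y0.
    by rewrite mulr0; apply: sumr_ge0.
  rewrite label_prob_gt0 // in y0; have [_ /forallP/(_ r)] := h1 y y0 gy.
  rewrite /freq ler_norml => /andP[g1 _].
  have pr := hm r (Defs.pi_gt0 S_ok r).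
  have g2 : m / 2%:R <= n%:R^-1 * \sum_i0 (y i0 == r)%:R by lra.
  rewrite big_mkcond /= (_ : \sum_j _ = (\sum_j (y j == r)%:R) * label_prob P U y).
    rewrite ler_wpM2r ?label_prob_ge0 //.
    by rewrite -ler_pdivlMl.
  by rewrite mulr_suml; apply: eq_bigr => j _; case: ifP; rewrite ?mul1r ?mul0r.
rewrite -mulr_suml in up; rewrite distrC.
have hb : pb <= e1 /\ pb <= 1 / 2%:R.
  by move: h2; rewrite le_min => /andP[].
have low' : n%:R * (m / 4%:R) <= \sum_j pj j.
  apply: le_trans low; rewrite -[X in _ <= X]mulrA ler_pM2l //.
  have : m / 2%:R * (1 / 2%:R) <= m / 2%:R * (1 - pb).
    by rewrite ler_pM2l //; lra.
  by lra.
have fin : n%:R * (m / 4%:R) * `|Wbar n r u - mm| <= n%:R * (2%:R * e1).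
  apply: (@le_trans _ _ (n%:R * (e1 + pb))); last by rewrite ler_pM2l //; lra.
  by apply: le_trans up; rewrite ler_wpM2r.
have : (m / 4%:R) * `|Wbar n r u - mm| <= (m / 4%:R) * eps.
  rewrite -[_ * eps](_ : 2%:R * e1 = _); last by rewrite /e1; field.
  by rewrite -(ler_pM2l n0) mulrA.
by rewrite ler_pM2l // divr_gt0.
Qed.

End local_estimates.

(** * The error of one step *)

Section one_step_error.
Context {R : realType} (S : opinion_params R) (S_ok : params_ok S).
Context d1 (Omega : measurableType d1) (P : probability Omega R).
Variables (U : opinion_inputs S Omega) (U_ok : is_opinion_model P U).
Variables (beta : 'I_(K S) -> 'I_(K S) -> R) (beta_ok : is_beta P U beta).
Variables (Wbar Rbar : nat -> 'M[R]_(K S, l S)).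
Variable (Rbar_ok : is_label_mean P U (fun n i => R0 U i) Rbar).
Local Notation kap := (@kappa R S).
Variables (n : nat) (x : labels S n).
Hypothesis x0 : (0 < P (labels_are U x))%E.
Hypothesis beta_rg : forall r s, 0 <= beta r s <= H S.
Hypothesis Wb1 : forall r u, `|Wbar n r u| <= 1.
Hypothesis Rb1 : forall r u, `|Rbar n r u| <= 1.
Local Notation EE := (condE P (labels_are U x)).
Local Notation e := (1 - c S - d S).
Local Notation CC w i j := (Defs.C U n w i j).
Local Notation rho := (rho beta (Wbar n) (Rbar n)).
Local Notation node := (node U beta (Wbar n) (Rbar n) x).
Local Notation innov := (innov U beta (Wbar n) (Rbar n) x).

Let mE := labels_meas U_ok x.
Let beta0 r s : 0 <= beta r s. Proof. by have /andP[] := beta_rg r s. Qed.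
Let H0 : 0 <= H S. Proof. exact: ltW (H_gt0 S_ok). Qed.

Lemma bmf_node u i k : bmf (node u i k).
Proof.
have ii : nodec i \in (finset.setT : {set coord n}) by rewrite finset.in_setT.
exact: (bmc_bmf U_ok (bmc_node S_ok U_ok beta (Wbar n) (Rbar n) x u ii (ltnSn k))).
Qed.

Lemma bmf_C i j : bmf (fun w => CC w i j).
Proof. exact: (bmc_bmf U_ok (bmc_C U_ok 0 i j)). Qed.

Lemma bmf_weight_sum (i : 'I_n) : bmf (weight_sum U i).
Proof. exact: (bmc_bmf U_ok (bmc_weight_sum U_ok 0 i)). Qed.

(** Taking means in the recursion of [node] gives that of [rho] with the mean
    signal in place of [Wbar]; the coefficients being at most 1, the errors at
    most add up. *)
Lemma node_mean (om : R) u j k :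
  (forall t, `|EE (Wnode U x u j t) - Wbar n (x j) u| <= om) ->
  `|EE (node u j k) - rho k (x j) u| <= k%:R * om.
Proof.
move=> Wom; have [c0 d0 e0 ce] := coef_ge0 S_ok.
have om0 : 0 <= om by exact: le_trans (Wom 0%N).
elim: k => [|k IH].
  rewrite [X in EE X](_ : _ = fun w => R0 U j w 0 u) //.
  by rewrite (condE_R0 U_ok Rbar_ok x0) subrr normr0 mul0r.
have -> : node u j k.+1 = fun w => (c S * field beta (Wbar n) (Rbar n) u (x j) k +
   Wnode U x u j k.+1 w) + e * node u j k w by [].
have mW := bmf_Wnode S_ok U_ok x u j k.+1.
have mN := bmf_node u j k.
rewrite (condE_add mE (bmf_add (bmf_cst _) mW) (bmf_scale _ mN)).
rewrite (condE_add mE (bmf_cst _) mW) (condE_cst mE x0) (condE_scale mE _ mN).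
rewrite [rho k.+1]/= [X in _ - X]mxE [X in _ - (X + _)]mxE.
rewrite [X in _ - (X + _ + _)]mxE [X in _ - (_ + _ + X)]mxE.
rewrite -/(field beta (Wbar n) (Rbar n) u (x j) k).
rewrite (_ : _ - _ = (EE (Wnode U x u j k.+1) - Wbar n (x j) u) +
  e * (EE (node u j k) - rho k (x j) u)); last by ring.
apply: le_trans (ler_normD _ _) _; rewrite normrM (ger0_norm e0) -natr1.
have h : e * `|EE (node u j k) - rho k (x j) u| <= 1 * (k%:R * om).
  by apply: ler_pM => //; lra.
have := Wom k.+1; lra.
Qed.

Lemma condE_weighted_arc i j :
  EE (fun w => B U i j w * (Defs.arc U j i w)%:R) =
  edge_prob x j i * beta (x i) (x j).
Proof.
have mB : coord_bmf (coord_sets U 0) [set wgtc i j; nodec j]%SET (B U i j).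
  by apply: (bmc_wgt U_ok); rewrite !inE eqxx.
under [X in EE X]eq_fun do rewrite mulrC.
by rewrite (condE_arc_mul U_ok x0 mB) (condE_wgt U_ok beta_ok x0).
Qed.

(** Limit of the total incoming weight of a vertex of community [r], divided by
    [theta n]. *)
Definition in_weight r : R := mean_field (beta r) r.

Lemma in_weight_ge0 r : 0 <= in_weight r.
Proof. exact: (mean_field_ge0 S_ok). Qed.

Lemma in_weightE r : in_weight r = \sum_t Defs.pi t * beta r t * kap t r.
Proof. by apply: eq_bigr => s _; rewrite mulrAC. Qed.

(** If the limiting incoming weight is 0, then for every other community either
    there are no edges from it or their weights are almost surely 0. *)
Lemma C_null i j : in_weight (x i) = 0 -> EE (fun w => CC w i j) = 0.
Proof.
move=> D0; pose f w := B U i j w * (Defs.arc U j i w)%:R.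
have mf : bmf f.
  by apply: bmf_mul; [exact: (bmf_wgt U_ok)|exact: bmf_bool (arc_meas U_ok _ _)].
apply: (condE_eq0 mE x0 mf (bmf_C i j)).
- by move=> w; exact: (weight_ge0 U_ok).
- by move=> w fw; rewrite (C_entry U_ok) -/(f w) fw !(mul0r, mulr0).
- rewrite /f condE_weighted_arc.
  have [k0|->] := mean_field_eq0 S_ok (beta0 (x i)) D0 (x j); last by rewrite mulr0.
  by rewrite edge_prob_eq0 // mul0r.
Qed.

Section concentrated.
Variables (m b1 e1 e2 e3 : R) (i : 'I_n).
Hypothesis m0 : 0 < m.
Hypothesis mD : 0 < in_weight (x i) -> m <= in_weight (x i).
Let sn w := weight_sum U i w / theta S n.
Hypothesis sum_near : EE (fun w => `|sn w - in_weight (x i)|) <= e1.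
Hypothesis Hn : H S * kmax S / n%:R <= e2.

Let bmf_sdev : bmf (fun w => `|sn w - in_weight (x i)|).
Proof.
apply: bmf_norm; apply: bmf_sub (bmf_cst _); apply: bmf_mul (bmf_cst _).
exact: bmf_weight_sum.
Qed.

Let t0 : 0 < theta S n. Proof. exact: (theta_gt0 S_ok). Qed.

(** On the event that the normalised incoming weight exceeds half its limit, the
    weight of an edge is at most [2 * H / (m * theta n)]; on the complement the
    deviation from the limit is at least [m / 2]. *)
Lemma C_small j : EE (fun w => CC w i j) <= 2%:R / m * (e1 + e2).
Proof.
have [D0|Dn] := eqVneq (in_weight (x i)) 0.
  rewrite C_null // mulr_ge0 ?divr_ge0 ?(ltW m0) // addr_ge0 //.
    exact: le_trans (condE_ge0 mE x0 (fun w _ => normr_ge0 _)) sum_near.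
  apply: le_trans Hn; rewrite divr_ge0 // mulr_ge0 //; exact: kmax_ge0.
have D0 : 0 < in_weight (x i) by rewrite lt_neqAle eq_sym Dn in_weight_ge0.
have mD' := mD D0; have near1 := sum_near; have ms := bmf_sdev.
set D := in_weight (x i) in D0 mD' near1 Dn ms *.
have marc : bmf (fun w => (Defs.arc U j i w)%:R : R).
  exact: bmf_bool (arc_meas U_ok _ _).
have H0' := H0.
pose a2 := H S / theta S n.
have a20 : 0 <= a2 by rewrite divr_ge0 // ltW.
apply: (@le_trans _ _ (EE (fun w => 2%:R / m * (`|sn w - D| +
    a2 * (Defs.arc U j i w)%:R)))).
  apply: (condE_le mE x0 (bmf_C i j)).
    by apply: bmf_scale; apply: bmf_add => //; exact: bmf_scale.
  move=> w _; set ar := (Defs.arc U j i w)%:R.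
  have ar0 : 0 <= ar by [].
  have p1 : 0 <= a2 * ar by rewrite mulr_ge0.
  have p2 := normr_ge0 (sn w - D).
  have [big|small] := lerP (D / 2%:R) (sn w).
    have s0 : 0 < sn w by apply: lt_le_trans big; rewrite divr_gt0.
    have W0 : 0 < weight_sum U i w by move: s0; rewrite /sn pmulr_lgt0 ?invr_gt0.
    rewrite (C_entry U_ok); apply: (@le_trans _ _ (a2 * ar / sn w)).
      have -> : a2 * ar / sn w = 1 * (H S * ar / weight_sum U i w).
        by rewrite /a2 /sn; field; rewrite !gt_eqF.
      have /andP[B0 BH] := B_range U_ok i j w.
      apply: ler_pM => //; first by rewrite !mulr_ge0 // invr_ge0 ltW.
        by case: (i != j).
      by rewrite ler_wpM2r ?invr_ge0 ?(ltW W0) // ler_wpM2r.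
    have iv : (sn w)^-1 <= 2%:R / m.
      rewrite -[2%:R / m]invf_div lef_pV2 ?posrE ?divr_gt0 //.
      by apply: le_trans big; rewrite ler_pM2r ?invr_gt0.
    rewrite mulrC; apply: ler_pM => //; first by rewrite invr_ge0 ltW.
    lra.
  apply: le_trans (C_le1 U_ok i j w) _.
  have h : m / 2%:R <= `|sn w - D| + a2 * ar.
    have := ler_norm (D - sn w); rewrite distrC; lra.
  rewrite -(ler_pM2l (divr_gt0 m0 (ltr0Sn R 1))) mulr1 mulrA.
  by rewrite (_ : m / 2%:R * (2%:R / m) = 1) ?mul1r //; field; rewrite gt_eqF.
rewrite (condE_scale mE); last by apply: bmf_add => //; exact: bmf_scale.
rewrite ler_pM2l ?divr_gt0 // (condE_add mE ms (bmf_scale _ marc)).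
apply: lerD => //; rewrite (condE_scale mE _ marc) (condE_arc U_ok x0 0).
apply: le_trans Hn; rewrite /a2 -!mulrA ler_wpM2l //.
by rewrite mulrC edge_prob_le.
Qed.

Variables (u : 'I_(l S)) (k : nat).
Hypothesis kb : 2%:R * k.+1%:R <= b1.
Let nsum w := (\sum_j (Defs.arc U j i w)%:R *
  ((j != i)%:R * (B U i j w * node u j k w))) / theta S n.
Let mu := mean_field (fun s => beta (x i) s * rho k s u) (x i).
Hypothesis num_near : EE (fun w => `|nsum w - mu|) <= e3.

Lemma bmf_nsum : bmf nsum.
Proof.
apply: bmf_mul (bmf_cst _); apply: bmf_sum => j _; apply: bmf_mul.
  exact: bmf_bool (arc_meas U_ok _ _).
by apply: bmf_scale; apply: bmf_mul; [exact: (bmf_wgt U_ok)|exact: bmf_node].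
Qed.

(** With [N] the numerator and [s] the denominator of the weighted average, both
    divided by [theta n], and [q = mu / D] the quotient of their limits,
    [(N / s - q) * s = (N - mu) - q * (s - D)]; where [s] is less than half of
    [D], the trivial bound [2 * b1] is paid by the deviation of [s]. *)
Lemma avg_small :
  EE (fun w => `|\sum_j CC w i j * node u j k w -
                 field beta (Wbar n) (Rbar n) u (x i) k|)
   <= 2%:R / m * (e3 + 2%:R * b1 * e1).
Proof.
set q := field _ _ _ _ _ _.
have k0 : 0 <= 2%:R * k.+1%:R :> R by [].
have b10 : 0 <= b1 by exact: le_trans kb.
have e10 : 0 <= e1.
  exact: le_trans (condE_ge0 mE x0 (fun w _ => normr_ge0 _)) sum_near.
have e30 : 0 <= e3.
  exact: le_trans (condE_ge0 mE x0 (fun w _ => normr_ge0 _)) num_near.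
pose Pa w := \sum_j CC w i j * node u j k w.
have mPa : bmf Pa.
  by apply: bmf_sum => j _; apply: bmf_mul; [exact: bmf_C|exact: bmf_node].
have nb j w : `|node u j k w| <= b1.
  exact: le_trans (node_bound S_ok U_ok beta0 Wb1 Rb1 x u j k w) kb.
have Pab w : `|Pa w| <= \sum_j CC w i j * b1.
  apply: le_trans (ler_norm_sum _ _ _) _; apply: ler_sum => j _.
  by rewrite normrM (ger0_norm (C_ge0 U_ok i j w)) ler_wpM2l ?(C_ge0 U_ok).
have [D0|Dn] := eqVneq (in_weight (x i)) 0.
  have -> : q = 0.
    rewrite /q /field mxE big1 // => s _; rewrite mxE /= -in_weightE D0 ltxx mul0r //.
  apply: (@le_trans _ _ (EE (fun w => \sum_j CC w i j * b1))).
    apply: (condE_le mE x0).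
    - by apply: bmf_norm; apply: bmf_sub (bmf_cst _).
    - by apply: bmf_sum => j _; exact: bmf_mul (bmf_C i j) (bmf_cst _).
    - by move=> w _; rewrite subr0; exact: Pab.
  rewrite (condE_sum mE x0) => [|j _]; last exact: bmf_mul (bmf_C i j) (bmf_cst _).
  rewrite big1; first by rewrite !mulr_ge0 ?invr_ge0 ?(ltW m0) // addr_ge0 ?mulr_ge0.
  move=> j _; under [X in EE X]eq_fun do rewrite mulrC.
  by rewrite (condE_scale mE _ (bmf_C i j)) C_null // mulr0.
have D0 : 0 < in_weight (x i) by rewrite lt_neqAle eq_sym Dn in_weight_ge0.
have mD' := mD D0.
have qD : q * in_weight (x i) = mu.
  rewrite /q /field mxE mulr_suml; apply: eq_bigr => s _.
  by rewrite mxE /= -in_weightE D0; field; rewrite gt_eqF.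
have near1 := sum_near; have ms := bmf_sdev.
set D := in_weight (x i) in D0 mD' near1 Dn ms qD *.
have Pab1 w : `|Pa w| <= b1.
  apply: le_trans (Pab w) _; rewrite -mulr_suml ler_piMl //; exact: (C_sum U_ok).
have qb : `|q| <= b1.
  apply: le_trans (Mrho_bound S_ok beta0 Wb1 Rb1 k (x i) u) _.
  by apply: le_trans kb; have := ler0n R k.+1; lra.
have bn := bmf_nsum.
have mnd : bmf (fun w => `|nsum w - mu|).
  by apply: bmf_norm; apply: bmf_sub (bmf_cst _).
apply: (@le_trans _ _ (EE (fun w => 2%:R / m * (`|nsum w - mu| +
    2%:R * b1 * `|sn w - D|)))).
  apply: (condE_le mE x0).
  - by apply: bmf_norm; apply: bmf_sub (bmf_cst _).
  - by apply: bmf_scale; apply: bmf_add => //; exact: bmf_scale.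
  move=> w _; rewrite -/(Pa w).
  have p1 := normr_ge0 (sn w - D); have p2 := normr_ge0 (nsum w - mu).
  have p3 : 0 <= b1 * `|sn w - D| by rewrite mulr_ge0.
  rewrite -(ler_pM2l (divr_gt0 m0 (ltr0Sn R 1))) mulrA.
  rewrite (_ : m / 2%:R * (2%:R / m) = 1) ?mul1r; last by field; rewrite gt_eqF.
  have tri : `|Pa w - q| <= 2%:R * b1.
    by apply: le_trans (ler_normB _ _) _; have := Pab1 w; lra.
  have [big|small] := lerP (D / 2%:R) (sn w); last first.
    have h : m / 2%:R <= `|sn w - D|.
      have := ler_norm (D - sn w); rewrite distrC; lra.
    apply: (@le_trans _ _ (`|sn w - D| * (2%:R * b1))); last by lra.
    by apply: ler_pM => //; rewrite ltW // divr_gt0.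
  have s0 : 0 < sn w by apply: lt_le_trans big; rewrite divr_gt0.
  have W0 : 0 < weight_sum U i w by move: s0; rewrite /sn pmulr_lgt0 ?invr_gt0.
  have PS : Pa w * sn w = nsum w.
    rewrite /Pa /sn /nsum mulrA; congr (_ / _); rewrite mulr_suml.
    apply: eq_bigr => j _; rewrite (C_entry U_ok) eq_sym.
    by field; rewrite gt_eqF.
  apply: (@le_trans _ _ (`|(Pa w - q) * sn w|)).
    rewrite normrM mulrC ler_wpM2l // gtr0_norm //.
    by apply: le_trans big; rewrite ler_pM2r ?invr_gt0.
  have -> : (Pa w - q) * sn w = (nsum w - mu) - q * (sn w - D).
    by rewrite -PS -qD; ring.
  apply: le_trans (ler_normB _ _) _; rewrite normrM; apply: lerD => //.
  have : `|q| * `|sn w - D| <= b1 * `|sn w - D| by rewrite ler_wpM2r.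
  lra.
rewrite (condE_scale mE); last by apply: bmf_add => //; exact: bmf_scale.
rewrite ler_pM2l ?divr_gt0 // (condE_add mE mnd (bmf_scale _ ms)).
by apply: lerD => //; rewrite (condE_scale mE _ ms) ler_wpM2l // mulr_ge0.
Qed.

Lemma innov_small e4 : EE (isodev U x i) <= e4 ->
  EE (innov u i k) <= 2%:R / m * (e3 + 2%:R * b1 * e1) + e4.
Proof.
move=> he4.
have -> : innov u i k = fun w => `|\sum_j CC w i j * node u j k w -
    field beta (Wbar n) (Rbar n) u (x i) k| + isodev U x i w by [].
rewrite (condE_add mE).
- by apply: lerD => //; exact: avg_small.
- apply: bmf_norm; apply: bmf_sub (bmf_cst _).
  by apply: bmf_sum => j _; apply: bmf_mul; [exact: bmf_C|exact: bmf_node].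
- exact: (bmc_bmf U_ok (bmc_isodev U x 0 i)).
Qed.

End concentrated.
End one_step_error.

(** * The process is close to its approximation *)

Section process_close.
Context {R : realType} (S : opinion_params R) (S_ok : params_ok S).
Hypothesis theta_infty : theta S n @[n --> \oo] --> +oo.
Context d1 (Omega : measurableType d1) (P : probability Omega R).
Variables (U : opinion_inputs S Omega) (U_ok : is_opinion_model P U).
Variables (beta : 'I_(K S) -> 'I_(K S) -> R) (beta_ok : is_beta P U beta).
Variables (Wbar Rbar : nat -> 'M[R]_(K S, l S)).
Variable (Wbar_ok : is_label_mean P U (fun n i => W U i 0) Wbar).
Variable (Rbar_ok : is_label_mean P U (fun n i => R0 U i) Rbar).
Local Notation typ := (typ P U).
Local Notation EE x := (condE P (labels_are U x)).
Local Notation rho n := (rho beta (Wbar n) (Rbar n)).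
Local Notation nd n := (node U beta (Wbar n) (Rbar n)).

(** The approximating process at a vertex whose label is prescribed. *)
Definition approx n (x : labels S n) (i : 'I_n) u k w : R :=
  driven S (field beta (Wbar n) (Rbar n) u (x i)) (R0 U i w 0 u)
    (fun t => W U i t w 0 u) k.

Lemma approxE n (x : labels S n) i u k w : labels_are U x w ->
  approx x i u k w = Rapprox U beta (Wbar n) (Rbar n) i k w 0 u.
Proof.
by move=> <-; rewrite /approx Rapprox_driven /field /Jn ffunE.
Qed.

Lemma Wbar1 n r u : `|Wbar n r u| <= 1.
Proof. exact: (label_mean_cube Wbar_ok n r u). Qed.

Lemma Rbar1 n r u : `|Rbar n r u| <= 1.
Proof. exact: (label_mean_cube Rbar_ok n r u). Qed.

Lemma bmf_Rproc n k (i : 'I_n) u : bmf (fun w => Rproc U n k w i u).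
Proof.
split; last by exists 1 => w; exact: (Rproc_cube U_ok).
elim: k i => [|k IH] i.
  rewrite (_ : (fun w => _) = fun w => R0 U i w 0 u).
    exact: (R0_entry_meas U_ok).
  by apply/funext => w; rewrite /= mxE.
under eq_fun do rewrite Rproc_step.
apply: measurable_funD.
  apply: measurable_funD; last exact: (bmf_W S_ok U_ok i k.+1 u).1.
  apply: measurable_funM => //; apply: measurable_sum => j.
  by apply: measurable_funM; [exact: (bmf_C U_ok i j).1|exact: IH].
exact: measurable_funM.
Qed.

Lemma approx_bound n (x : labels S n) i u k w :
  (forall r s, 0 <= beta r s) -> `|approx x i u k w| <= 2%:R * k.+1%:R.
Proof.
move=> b0; apply: (driven_bound S_ok) => [t||t].
- exact: (Mrho_bound S_ok b0 (@Wbar1 n) (@Rbar1 n)).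
- exact: (R0_entry_cube U_ok).
- by apply: le_trans (W_cube U_ok i t w 0 u) _; rewrite ler1n.
Qed.

Lemma bmf_approx n (x : labels S n) i u k : bmf (approx x i u k).
Proof.
elim: k => [|k IH] /=.
  split; first exact: (R0_entry_meas U_ok).
  by exists 1 => w; exact: (R0_entry_cube U_ok).
apply: bmf_add; last exact: bmf_scale.
by apply: bmf_add; [exact: bmf_cst|exact: (bmf_W S_ok U_ok)].
Qed.

Lemma approx_node n (x : labels S n) i u k w :
  `|nd n x u i k w - approx x i u k w| <= k%:R * isodev U x i w.
Proof.
apply: (driven_diff S_ok) => t; rewrite distrC; exact: (W_Wnode S_ok U_ok).
Qed.

Lemma typ_beta : typ (fun n x => forall r s, 0 <= beta r s <= H S).
Proof.
apply: typ_mono (typ_labels S_ok P U) => n x x0 lab r s.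
have [i <-] := lab r; have [j <-] := lab s.
exact: (beta_range U_ok beta_ok x0).
Qed.

Lemma near_div (A : R) (eps : R) : 0 < eps -> \forall n \near \oo, A / n%:R <= eps.
Proof.
move=> e0; have h := nbhs_infty_ger (A / eps).
near=> n; have n0 : (0 < n)%N by near: n; exact: nbhs_infty_gt.
rewrite ler_pdivrMr ?ltr0n // -ler_pdivrMl // mulrC.
by near: n.
Unshelve. all: by end_near. Qed.

Section at_time.
Variables (kk : nat).
Local Notation tau := kk.+1.
Let b1 : R := 2%:R * kk.+1%:R.
Let Nb : R := H S * b1.

Let H0 : 0 <= H S. Proof. exact: ltW (H_gt0 S_ok). Qed.
Let b10 : 0 <= b1. Proof. by rewrite mulr_ge0. Qed.
Let Nb0 : 0 <= Nb. Proof. exact: mulr_ge0. Qed.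

Let kb k : (k <= kk)%N -> 2%:R * k.+1%:R <= b1.
Proof. by move=> h; rewrite ler_pM2l // ler_nat ltnS. Qed.

(** A weight and the process of the neighbour are independent, so the error in
    mean is that of [node_mean] times [H]; the absent diagonal term [j = i]
    costs [Nb]. *)
Lemma numerator_mean n (x : labels S n) i u k (om : R) :
  (0 < P (labels_are U x))%E -> (forall r s, 0 <= beta r s <= H S) ->
  (k <= kk)%N ->
  (forall j t, `|EE x (Wnode U x u j t) - Wbar n (x j) u| <= om) ->
  \sum_j `|EE x (fun w => (j != i)%:R * (B U i j w * nd n x u j k w))
    - beta (x i) (x j) * rho n k (x j) u| <= n%:R * (H S * (kk%:R * om)) + Nb.
Proof.
move=> x0 brg kkk Wom; have mE := labels_meas U_ok x.
have om0 : 0 <= om by exact: le_trans (Wom i 0%N).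
have beta0 r s : 0 <= beta r s by have /andP[] := brg r s.
apply: (@le_trans _ _ (\sum_j (H S * (kk%:R * om) + (j == i)%:R * Nb))).
  apply: ler_sum => j _.
  have mN := bmf_node S_ok U_ok beta Wbar Rbar x u j k.
  have mBN : bmf (fun w => B U i j w * nd n x u j k w).
    by apply: bmf_mul => //; exact: (bmf_wgt U_ok).
  rewrite (condE_scale mE _ mBN).
  have /andP[be0 beH] := brg (x i) (x j).
  have [ji|ji] := eqVneq j i; rewrite /=.
    subst j; rewrite mul0r sub0r normrN mul1r -[X in X <= _]add0r; apply: lerD.
      by rewrite !mulr_ge0.
    rewrite normrM ger0_norm //; apply: ler_pM => //.
    apply: le_trans (rho_bound S_ok beta0 (@Wbar1 n) (@Rbar1 n) k (x i) u) _.
    by apply: le_trans (kb kkk); have := ler0n R k.+1; lra.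
  rewrite mul1r mul0r addr0.
  have mB : coord_bmf (coord_sets U tau) [set wgtc i j]%SET (B U i j).
    by apply: (bmc_wgt U_ok); rewrite inE.
  have mNc : coord_bmf (coord_sets U tau) [set nodec j]%SET (nd n x u j k).
    by apply: (bmc_node S_ok U_ok) => //; rewrite inE.
  rewrite (bmc_mul U_ok x0 _ mB mNc); last first.
    by apply/fintype.subsetP => a; rewrite !inE => /eqP ->.
  rewrite (condE_wgt U_ok beta_ok x0) -mulrBr normrM ger0_norm //.
  apply: ler_pM => //; apply: le_trans (node_mean S_ok U_ok beta Rbar_ok x0 k (Wom j)) _.
  by rewrite ler_wpM2r // ler_nat.
rewrite big_split /= sumr_const card_ord -[X in X + _]mulr_natl lerD2l.
by rewrite -mulr_suml (bigD1 i) //= eqxx big1 ?addr0 ?mul1r // => j /negbTE ->.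
Qed.

(** The error is dominated by a walk whose mean is bounded by [condE_walk]; its
    parameters, the mean weight of an edge and the mean one-step error, are
    small because the incoming sums concentrate. The uniformity in the vertex
    is what the statement about finitely many vertices needs. *)
Lemma process_close (eps : R) : 0 < eps -> typ (fun n x =>
  forall i u k, (k <= kk)%N ->
    EE x (fun w => `|Rproc U n k w i u - approx x i u k w|) <= eps).
Proof.
move=> eps0; have km0 := kmax_ge0 S_ok.
pose b := b1 + 1; have b0 : 0 <= b by rewrite addr_ge0.
have [m m0 hm] := pos_lower (in_weight beta).
have m2 : 0 <= 2%:R / m by rewrite divr_ge0 // ltW.
(* All errors will be multiples of [e1]: the numerator error [e1 * c3], the
   one-step error [e1 * cd], the mean edge weight [e1 * cg], and in the end
   [e1 * tot]. *)
pose c3 := 1 + kmax S * (H S * kk%:R + 1).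
have c30 : 0 <= c3 by rewrite addr_ge0 // mulr_ge0 // addr_ge0 // mulr_ge0.
pose cd := 2%:R / m * (c3 + 2%:R * b1) + 1.
have cd0 : 0 <= cd by rewrite addr_ge0 // mulr_ge0 // addr_ge0 // mulr_ge0.
pose cg := 2%:R / m * 2%:R.
have cg0 : 0 <= cg by rewrite mulr_ge0.
pose tot := 2%:R ^+ kk * (cd + kk%:R * (b * cg)) + kk%:R.
have tot0 : 0 <= tot.
  apply: addr_ge0 => //; apply: mulr_ge0; first exact: exprn_ge0.
  by apply: addr_ge0 => //; apply: mulr_ge0 => //; exact: mulr_ge0.
pose e1 := eps / (tot + 1).
have e10 : 0 < e1 by rewrite divr_gt0 // ltr_wpDl.
have near_all : \forall n \near \oo, [/\ Nb / n%:R <= e1,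
    H S * kmax S / n%:R <= e1 & forall u (x : labels S n),
    (0 < P (labels_are U x))%E -> forall i t,
    `|EE x (Wnode U x u i t) - Wbar n (x i) u| <= e1].
  have h1 := near_div Nb e10; have h2 := near_div (H S * kmax S) e10.
  have h3 : \forall n \near \oo, forall u (x : labels S n),
    (0 < P (labels_are U x))%E -> forall i t,
    `|EE x (Wnode U x u i t) - Wbar n (x i) u| <= e1.
    by apply: filter_forall => u; exact: (Wbar_close S_ok theta_infty U_ok).
  by move: h1 h2 h3; apply: filterS3 => n.
apply: typ_mono (typ_and (typ_and (isodev_small S_ok theta_infty U_ok e10) typ_beta)
  (typ_and (in_sum_concentration S_ok theta_infty U_ok tau Nb0 e10)
           (typ_near P U near_all))).
move=> n x x0 [[iso_sm brg] [conc [near1 near2 near3]]] i u k kkk.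
have mE := labels_meas U_ok x.
have beta0 r s : 0 <= beta r s by have /andP[] := brg r s.
have mi := bmc_bmf U_ok (bmc_isodev U x 0 i).
have mdiff : bmf (fun w => Rproc U n k w i u - nd n x u i k w).
  by apply: bmf_sub; [exact: bmf_Rproc|exact: (bmf_node S_ok U_ok)].
have sum_near j : EE x (fun w => `|weight_sum U j w / theta S n -
    in_weight beta (x j)|) <= e1.
  have HNb : H S <= Nb.
    rewrite /Nb ler_peMr // /b1; have : 1 <= kk.+1%:R :> R by rewrite ler1n.
    lra.
  have := conc j (fun v => B U j v) (beta (x j)) _ _ _.
  rewrite [X in _ -> _ -> _ -> _ <= _ + _ * X]big1; last first.
    by move=> v _; rewrite (condE_wgt U_ok beta_ok x0) subrr normr0.
  rewrite mulr0 addr0 => h.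
  apply: le_trans (h _ _ _).
  - rewrite le_eqVlt; apply/orP; left; apply/eqP; congr condE.
    apply/funext => w; congr (`|_ / _ - _|); rewrite /weight_sum.
    by apply: eq_bigr => v _; rewrite mulrC.
  - by move=> v; apply: (bmc_wgt U_ok); rewrite !inE eqxx.
  - move=> v w; have /andP[B0 BH] := B_range U_ok j v w.
    by rewrite ger0_norm //; exact: le_trans BH HNb.
  - move=> s; have /andP[B0 BH] := brg (x j) s.
    by rewrite ger0_norm //; exact: le_trans BH HNb.
have num_near j v q : (q <= kk)%N -> EE x (fun w =>
    `|(\sum_a (Defs.arc U a j w)%:R * ((a != j)%:R * (B U j a w * nd n x v a q w)))
      / theta S n - mean_field (fun s => beta (x j) s * rho n q s v) (x j)|)
    <= e1 * c3.
  move=> qk.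
  apply: le_trans (conc j (fun a w => (a != j)%:R * (B U j a w * nd n x v a q w))
     (fun s => beta (x j) s * rho n q s v) _ _ _) _.
  - move=> a; apply: bmf_scale; apply: bmf_mul.
      by apply: (bmc_wgt U_ok); rewrite !inE eqxx.
    by apply: (bmc_node S_ok U_ok) => //; rewrite !inE eqxx orbT.
  - move=> a w; have /andP[B0 BH] := B_range U_ok j a w.
    rewrite !normrM (ger0_norm B0) -[X in _ <= X]mul1r; apply: ler_pM => //.
    + exact: mulr_ge0.
    + by case: (a != j); rewrite ?normr1 ?normr0.
    apply: ler_pM => //; apply: le_trans (kb qk).
    exact: (node_bound S_ok U_ok beta0 (@Wbar1 n) (@Rbar1 n)).
  - move=> s; have /andP[B0 BH] := brg (x j) s.
    rewrite normrM (ger0_norm B0); apply: ler_pM => //.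
    apply: le_trans (rho_bound S_ok beta0 (@Wbar1 n) (@Rbar1 n) q s v) _.
    by apply: le_trans (kb qk); have := ler0n R q.+1; lra.
  have nm := numerator_mean j x0 brg qk (near3 v x x0).
  have n0 : 0 < n%:R :> R by rewrite ltr0n; exact: leq_ltn_trans (ltn_ord i).
  rewrite mulrDr mulr1 lerD2l.
  apply: le_trans (ler_wpM2l _ nm) _; first by rewrite divr_ge0.
  rewrite mulrDr (_ : kmax S / n%:R * (n%:R * _) = kmax S * (H S * (kk%:R * e1)));
    last by field; rewrite gt_eqF.
  rewrite (_ : kmax S / n%:R * Nb = kmax S * (Nb / n%:R)); last by field; rewrite gt_eqF.
  have := ler_wpM2l km0 near1; lra.
pose dl := e1 * cd; pose gm := e1 * cg.
have Cg a v : EE x (fun w => Defs.C U n w a v) <= gm.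
  apply: le_trans (C_small S_ok U_ok beta_ok x0 brg m0 (hm (x a)) (sum_near a)
    near2 v) _.
  by rewrite /gm /cg; lra.
have Id v q : (q < tau)%N -> EE x (innov U beta (Wbar n) (Rbar n) x u v q) <= dl.
  rewrite ltnS => qk.
  apply: le_trans (innov_small S_ok U_ok beta_ok x0 brg (@Wbar1 n) (@Rbar1 n)
    m0 (hm (x v)) (sum_near v) (kb qk) (num_near v u q qk) (iso_sm v)) _.
  by rewrite /dl /cd; lra.
have dl0 : 0 <= dl by rewrite mulr_ge0 // ltW.
have gm0 : 0 <= gm by rewrite mulr_ge0 // ltW.
have i0 : i \notin (finset.set0 : {set 'I_n}) by rewrite finset.in_set0.
have walk_le := condE_walk S_ok U_ok x0 b0 gm0 dl0 Cg Id i0 (leqW kkk).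
have err := error_walk S_ok U_ok beta0 (@Wbar1 n) (@Rbar1 n) x u
  (b := b) (kk := kk) (fun q qk => lerD (kb qk) (lexx 1)).
have mwalk := bmc_bmf U_ok (bmc_walk S_ok U_ok beta (Wbar n) (Rbar n) x u b i0
  (leqW kkk)).
apply: (@le_trans _ _ (EE x (fun w =>
  walk U beta (Wbar n) (Rbar n) x u b k finset.set0 i w + k%:R * isodev U x i w))).
  apply: (condE_le mE x0).
  - apply: bmf_norm; apply: bmf_sub; [exact: bmf_Rproc|exact: bmf_approx].
  - by apply: bmf_add => //; exact: bmf_scale.
  - move=> w _; rewrite (_ : _ - _ = (Rproc U n k w i u - nd n x u i k w) +
      (nd n x u i k w - approx x i u k w)); last by ring.
    apply: le_trans (ler_normD _ _) _; apply: lerD; first exact: err.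
    exact: approx_node.
rewrite (condE_add mE mwalk (bmf_scale _ mi)) (condE_scale mE _ mi).
apply: (@le_trans _ _ (e1 * tot)); last first.
  by rewrite /e1 mulrAC ler_pdivrMr ?ler_pM2l //; lra.
rewrite /tot mulrDr; apply: lerD.
  apply: le_trans walk_le _; rewrite cards0 add0n.
  rewrite [X in _ <= X]mulrCA; apply: ler_pM.
  - by rewrite subr_ge0 exprn_ege1 // ler1n.
  - by apply: addr_ge0 => //; apply: mulr_ge0 => //; exact: mulr_ge0.
  - apply: (@le_trans _ _ (2%:R ^+ k)); first by lra.
    by apply: ler_weXn2l => //; rewrite ler1n.
  - rewrite /dl /gm [X in _ <= X]mulrDr lerD2l.
    rewrite [X in _ <= X](_ : _ = kk%:R * (b * (e1 * cg))); last by ring.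
    by apply: ler_wpM2r; [exact: mulr_ge0|rewrite ler_nat].
rewrite mulrC; apply: ler_pM => //.
  by apply: (condE_ge0 mE x0) => w _; have /andP[] := isodev_le1 U x i w.
by rewrite ler_nat.
Qed.

End at_time.
End process_close.

(** * Continuous test functions of matrices *)

Section test_functions.
Context {R : realType} (m n : nat).
Implicit Types (f : 'M[R]_(m, n) -> R) (X Y : 'M[R]_(m, n)).

Lemma opnorm1_le X : opnorm1 X <= \sum_i \sum_j `|X i j|.
Proof.
apply: ge_sup.
  exists (norm1 (X *m 0)); exists 0 => //=.
  by rewrite /norm1 big1 ?ler01 // => i _; rewrite mxE normr0.
move=> _ [v /= v1 <-]; rewrite /norm1; apply: ler_sum => i _.
rewrite mxE; apply: le_trans (ler_norm_sum _ _ _) _; apply: ler_sum => j _.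
rewrite normrM ler_piMr //; apply: le_trans v1.
by rewrite /norm1 (bigD1 j) //= lerDl; exact: sumr_ge0.
Qed.

Lemma continuous1_entry f X (eps : R) : continuous1 f -> 0 < eps ->
  exists2 dl : R, 0 < dl &
    forall Y, (forall i j, `|Y i j - X i j| < dl) -> `|f Y - f X| < eps.
Proof.
move=> cf e0; have [dl d0 h] := cf X eps e0.
have mn0 : 0 < (m * n)%:R + 1 :> R by rewrite ltr_wpDl.
exists (dl / ((m * n)%:R + 1)); first exact: divr_gt0.
move=> Y hY; apply: h; apply: le_lt_trans (opnorm1_le _) _.
apply: (@le_lt_trans _ _ (\sum_(i < m) \sum_(j < n) dl / ((m * n)%:R + 1))).
  by apply: ler_sum => i _; apply: ler_sum => j _; rewrite !mxE; exact/ltW/hY.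
rewrite !sumr_const !card_ord -mulrnA -[X in X < _]mulr_natr mulnC.
rewrite mulrAC ltr_pdivrMr // ltr_pM2l //; lra.
Qed.

(** A continuous function of a matrix with measurable entries is measurable:
    it is the limit of its values at the matrices rounded to a grid. *)
Lemma measurable_continuous1 d (T : measurableType d) (g : T -> 'M[R]_(m, n)) f :
  (forall i j, measurable_fun setT (fun t => g t i j)) -> continuous1 f ->
  measurable_fun setT (fun t => f (g t)).
Proof.
move=> mg cf.
pose Z N t : 'M[int]_(m, n) := \matrix_(i, j) Num.floor (g t i j * N.+1%:R).
pose rd N (z : 'M[int]_(m, n)) : 'M[R]_(m, n) :=
  \matrix_(i, j) ((z i j)%:~R / N.+1%:R).
have mZ N (z : 'M[int]_(m, n)) : measurable [set t | Z N t = z].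
  rewrite (_ : [set t | _] = \bigcap_(i in [set: 'I_m])
     \bigcap_(j in [set: 'I_n]) [set t | (z i j)%:~R <= g t i j * N.+1%:R
        < (z i j + 1)%:~R]).
    apply: fin_bigcap_measurable => // i _; apply: fin_bigcap_measurable => // j _.
    have mf : measurable_fun setT (fun t => g t i j * N.+1%:R).
      by apply: measurable_funM.
    rewrite (_ : [set t | _] = (fun t => g t i j * N.+1%:R) @^-1`
      [set` `[(z i j)%:~R, (z i j + 1)%:~R[ ]).
      by rewrite -[X in measurable X]setTI; exact: mf.
    by apply/seteqP; split => t /=; rewrite in_itv.
  apply/seteqP; split=> t /=.
    by move=> <- i _ j _ /=; rewrite !mxE floor_itv.
  move=> h; apply/matrixP => i j; rewrite mxE.
  by apply: floor_def; exact: h.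
apply: (measurable_fun_cvg (h := fun N t => f (rd N (Z N t)))).
  move=> N _ Y mY; rewrite setTI.
  rewrite (_ : _ @^-1` _ = \bigcup_(z in [set z | Y (f (rd N z))])
     [set t | Z N t = z]).
    rewrite bigcup_mkcond; apply: countable_bigcupT_measurable => [|z].
      exact: countableP.
    by case: ifP.
  apply/seteqP; split=> t /=; first by move=> h; exists (Z N t).
  by move=> [z hz ->].
move=> t _; apply/cvgrPdist_lt => e e0.
have [dl d0 h] := continuous1_entry (g t) cf e0.
have : \forall N \near \oo, dl^-1 <= N%:R by exact: nbhs_infty_ger.
apply: filterS => N hN; rewrite distrC; apply: h => i j; rewrite !mxE.
have N0 : 0 < N.+1%:R :> R by [].
have /andP[h1 h2] := floor_itv (g t i j * N.+1%:R).
set z := (Num.floor _)%:~R; set y := g t i j.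
have -> : `|z / N.+1%:R - y| = `|z - y * N.+1%:R| / N.+1%:R.
  rewrite -[X in _ = _ / X](ger0_norm (ltW N0)) -normf_div; congr (`|_|).
  by field; rewrite addrC natr1 pnatr_eq0.
rewrite ltr_pdivrMr //.
have hd : 1 < dl * N.+1%:R.
  rewrite -ltr_pdivrMl // mulr1; apply: le_lt_trans hN _.
  by rewrite ltr_nat.
move: h1 h2; rewrite intrD -/z -/y => h1 h2.
rewrite ltr_norml; apply/andP; split; lra.
Qed.

End test_functions.

Section uniform_continuity.
Context {R : realType} (m n : nat).
Implicit Types (f : 'M[R]_(m, n) -> R) (X Y : 'M[R]_(m, n)).

Definition box (b : R) : set 'M[R]_(m, n) := [set X | forall i j, `|X i j| <= b].

(** Uniform continuity on a compact set: of two sequences of points that violate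
    it, the first clusters at some [X], and continuity at [X] is contradicted. *)
Lemma box_unif_continuous f (b eps : R) : continuous1 f -> 0 < eps ->
  exists2 dl : R, 0 < dl & forall X Y, box b X -> box b Y ->
    (forall i j, `|X i j - Y i j| <= dl) -> `|f X - f Y| <= eps.
Proof.
move=> cf e0; apply: contrapT => hn.
have bad k : exists XY : 'M[R]_(m, n) * 'M[R]_(m, n),
    [/\ box b XY.1, box b XY.2, forall i j, `|XY.1 i j - XY.2 i j| <= k.+1%:R^-1
      & eps < `|f XY.1 - f XY.2| ].
  apply: contrapT => hk; apply: hn; exists (k.+1%:R^-1); first by rewrite invr_gt0.
  move=> X Y bX bY XY; rewrite leNgt; apply/negP => lt.
  by apply: hk; exists (X, Y).
have [XY hXY] := choice bad.
pose A : set 'rV[R]_(m * n) := [set v | forall j, v 0 j \in `[- b, b]].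
have cA : compact A.
  have -> : A = [set v : 'rV[R]_(m * n) | forall j, `[- b, b]%classic (v 0 j)].
    by [].
  apply: (rV_compact (A := fun=> `[- b, b]%classic)) => j; exact: segment_compact.
pose v k : 'rV[R]_(m * n) := mxvec (XY k).1.
have Av k : A (v k).
  move=> j; case/mxvec_indexP: j => i j; rewrite mxvecE in_itv /= -ler_norml.
  by have [h _ _ _] := hXY k; exact: h.
have [p [_ clp]] := cA (v @ \oo) _ (filterE _ Av).
set X := vec_mx p : 'M[R]_(m, n).
have [dl d0 h] := continuous1_entry X cf (divr_gt0 e0 (ltr0Sn R 1)).
have d2 : 0 < dl / 2%:R by rewrite divr_gt0.
pose near k := 2%:R / dl <= k%:R :> R.
have nearv : (v @ \oo) (v @` [set k | near k]).
  have : \forall k \near \oo, near k by exact: nbhs_infty_ger.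
  by apply: filterS => k nk; exists k.
have [_ [[k /= nk <-] [_ bw]]] := clp _ _ nearv (nbhsx_ballx p _ d2).
have [bX bY XYk lt] := hXY k.
have k0 : 0 < k.+1%:R :> R by [].
have kd : k.+1%:R^-1 < dl / 2%:R.
  rewrite -[dl / _]invf_div ltf_pV2 ?posrE ?divr_gt0 //.
  by apply: le_lt_trans nk _; rewrite ltr_nat.
have h1 i j : `|(XY k).1 i j - X i j| < dl / 2%:R.
  have := bw 0 (mxvec_index i j); rewrite /ball /= distrC.
  by rewrite mxvecE mxE.
have f1 : `|f (XY k).1 - f X| < eps / 2%:R.
  by apply: h => i j; apply: lt_trans (h1 i j) _; lra.
have f2 : `|f (XY k).2 - f X| < eps / 2%:R.
  apply: h => i j.
  have := ler_distD ((XY k).1 i j) ((XY k).2 i j) (X i j).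
  have := h1 i j; have := le_lt_trans (XYk i j) kd.
  rewrite [`|(XY k).1 i j - (XY k).2 i j|]distrC; clear; lra.
have := ler_distD (f X) (f (XY k).1) (f (XY k).2).
rewrite [`|f X - _|]distrC; lra.
Qed.

(** For close arguments uniform continuity provides [eps]; for the others the
    distance is bounded below and the bound of [f] suffices. This form can be
    integrated. *)
Lemma box_lipschitz f (b eps : R) : continuous1 f -> bounded_function f ->
  0 < eps -> exists2 L : R, 0 <= L & forall X Y, box b X -> box b Y ->
    `|f X - f Y| <= eps + L * \sum_i \sum_j `|X i j - Y i j|.
Proof.
move=> cf [C fC] e0; have [dl d0 h] := box_unif_continuous b cf e0.
have C0 : 0 <= `|C| by [].
exists (2%:R * `|C| / dl); first by rewrite divr_ge0 ?mulr_ge0 // ltW.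
move=> X Y bX bY; set s := \sum_i _.
have s0 : 0 <= s by apply: sumr_ge0 => i _; exact: sumr_ge0.
have [near|far] := pselect (forall i j, `|X i j - Y i j| <= dl).
  apply: le_trans (h X Y bX bY near) _; rewrite lerDl; apply: mulr_ge0 => //.
  by apply: divr_ge0; [exact: mulr_ge0|exact: ltW].
have [i hi] := (existsNP _).2 far; have [j hj] := (existsNP _).2 hi.
have ds : dl <= s.
  apply: (@le_trans _ _ `|X i j - Y i j|); first by rewrite leNgt; apply/negP => /ltW.
  rewrite /s (bigD1 i) //= (bigD1 j) //= -addrA lerDl addr_ge0 //.
    exact: sumr_ge0.
  by apply: sumr_ge0 => k _; exact: sumr_ge0.
have fb Z : `|f Z| <= `|C| by exact: le_trans (fC Z) (ler_norm C).
apply: (@le_trans _ _ (2%:R * `|C|)).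
  apply: le_trans (ler_normB _ _) _; have := fb X; have := fb Y; lra.
have : 2%:R * `|C| <= 2%:R * `|C| / dl * s.
  rewrite mulrAC ler_pdivlMr //; apply: ler_wpM2l => //; exact: mulr_ge0.
by lra.
Qed.

End uniform_continuity.

(** * Averages and products of test functions *)

Section averaging.
Context {R : realType} (S : opinion_params R) (S_ok : params_ok S).
Hypothesis theta_infty : theta S n @[n --> \oo] --> +oo.
Context d1 (Omega : measurableType d1) (P : probability Omega R).
Variables (U : opinion_inputs S Omega) (U_ok : is_opinion_model P U).
Variables (beta : 'I_(K S) -> 'I_(K S) -> R) (beta_ok : is_beta P U beta).
Variables (Wbar Rbar : nat -> 'M[R]_(K S, l S)).
Variable (Wbar_ok : is_label_mean P U (fun n i => W U i 0) Wbar).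
Variable (Rbar_ok : is_label_mean P U (fun n i => R0 U i) Rbar).
Variable k : nat.
Local Notation typ := (typ P U).
Local Notation EE x := (condE P (labels_are U x)).
Local Notation approx := (approx U beta Wbar Rbar).
Local Notation testfun := ('M[R]_(l S, k.+1) -> R).

Definition Vapp n (x : labels S n) i w : 'M[R]_(l S, k.+1) :=
  \matrix_(u, b) approx x i u b w.

Lemma bmf_test_V n (i : 'I_n) (f : testfun) : continuous1 f -> bounded_function f ->
  bmf (fun w => f (V U k i w)).
Proof.
move=> cf [C fC]; split; last by exists C.
apply: measurable_continuous1 => // u b; under eq_fun do rewrite mxE.
exact: (bmf_Rproc S_ok U_ok b i u).1.
Qed.

(** The coordinates that determine row [i] of the approximating process; rows
    of distinct vertices have disjoint coordinates. *)
Definition vertex_coords n (i : 'I_n) : {set coord n} := nodec i |: row_coords i.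

Lemma vertex_coords_disj n (i j : 'I_n) : i != j ->
  vertex_coords i \subset ~: vertex_coords j.
Proof.
move=> ij; apply/fintype.subsetP => a; rewrite !inE.
case: a => [[[p q]|[p q]]|p] /=; rewrite ?orbF ?orFb.
- by move=> /eqP ->.
- by move=> /eqP ->.
- by move=> /eqP [->].
Qed.

Lemma bmc_approx n (x : labels S n) i u t tau : (t < tau)%N ->
  coord_bmf (coord_sets U tau) (vertex_coords i) (approx x i u t).
Proof.
move=> tt; have ii : nodec i \in vertex_coords i by rewrite !inE eqxx.
apply: (bmc_driven U_ok _ _ ii) => // s st.
have mZ := bmc_Z ii st (Z_bound S_ok U_ok u i s).
have mQ := bmc_Q U_ok tau u ii.
have mI : coord_bmf (coord_sets U tau) (vertex_coords i)
    (fun w => (indeg U i w == 0%N)%:R : R).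
  by apply: coord_bmf_sub (bmc_indeg0 U tau i); exact: finset.subsetUr.
have -> : (fun w => W U i s w 0 u) = (fun w => d S * Z U i s w 0 u
    + (c S * (indeg U i w == 0%N)%:R) * Q U i w 0 u).
  by apply/funext => w; rewrite /W !mxE.
by apply: bmf_add; [exact: bmf_scale|apply: bmf_mul => //; exact: bmf_scale].
Qed.

Lemma bmc_test n (x : labels S n) i (f : testfun) : continuous1 f ->
  bounded_function f ->
  coord_bmf (coord_sets U k.+1) (vertex_coords i) (fun w => f (Vapp x i w)).
Proof.
move=> cf [C fC]; split; last by exists C.
apply: measurable_continuous1 => // u b; under eq_fun do rewrite mxE.
exact: (bmc_approx x i u (ltn_ord b)).1.
Qed.

Lemma test_close (f : testfun) (eps : R) : continuous1 f -> bounded_function f ->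
  0 < eps ->
  typ (fun n x => forall i,
    EE x (fun w => `|f (V U k i w) - f (Vapp x i w)|) <= eps).
Proof.
move=> cf bf e0; have e2 : 0 < eps / 2%:R by rewrite divr_gt0.
have [L L0 hL] := box_lipschitz (2%:R * k.+1%:R) cf bf e2.
pose D : R := L * ((l S)%:R * k.+1%:R) + 1.
have D0 : 0 < D by rewrite ltr_wpDl // !mulr_ge0.
have e3 : 0 < eps / 2%:R / D by rewrite divr_gt0.
apply: typ_mono (typ_and (typ_beta S_ok U_ok beta_ok)
  (process_close S_ok theta_infty U_ok beta_ok Wbar_ok Rbar_ok k e3)).
move=> n x x0 [brg pc] i; have mE := labels_meas U_ok x.
have beta0 r s : 0 <= beta r s by have /andP[] := brg r s.
have mV := bmf_test_V i cf bf.
have mA := bmc_bmf U_ok (bmc_test x i cf bf).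
pose dv u (b : 'I_k.+1) w := `|Rproc U n b w i u - approx x i u b w|.
have mdv u b : bmf (dv u b).
  apply: bmf_norm; apply: bmf_sub; first exact: (bmf_Rproc S_ok U_ok).
  exact: (bmf_approx S_ok U_ok).
have ms : bmf (fun w => \sum_u \sum_b dv u b w).
  by apply: bmf_sum => u _; exact: bmf_sum.
apply: (@le_trans _ _ (EE x (fun w => eps / 2%:R + L * \sum_u \sum_b dv u b w))).
  apply: (condE_le mE x0).
  - by apply: bmf_norm; exact: bmf_sub.
  - by apply: bmf_add; [exact: bmf_cst|exact: bmf_scale].
  - move=> w _; apply: le_trans (hL _ _ _ _) _.
    + move=> u b; rewrite mxE; apply: le_trans (Rproc_cube U_ok b w i u) _.
      by have := ler0n R k; rewrite -natr1; lra.
    + move=> u b; rewrite mxE.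
      apply: le_trans (approx_bound S_ok U_ok Wbar_ok Rbar_ok x i u b w beta0) _.
      by rewrite ler_pM2l // ler_nat ltn_ord.
    + rewrite lerD2l ler_wpM2l //; apply: ler_sum => u _; apply: ler_sum => b _.
      by rewrite !mxE.
rewrite (condE_add mE (bmf_cst _) (bmf_scale _ ms)) (condE_cst mE x0).
rewrite (condE_scale mE _ ms) (condE_sum mE x0); last first.
  by move=> u _; exact: bmf_sum.
have : L * \sum_u EE x (fun w => \sum_b dv u b w) <= eps / 2%:R; last by lra.
apply: (@le_trans _ _ (L * \sum_(u < l S) \sum_(b < k.+1) (eps / 2%:R / D))).
  rewrite ler_wpM2l //; apply: ler_sum => u _; rewrite (condE_sum mE x0) //.
  by apply: ler_sum => b _; apply: pc; rewrite -ltnS.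
rewrite !sumr_const !card_ord -mulrnA -[X in L * X]mulr_natl natrM.
rewrite mulrA -[X in _ <= X](divfK (lt0r_neq0 D0)) [X in _ <= X]mulrC.
rewrite ler_wpM2r ?(ltW e3) // /D mulrC [X in L * X]mulrC mulrC; lra.
Qed.

Section root_law.
Context d2 (Omega' : measurableType d2) (P' : probability Omega' R).
Variables (Jroot : forall n, labels S n -> Omega' -> 'I_(K S))
  (Rroot : forall n, labels S n -> 'I_k.+1 -> Omega' -> 'rV[R]_(l S)).
Variable (root_ok : is_root P P' U beta Wbar Rbar Jroot Rroot).

Lemma row_measurable d (T : measurableType d) (g : T -> 'rV[R]_(l S)) :
  (forall u, measurable_fun setT (fun t => g t 0 u)) -> measurable_fun setT g.
Proof.
move=> mg; apply: (@measurability _ _ _ _ _ _ (@mx_cylinders R 1 (l S))) => //.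
move=> _ [_ [i [j [B [mB ->]]]] <-]; rewrite ord1.
exact: (mg j).
Qed.

Lemma Jroot_event_meas n (x : labels S n) r :
  measurable [set w | Jroot x w = r].
Proof. exact: (Jroot_meas root_ok). Qed.

Lemma Jroot_event_gt0 n (x : labels S n) r :
  (0 < P' [set w | Jroot x w = r])%E.
Proof. by rewrite (Jroot_law root_ok) lte_fin (Defs.pi_gt0 S_ok). Qed.

Lemma root_entry_meas n (x : labels S n) u b :
  measurable_fun setT (fun w => Vroot Rroot x w u b).
Proof.
under eq_fun do rewrite mxE.
exact: (measurableT_comp (entry_meas u) (Rroot_meas root_ok x b)).
Qed.

Lemma bmf_test_root n (x : labels S n) (f : testfun) : continuous1 f ->
  bounded_function f -> bmf (fun w => f (Vroot Rroot x w)).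
Proof.
move=> cf [C fC]; split; last by exists C.
by apply: measurable_continuous1 => // u b; exact: root_entry_meas.
Qed.

(** The law of the root is given through tuples of rows; read the test function
    on them. *)
Lemma root_mean n (x : labels S n) i r (f : testfun) :
  (0 < P (labels_are U x))%E -> x i = r ->
  continuous1 f -> bounded_function f ->
  condE P' [set w | Jroot x w = r] (fun w => f (Vroot Rroot x w)) =
  EE x (fun w => f (Vapp x i w)).
Proof.
move=> x0 xi cf bf.
pose X1 w := [tuple Rroot x b w | b < k.+1].
pose X2 w : k.+1.-tuple 'rV[R]_(l S) := [tuple \row_u approx x i u b w | b < k.+1].
pose h (t : k.+1.-tuple 'rV[R]_(l S)) := f (\matrix_(u, b) tnth t b 0 u).
have -> : (fun w => f (Vroot Rroot x w)) = (fun w => h (X1 w)).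
  apply/funext => w; congr f; apply/matrixP => u b; rewrite !mxE.
  by rewrite tnth_mktuple.
have -> : (fun w => f (Vapp x i w)) = (fun w => h (X2 w)).
  apply/funext => w; congr f; apply/matrixP => u b; rewrite !mxE.
  by rewrite tnth_mktuple mxE.
apply: condE_eq_law.
- exact: Jroot_event_meas.
- exact: (labels_meas U_ok).
- exact: Jroot_event_gt0.
- exact: x0.
- apply/measurable_fun_tnthP => b.
  rewrite (_ : _ \o _ = Rroot x b); first exact: (Rroot_meas root_ok).
  by apply/funext => w; rewrite /= tnth_mktuple.
- apply/measurable_fun_tnthP => b; apply: row_measurable => u.
  rewrite (_ : (fun _ => _) = approx x i u b).
    exact: (bmf_approx S_ok U_ok beta Wbar Rbar x i u b).1.
  by apply/funext => w; rewrite /= tnth_mktuple mxE.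
- move=> A mA; rewrite (Rroot_law root_ok x0 xi mA) /condP.
  congr (fine (P _) / _); apply/seteqP; split=> w /= [hA hx]; split=> //;
    move: hA; congr (A _); apply: eq_mktuple => b; apply/rowP => u;
    by rewrite mxE (approxE _ _ _ _ _ _ hx).
- split; last by have [C fC] := bf; exists C => t; exact: fC.
  apply: measurable_continuous1 => // u b; under eq_fun do rewrite mxE.
  exact: (measurableT_comp (entry_meas u) (measurable_tnth b)).
Qed.

(** Replace the factors one at a time. *)
Lemma prod_diff (m : nat) (a b : 'I_m -> R) (C : R) : 1 <= C ->
  (forall j, `|a j| <= C) -> (forall j, `|b j| <= C) ->
  `|\prod_j a j - \prod_j b j| <= C ^+ m * \sum_j `|a j - b j|.
Proof.
move=> C1; have C0 : 0 <= C by exact: le_trans C1.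
elim: m a b => [|m IH] a b ha hb.
  by rewrite !big_ord0 subrr normr0 mulr0.
rewrite !big_ord_recl exprS.
set a' := fun j => a (lift ord0 j); set b' := fun j => b (lift ord0 j).
have ih := IH a' b' (fun j => ha _) (fun j => hb _).
have pa : `|\prod_j a' j| <= C ^+ m.
  rewrite normr_prod; apply: (@le_trans _ _ (\prod_(j < m) C)).
    by apply: ler_prod => j _; rewrite normr_ge0 /=; exact: ha.
  by rewrite prodr_const card_ord.
set A := \prod_j a' j in ih pa *; set B := \prod_j b' j in ih *.
set s := \sum_j _ in ih *.
have s0 : 0 <= s by exact: sumr_ge0.
rewrite (_ : a ord0 * A - b ord0 * B = (a ord0 - b ord0) * A + b ord0 * (A - B));
  last by ring.
apply: le_trans (ler_normD _ _) _; rewrite !normrM mulrDr; apply: lerD.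
  rewrite mulrC; apply: ler_pM => //; apply: le_trans pa _.
  by rewrite ler_peMl // exprn_ge0.
by rewrite -mulrA; apply: ler_pM.
Qed.

(** Factor by factor the process may be replaced by its approximation, whose
    rows are independent. *)
Lemma product_test (m : nat) (r : 'I_m -> 'I_(K S)) (f : 'I_m -> testfun)
    (eps : R) :
  (forall j, bounded_function (f j)) -> (forall j, continuous1 (f j)) ->
  0 < eps ->
  typ (fun n x => forall v : 'I_m -> 'I_n, injective v ->
    (forall j, x (v j) = r j) ->
    `|EE x (fun w => \prod_j f j (V U k (v j) w)) -
      \prod_j condE P' [set w | Jroot x w = r j] (fun w => f j (Vroot Rroot x w))|
    < eps).
Proof.
move=> bf cf e0.
have bf' j : exists C, forall X, `|f j X| <= C := bf j.
have [Cs hCs] := choice bf'.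
pose C := 1 + \sum_j `|Cs j|.
have C1 : 1 <= C by rewrite lerDl; exact: sumr_ge0.
have fC j X : `|f j X| <= C.
  apply: le_trans (hCs j X) _; rewrite /C (bigD1 j) //=.
  apply: le_trans (ler_norm _) _; rewrite addrCA lerDl addr_ge0 //.
  exact: sumr_ge0.
have D0 : 0 < C ^+ m * m%:R + 1 by rewrite ltr_wpDl // mulr_ge0 // exprn_ge0 //; lra.
have e1 : 0 < eps / (C ^+ m * m%:R + 1) by rewrite divr_gt0.
have tc : typ (fun n x => forall j i,
    EE x (fun w => `|f j (V U k i w) - f j (Vapp x i w)|) <=
      eps / (C ^+ m * m%:R + 1)).
  have : forall s : seq 'I_m, typ (fun n x => forall j i, j \in s ->
    EE x (fun w => `|f j (V U k i w) - f j (Vapp x i w)|) <=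
      eps / (C ^+ m * m%:R + 1)).
    elim=> [|j s IH]; first by exists 1 => //; near=> n.
    apply: typ_mono (typ_and (test_close (cf j) (bf j) e1) IH).
    move=> n x _ [h1 h2] q i; rewrite inE => /orP[/eqP ->|qs]; first exact: h1.
    exact: h2.
  move=> /(_ (index_enum 'I_m)); apply: typ_mono => n x _ h j i.
  by apply: h; exact: mem_index_enum.
apply: typ_mono tc => n x x0 hc v vi xv; have mE := labels_meas U_ok x.
have mV j := bmf_test_V (v j) (cf j) (bf j).
have mA j := bmc_bmf U_ok (bmc_test x (v j) (cf j) (bf j)).
have -> : \prod_j condE P' [set w | Jroot x w = r j]
    (fun w => f j (Vroot Rroot x w)) = EE x (fun w => \prod_j f j (Vapp x (v j) w)).
  rewrite (@bmc_prod _ _ _ _ _ _ U_ok _ _ x0 k.+1 _ _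
     (fun j => vertex_coords (v j))).
  - by apply: eq_bigr => j _; exact: root_mean.
  - exact: index_enum_uniq.
  - by move=> i j _ _ ij; apply: vertex_coords_disj; rewrite (inj_eq vi).
  - by move=> j _; exact: bmc_test.
have mpV : bmf (fun w => \prod_j f j (V U k (v j) w)) by exact: bmf_prod.
have mpA : bmf (fun w => \prod_j f j (Vapp x (v j) w)) by exact: bmf_prod.
rewrite -(condE_sub mE mpV mpA).
apply: le_lt_trans (condE_norm mE x0 (bmf_sub mpV mpA)) _.
have mds : bmf (fun w => \sum_j `|f j (V U k (v j) w) - f j (Vapp x (v j) w)|).
  by apply: bmf_sum => j _; apply: bmf_norm; exact: bmf_sub.
apply: (@le_lt_trans _ _ (EE x (fun w => C ^+ m * \sum_j
   `|f j (V U k (v j) w) - f j (Vapp x (v j) w)|))).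
  apply: (condE_le mE x0).
  - by apply: bmf_norm; exact: bmf_sub.
  - exact: bmf_scale.
  - by move=> w _; apply: prod_diff => // j; exact: fC.
rewrite (condE_scale mE _ mds) (condE_sum mE x0); last first.
  by move=> j _; apply: bmf_norm; exact: bmf_sub.
apply: (@le_lt_trans _ _ (C ^+ m * \sum_(j < m) (eps / (C ^+ m * m%:R + 1)))).
  rewrite ler_wpM2l ?exprn_ge0 //; first by lra.
  by apply: ler_sum => j _; exact: hc.
rewrite sumr_const card_ord -[X in _ * X]mulr_natl.
rewrite [X in X < _](_ : _ = eps * (C ^+ m * m%:R / (C ^+ m * m%:R + 1))); last by ring.
rewrite -[X in _ < X]mulr1 ltr_pM2l // ltr_pdivrMr // mul1r; lra.
Unshelve. all: by end_near.
Qed.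

(** Averages over the vertices: independent rows of the approximating process
    obey the law of large numbers. *)
Lemma average_test (r : 'I_(K S)) (f : testfun) (eps : R) :
  bounded_function f -> continuous1 f -> 0 < eps ->
  typ (fun n x => EE x (fun w =>
    `|n%:R^-1 * \sum_i f (V U k i w) * (x i == r)%:R -
      \int[P']_w' (f (Vroot Rroot x w') * (Jroot x w' == r)%:R)|) <= eps).
Proof.
move=> bf cf e0; have [C C0 fC] := bounded_nneg bf.
have e4 : 0 < eps / 4%:R by rewrite divr_gt0.
have ee : 0 < eps / 4%:R / (C + 1) by rewrite divr_gt0 // ltr_wpDl.
have nn : \forall n \near \oo, C ^+ 2 / n%:R <= (eps / 4%:R) ^+ 2.
  by apply: near_div; rewrite exprn_gt0.
apply: typ_mono (typ_and (typ_and (typ_labels S_ok P U) (test_close cf bf e4))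
  (typ_and (typ_near P U nn) (typ_good P U ee))).
move=> n x x0 [[lab tc] [{}nn /forallP/(_ r) fr]]; have mE := labels_meas U_ok x.
have [i0 xi0] := lab r.
have n0 : 0 < n%:R :> R by rewrite ltr0n; exact: leq_ltn_trans (ltn_ord i0).
set phi := condE P' [set w | Jroot x w = r] (fun w => f (Vroot Rroot x w)).
have phiE i : x i = r -> EE x (fun w => f (Vapp x i w)) = phi.
  by move=> xi; rewrite /phi (root_mean x0 xi cf bf).
have mVr := bmf_test_root x cf bf.
have phiC : `|phi| <= C.
  exact: (condE_bound (Jroot_event_meas x r) (Jroot_event_gt0 x r) mVr).
have -> : \int[P']_w' (f (Vroot Rroot x w') * (Jroot x w' == r)%:R) =
    Defs.pi r * phi.
  have pr : fine (P' [set w | Jroot x w = r]) = Defs.pi r.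
    by rewrite (Jroot_law root_ok).
  rewrite /phi /condE pr mulrC divfK; last by rewrite gt_eqF // (Defs.pi_gt0 S_ok).
  rewrite [in RHS]Rintegral_mkcond; apply: eq_Rintegral => w _; rewrite /patch.
  have [e|ne] := eqVneq (Jroot x w) r; first by rewrite mem_set // mulr1.
  by rewrite memNset ?mulr0 //; apply/eqP.
have mV i := bmf_test_V i cf bf.
have mA i := bmc_bmf U_ok (bmc_test x i cf bf).
pose X i w := (x i == r)%:R * f (Vapp x i w).
have mX i : coord_bmf (coord_sets U k.+1) (vertex_coords i) (X i).
  by apply: bmf_scale; exact: bmc_test.
have mX1 i := bmc_bmf U_ok (mX i).
have EX i : EE x (X i) = (x i == r)%:R * phi.
  rewrite (condE_scale mE _ (mA i)); case: eqP => [xi|]; last by rewrite !mul0r.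
  by rewrite (phiE i xi).
pose Y w := n%:R^-1 * (\sum_i X i w - \sum_i EE x (X i)).
have mY : bmf Y.
  by apply: bmf_scale; apply: bmf_sub (bmf_cst _); exact: bmf_sum.
have Y2 : EE x (fun w => Y w ^+ 2) <= (eps / 4%:R) ^+ 2.
  apply: le_trans nn; under [X in EE x X]eq_fun do rewrite /Y exprMn.
  rewrite (condE_scale mE); last first.
    by under eq_fun do rewrite expr2; apply: bmf_mul; apply: bmf_sub (bmf_cst _);
      exact: bmf_sum.
  apply: (@le_trans _ _ (n%:R^-1 ^+ 2 * \sum_(i < n) C ^+ 2)).
    rewrite ler_wpM2l ?sqr_ge0 //.
    apply: le_trans (variance_sum U_ok x0 (@vertex_coords_disj n) mX) _.
    apply: ler_sum => i _; rewrite -[X in _ <= X](condE_cst mE x0).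
    apply: (condE_le mE x0).
    - by under eq_fun do rewrite expr2; exact: bmf_mul.
    - exact: bmf_cst.
    - move=> w _; rewrite -[X in X <= _]real_normK ?num_real // ler_sqr ?nnegrE //.
      rewrite normrM -[X in _ <= X]mul1r; apply: ler_pM => //.
      by case: eqP; rewrite ?normr1 ?normr0.
  rewrite sumr_const card_ord -[X in _ * X]mulr_natl.
  rewrite [X in X <= _](_ : _ = C ^+ 2 / n%:R) //; field; rewrite gt_eqF //.
have Y1 : EE x (fun w => `|Y w|) <= eps / 2%:R.
  apply: le_trans (L1_le_L2 U_ok x0 e4 mY) _.
  have : (eps / 4%:R)^-1 * EE x (fun w => Y w ^+ 2) <= eps / 4%:R.
    by rewrite ler_pdivrMl // -expr2.
  lra.
pose dv i w := `|f (V U k i w) - f (Vapp x i w)|.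
have mdv i : bmf (dv i) by apply: bmf_norm; exact: bmf_sub.
have msd : bmf (fun w => \sum_i dv i w) by exact: bmf_sum.
apply: (@le_trans _ _ (EE x (fun w => (n%:R^-1 * \sum_i dv i w + `|Y w|) +
    eps / 4%:R))).
  apply: (condE_le mE x0).
  - apply: bmf_norm; apply: bmf_sub (bmf_cst _); apply: bmf_scale.
    by apply: bmf_sum => i _; exact: bmf_mul (bmf_cst _).
  - apply: bmf_add (bmf_cst _); apply: bmf_add; first exact: bmf_scale.
    exact: bmf_norm.
  - move=> w _.
    rewrite (_ : _ - _ = n%:R^-1 * (\sum_i (x i == r)%:R *
        (f (V U k i w) - f (Vapp x i w))) + Y w + (freq x r - Defs.pi r) * phi).
      apply: le_trans (ler_normD _ _) _; apply: lerD; last first.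
        rewrite normrM; apply: (@le_trans _ _ (eps / 4%:R / (C + 1) * (C + 1))).
          by apply: ler_pM => //; lra.
        by rewrite divfK // gt_eqF // ltr_wpDl.
      apply: le_trans (ler_normD _ _) _; apply: lerD => //.
      rewrite normrM ger0_norm ?invr_ge0 // ler_wpM2l ?invr_ge0 //.
      apply: le_trans (ler_norm_sum _ _ _) _; apply: ler_sum => i _.
      rewrite normrM ler_piMl //; by case: eqP; rewrite ?normr1 ?normr0.
    rewrite /Y (eq_bigr _ (fun i _ => EX i)) -mulr_suml /freq /X.
    under [X in _ = _ * X + _ + _]eq_bigr do rewrite mulrBr.
    rewrite sumrB; under [X in _ * X - _]eq_bigr do rewrite mulrC.
    by ring.
have m1 : bmf (fun w => n%:R^-1 * \sum_i dv i w) by exact: bmf_scale.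
rewrite (condE_add mE (bmf_add m1 (bmf_norm mY)) (bmf_cst _)) (condE_cst mE x0).
rewrite (condE_add mE m1 (bmf_norm mY)) (condE_scale mE _ msd) (condE_sum mE x0) //.
have : n%:R^-1 * \sum_i EE x (dv i) <= eps / 4%:R; last by lra.
rewrite ler_pdivrMl //; apply: le_trans (ler_sum _ (fun i _ => tc i)) _.
by rewrite sumr_const card_ord -[X in X <= _]mulr_natl.
Qed.

End root_law.

(** An event that excludes the typical labels has vanishing probability. *)
Lemma typ_cvg0 (a : forall n, pred (labels S n)) :
  typ (fun n x => ~~ a n x) ->
  P [set w | a n (Jn U n w)] @[n --> \oo] --> 0%E.
Proof.
move=> [eta eta0 h]; apply/fine_cvgP; split.
  near=> n; apply: fin_num_measure; exact: (label_event_meas U_ok).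
apply/cvgr0Pnorm_le => e e0.
move: h (bad_labels_vanish U_ok eta0 e0); apply: filterS2 => n h1 h2.
rewrite /= ger0_norm ?fine_ge0 // (label_event_prob U_ok).
apply: le_trans h2; rewrite [X in _ <= X]big_mkcond [X in X <= _]big_mkcond /=.
apply: ler_sum => x _; case: ifP => [ax|_]; last by case: ifP => // _; exact: label_prob_ge0.
case: ifPn => // /negPn gx.
have [x0|x0] := boolP (0 < label_prob P U x).
  by rewrite label_prob_gt0 // in x0; have := h1 x x0 gx; rewrite ax.
by rewrite leNgt.
Unshelve. all: by end_near.
Qed.

(** Markov's inequality, conditionally on the labels. *)
Lemma typ_cvg_in_prob (X : nat -> Omega -> R) (Y : forall n, labels S n -> R) :
  (forall n, bmf (X n)) ->
  (forall eps : R, 0 < eps ->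
     typ (fun n x => EE x (fun w => `|X n w - Y n x|) <= eps)) ->
  cvg_in_prob P X (fun n w => Y n (Jn U n w)).
Proof.
move=> mX h eps eps0.
pose Bx n (x : labels S n) := [set w | eps <= `|X n w - Y n x|].
have mBx n x : measurable (Bx n x).
  have mf : measurable_fun setT (fun w => `|X n w - Y n x|).
    exact: (bmf_norm (bmf_sub (mX n) (bmf_cst (Y n x)))).1.
  rewrite (_ : Bx n x = (fun w => `|X n w - Y n x|) @^-1` [set` `[eps, +oo[ ]).
    by rewrite -[Z in measurable Z]setTI; exact: mf.
  by apply/seteqP; split=> w; rewrite /Bx /= in_itv /= andbT.
pose Bn n := [set w | eps <= `|X n w - Y n (Jn U n w)|].
have mBn n : measurable (Bn n).
  rewrite (_ : Bn n = \bigcup_(x in [set` (predT : pred (labels S n))])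
     (labels_are U x `&` Bx n x)).
    apply: fin_bigcup_measurable => // x _; apply: measurableI => //.
    exact: (labels_meas U_ok).
  apply/seteqP; split=> w /=; first by move=> hw; exists (Jn U n w).
  by move=> [x _ [hx]]; rewrite /Bn /Bx /= -hx.
apply/fine_cvgP; split; first by near=> n; apply: fin_num_measure; exact: mBn.
apply/cvgr0Pnorm_le => e e0.
have e2 : 0 < e / 2%:R by rewrite divr_gt0.
have [eta eta0 h'] := h _ (mulr_gt0 e2 eps0).
move: h' (bad_labels_vanish U_ok eta0 e2); apply: filterS2 => n h1 h2.
rewrite /= ger0_norm ?fine_ge0 // -/(Bn n).
have -> : fine (P (Bn n)) = \sum_(x : labels S n) label_prob P U x * EE x \1_(Bn n).
  rewrite -(int_labels U_ok predT (bmf_indic (mBn n))).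
  rewrite (_ : [set w | _] = setT); last by apply/seteqP; split.
  by rewrite /Rintegral integral_indic // setIT.
rewrite (bigID (fun x : labels S n => good eta x)) /=.
have ind1 (x : labels S n) : 0 < label_prob P U x -> EE x \1_(Bn n) <= 1.
  rewrite label_prob_gt0 // => x0; have mE := labels_meas U_ok x.
  rewrite -[Z in _ <= Z](condE_cst mE x0).
  apply: (condE_le mE x0); [exact: bmf_indic|exact: bmf_cst|].
  by move=> w _; rewrite indicE; case: (w \in _).
have lp0 (x : labels S n) : (0 < label_prob P U x) = false -> label_prob P U x = 0.
  by move=> hx; apply/eqP; rewrite eq_le label_prob_ge0 leNgt hx.
have -> : e = e / 2%:R + e / 2%:R by lra.
apply: lerD; last first.
  apply: le_trans h2; apply: ler_sum => x _.
  case hx : (0 < label_prob P U x); last by rewrite (lp0 x hx) mul0r.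
  by rewrite ler_piMr ?label_prob_ge0 // ind1.
apply: (@le_trans _ _ (\sum_(x : labels S n | good eta x) label_prob P U x * (e / 2%:R))).
  apply: ler_sum => x gx.
  case hx : (0 < label_prob P U x); last by rewrite (lp0 x hx) !mul0r.
  rewrite ler_pM2l //; rewrite label_prob_gt0 // in hx; have mE := labels_meas U_ok x.
  have mXY : bmf (fun w => `|X n w - Y n x|).
    by apply: bmf_norm; apply: bmf_sub => //; exact: bmf_cst.
  apply: (@le_trans _ _ (EE x (fun w => eps^-1 * `|X n w - Y n x|))).
    apply: (condE_le mE hx); [exact: bmf_indic|exact: bmf_scale|].
    move=> w xw; rewrite indicE; have [hw|hw] := boolP (w \in Bn n).
      rewrite inE in hw; move: hw; rewrite /Bn /= xw => hw.
      by rewrite ler_pdivlMl // mulr1.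
    by rewrite mulr_ge0 // invr_ge0 ltW.
  rewrite (condE_scale mE _ mXY) ler_pdivrMl // mulrC.
  exact: h1.
rewrite -mulr_suml -[Z in _ <= Z]mul1r ler_wpM2r ?(ltW e2) //.
rewrite -(sum_label_prob U_ok n) [Z in _ <= Z](bigID (fun x : labels S n => good eta x)) /=.
by rewrite lerDl; apply: sumr_ge0 => x _; exact: label_prob_ge0.
Unshelve. all: by end_near.
Qed.

End averaging.

(** * The limit theorem *)

Theorem theorem3p2 (R : realType) (S : opinion_params R) (S_ok : params_ok S)
  (theta_infty : theta S n @[n --> \oo] --> +oo)
  (d1 : measure_display) (Omega : measurableType d1) (P : probability Omega R)
  (U : opinion_inputs S Omega) (U_ok : is_opinion_model P U)
  (beta : 'I_(K S) -> 'I_(K S) -> R) (beta_ok : is_beta P U beta)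
  (Wbar Rbar : nat -> 'M[R]_(K S, l S))
  (Wbar_ok : is_label_mean P U (fun n i => W U i 0) Wbar)
  (Rbar_ok : is_label_mean P U (fun n i => R0 U i) Rbar)
  (k : nat)
  (d2 : measure_display) (Omega' : measurableType d2)
  (P' : probability Omega' R)
  (Jroot : forall n, labels S n -> Omega' -> 'I_(K S))
  (Rroot : forall n, labels S n -> 'I_k.+1 -> Omega' -> 'rV[R]_(l S))
  (root_ok : is_root P P' U beta Wbar Rbar Jroot Rroot) :
  (forall (r : 'I_(K S)) (f : 'M[R]_(l S, k.+1) -> R),
     bounded_function f -> continuous1 f ->
     cvg_in_prob P
       (fun n w => n%:R^-1 * \sum_(i < n) f (V U k i w) * (J U i w == r)%:R)
       (fun n w => \int[P']_w'
          (f (Vroot Rroot (Jn U n w) w') * (Jroot n (Jn U n w) w' == r)%:R)))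
  /\
  (forall (m : nat) (r : 'I_m -> 'I_(K S))
     (f : 'I_m -> 'M[R]_(l S, k.+1) -> R), (1 <= m)%N ->
     (forall j, bounded_function (f j)) -> (forall j, continuous1 (f j)) ->
     forall eps, 0 < eps ->
     P [set w | exists v : 'I_m -> 'I_n,
          [/\ injective v, forall j, J U (v j) w = r j &
            eps <= `| condE P (labels_are U (Jn U n w))
                        (fun w1 => \prod_j f j (V U k (v j) w1))
                      - \prod_j condE P' [set w' | Jroot n (Jn U n w) w' = r j]
                          (fun w' => f j (Vroot Rroot (Jn U n w) w')) |]]
       @[n --> \oo] --> 0%E).
Proof.
split=> [r f bf cf | m r f m1 bf cf eps e0].
  apply: (typ_cvg_in_prob U_ok (Y := fun n x => \int[P']_w'
    (f (Vroot Rroot x w') * (Jroot n x w' == r)%:R))).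
    move=> n; apply: bmf_scale; apply: bmf_sum => i _; apply: bmf_mul.
      exact: (bmf_test_V S_ok U_ok).
    apply: bmf_bool; rewrite (_ : [set w | _] = [set w | J U i w = r]).
      exact: (J_meas U_ok).
    by apply/seteqP; split=> w /= /eqP.
  move=> e e0; apply: typ_mono (average_test S_ok theta_infty U_ok beta_ok Wbar_ok
    Rbar_ok root_ok r bf cf e0) => n x x0.
  congr (_ <= _); apply: condE_ext => w xw; congr (`|_ * _ - _|).
  by apply: eq_bigr => i _; rewrite -xw /Jn ffunE.
pose a n : pred (labels S n) := fun x => `[< exists v : 'I_m -> 'I_n,
  [/\ injective v, forall j, x (v j) = r j &
      eps <= `| condE P (labels_are U x) (fun w1 => \prod_j f j (V U k (v j) w1))
        - \prod_j condE P' [set w' | Jroot n x w' = r j]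
            (fun w' => f j (Vroot Rroot x w')) |] >].
rewrite [X in X @ _ --> _](_ : _ = fun n => P [set w | a n (Jn U n w)]).
  apply: (typ_cvg0 U_ok).
  apply: typ_mono (product_test S_ok theta_infty U_ok beta_ok Wbar_ok Rbar_ok
    root_ok r bf cf e0) => n x x0 h.
  apply/negP => /asboolP[v [vi vr]]; rewrite leNgt => /negP; apply.
  exact: h.
apply/funext => n; congr (P _); apply/seteqP; split=> w /=.
  move=> [v [vi vr le]]; apply/asboolP; exists v; split=> // j.
  by rewrite /Jn ffunE.
move=> /asboolP[v [vi vr le]]; exists v; split=> // j.
by rewrite -(vr j) /Jn ffunE.
Qed.
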